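(* For every index $\boldsymbol{k}$, we have $$\zeta^{\star,\ast}_{\widehat{\mathcal{S}}}(\boldsymbol{k})\equiv\zeta^{\star,\mathrm{sh}}_{\widehat{\mathcal{S}}}(\boldsymbol{k})\equiv\zeta^{\star,KY}_{\widehat{\mathcal{S}}}(\boldsymbol{k})$$ in $(\mathcal{Z}/\zeta(2)\mathcal{Z})[[t]]$.
   Context: An index is a tuple $\boldsymbol{k}=(k_1,\dots,k_r)$ of positive integers ($r\ge 0$; $r=0$ gives the empty index $\varnothing$). It is admissible if it is empty or $k_r\ge 2$. For admissible $\boldsymbol{k}$, $\zeta(k_1,\dots,k_r)=\sum_{1\le n_1<\cdots<n_r}\frac{1}{n_1^{k_1}\cdots n_r^{k_r}}$, $\zeta(\varnothing)=1$. $\mathcal{Z}\subset\mathbb{R}$ is the $\mathbb{Q}$-linear span of $1$ and all multiple zeta values; it is a $\mathbb{Q}$-algebra. Let $\mathfrak{H}=\mathbb{Q}\langle x,y\rangle$, $\mathfrak{H}^1=\mathbb{Q}+y\mathfrak{H}\supset\mathfrak{H}^0=\mathbb{Q}+y\mathfrak{H}x$, $z_k=yx^{k-1}$, $z_{\boldsymbol{k}}=z_{k_1}\cdots z_{k_r}$. Let $Z:\mathfrak{H}^0\to\mathbb{R}$ be the $\mathbb{Q}$-linear map with $Z(z_{\boldsymbol{k}})=\zeta(\boldsymbol{k})$ for admissible $\boldsymbol{k}$. The harmonic product $\ast$ on $\mathfrak{H}^1$ is the $\mathbb{Q}$-bilinear product with $w\ast1=1\ast w=w$ and $w_1z_k\ast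 w_2z_l=(w_1\ast w_2z_l)z_k+(w_1z_k\ast w_2)z_l+(w_1\ast w_2)z_{k+l}$. The shuffle product $\mathrm{sh}$ on $\mathfrak{H}$ is the $\mathbb{Q}$-bilinear product with $w\,\mathrm{sh}\,1=1\,\mathrm{sh}\,w=w$ and $w_1u_1\,\mathrm{sh}\,w_2u_2=(w_1\,\mathrm{sh}\,w_2u_2)u_1+(w_1u_1\,\mathrm{sh}\,w_2)u_2$ for $u_1,u_2\in\{x,y\}$. For $\bullet\in\{\ast,\mathrm{sh}\}$, $Z$ is a homomorphism for $\bullet$ on $\mathfrak{H}^0$, $(\mathfrak{H}^1,\bullet)\cong(\mathfrak{H}^0,\bullet)[y]$, and $Z^{\bullet}:(\mathfrak{H}^1,\bullet)\to\mathbb{R}[T]$, $w\mapsto Z^\bullet(w;T)$, is the unique $\mathbb{Q}$-algebra homomorphism extending $Z$ with $Z^{\bullet}(y;T)=T$; its image lies in $\mathcal{Z}[T]$. Put $\zeta^{\bullet}(\boldsymbol{k})=Z^{\bullet}(z_{\boldsymbol{k}};0)$ and $$\zeta^{\star,\bullet}(k_1,\dots,k_r)=\sum_{\square=\text{`,' or `+'}}\zeta^{\bullet}(k_1\square\cdots\square k_r)\qquad(\bullet\in\{\ast,\mathrm{sh}\}),$$ the sum being over all $2^{r-1}$ ways to replace each $\square$ by a comma or a plus sign (and $\zeta^{\star,\bullet}(\varnothing)=1$). Kaneko–Yamamoto regularization: a 2-poset is a finite poset $X$ with a label map $\delta_X:X\to\{x,y\}$. Put $W(X)=\sum_f \delta_X(f^{-1}(1))\cdots\delta_X(f^{-1}(\#X))\in\mathfrak{H}$,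 summed over all bijections $f:X\to\{1,\dots,\#X\}$ such that $p<q$ implies $f(p)<f(q)$ ($W(\varnothing)=1$). For $\boldsymbol{k}=(k_1,\dots,k_r)$, let $X^\star(\boldsymbol{k})$ be the 2-poset with elements $p_{i,m}$ ($1\le i\le r$, $1\le m\le k_i$), with order generated by $p_{i,1}<p_{i,2}<\cdots<p_{i,k_i}$ for each $i$ and $p_{i,1}<p_{i+1,k_{i+1}}$ for $1\le i\le r-1$, and with $p_{i,1}$ labelled $y$ and $p_{i,m}$ ($m\ge2$) labelled $x$. Put $w^\star(\boldsymbol{k})=W(X^\star(\boldsymbol{k}))\in\mathfrak{H}^1$ and $\zeta^{\star,KY}(\boldsymbol{k})=Z^{\mathrm{sh}}(w^\star(\boldsymbol{k});0)\in\mathcal{Z}$. For $\bullet\in\{\ast,\mathrm{sh},KY\}$ the $t$-adic symmetric multiple zeta-star values are the elements of $\mathcal{Z}[[t]]$ $$\zeta_{\widehat{\mathcal{S}}}^{\star,\bullet}(k_1,\dots,k_r)=\sum_{i=0}^{r}(-1)^{k_{i+1}+\cdots+k_r}\zeta^{\star,\bullet}(k_1,\ldots,k_i)\sum_{l_{i+1},\ldots,l_r\ge0}\ \prod_{j=i+1}^r\binom{k_j+l_j-1}{l_j}\,\zeta^{\star,\bullet}(k_r+l_r,\ldots,k_{i+1}+l_{i+1})\,t^{l_{i+1}+\cdots+l_r}.$$ *)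

(* Defs.v *)
From HB Require Import structures.
From mathcomp Require Import all_boot all_order all_algebra.
From mathcomp Require Import finmap.
From mathcomp.multinomials Require Import monalg.
From mathcomp Require Import boolp classical_sets reals constructive_ereal esum.

Set Implicit Arguments.
Unset Strict Implicit.
Unset Printing Implicit Defensive.

Import Order.TTheory GRing.Theory Num.Theory.

Local Open Scope classical_set_scope.
Local Open Scope ring_scope.

Definition is_index (k : seq nat) : bool := all (leq 1) k.

(* The default value 2 of [last] makes the empty index admissible. *)
Definition admissible (k : seq nat) : bool := is_index k && (1 < last 2 k)%N.

(* [path ltn 0 n] says 0 < n_1 < ... < n_r.  The terms are nonnegative, so the
   sum is taken unconditionally in the extended reals; it is finite when [k] is
   admissible. *)
Definition zeta (R : realType) (k : seq nat) : R :=
  fine (\esum_(n in [set n : seq nat | size n = size k /\ path ltn 0%N n])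
          (\prod_(p <- zip n k) (p.1%:R : R) ^- p.2)%:E).

Definition MZV_span (R : realType) : set R :=
  [set a | exists s : seq (rat * seq nat),
     all (fun p => admissible p.2) s /\
     a = \sum_(p <- s) ratr p.1 * zeta R p.2].

Definition eqmod_zeta2 (R : realType) (a b : R) : Prop :=
  [/\ MZV_span a, MZV_span b & exists2 c, MZV_span c & a - b = zeta R [:: 2%N] * c].

(* A power series is given by its sequence of coefficients. *)
Definition series_eqmod_zeta2 (R : realType) (a b : nat -> R) : Prop :=
  forall n, eqmod_zeta2 (a n) (b n).

Notation letter := bool (only parsing).
Definition lx : letter := false.
Definition ly : letter := true.

(* The algebra Q<x, y>. *)
Definition Hoff : lalgType rat := {malg rat[{fmonom letter}]}.

Definition wmon (s : seq letter) : Hoff := << FMonom s >>.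

Definition Hx : Hoff := wmon [:: lx].
Definition Hy : Hoff := wmon [:: ly].
Definition Hz (k : nat) : Hoff := Hy * Hx ^+ k.-1.
Definition zword (k : seq nat) : Hoff := \prod_(i <- k) Hz i.

Definition Hoff1 : set Hoff :=
  [set w | exists (c : rat) (v : Hoff), w = c%:A + Hy * v].
Definition Hoff0 : set Hoff :=
  [set w | exists (c : rat) (v : Hoff), w = c%:A + Hy * v * Hx].

(* Reads the word z_{k_1} ... z_{k_r} from left to right and returns
   [:: k_r; ...; k_1].  The value on words starting with x is irrelevant. *)
Definition rev_index (u : seq letter) : seq nat :=
  foldl (fun k a => if a == ly then 1%N :: k else (head 0%N k).+1 :: behead k)
        [::] u.

Definition Zmap (R : realType) (w : Hoff) : R :=
  \sum_(u <- msupp w) ratr w@_u * zeta R (rev (rev_index u)).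

Definition bilinear_ext (op : seq letter -> seq letter -> Hoff) (a b : Hoff) :
  Hoff :=
  \sum_(u <- msupp a) \sum_(v <- msupp b) (a@_u * b@_v) *: op u v.

(* The products are defined by recursion on the last letter, hence on reversed
   lists. *)
Fixpoint harm_rev (s : seq nat) : seq nat -> Hoff :=
  fix harm_rev_s (t : seq nat) : Hoff :=
    match s, t with
    | [::], _ => zword (rev t)
    | _, [::] => zword (rev s)
    | k :: s', l :: t' =>
        harm_rev s' t * Hz k + harm_rev_s t' * Hz l
        + harm_rev s' t' * Hz (k + l)%N
    end.

(* Meaningful on Hoff1 only. *)
Definition harm : Hoff -> Hoff -> Hoff :=
  bilinear_ext (fun u v => harm_rev (rev_index u) (rev_index v)).

Fixpoint sh_rev (s : seq letter) : seq letter -> Hoff :=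
  fix sh_rev_s (t : seq letter) : Hoff :=
    match s, t with
    | [::], _ => wmon (rev t)
    | _, [::] => wmon (rev s)
    | a :: s', b :: t' => sh_rev s' t * wmon [:: a] + sh_rev_s t' * wmon [:: b]
    end.

Definition sh : Hoff -> Hoff -> Hoff :=
  bilinear_ext (fun u v => sh_rev (rev u) (rev v)).

Record is_regularization (R : realType) (mul : Hoff -> Hoff -> Hoff)
    (f : Hoff -> {poly R}) : Prop := IsRegularization {
  reg_linear : forall (c : rat) u v, Hoff1 u -> Hoff1 v ->
    f (c *: u + v) = (ratr c : R) *: f u + f v;
  reg_mul : forall u v, Hoff1 u -> Hoff1 v -> f (mul u v) = f u * f v;
  reg_H0 : forall w, Hoff0 w -> f w = (Zmap R w)%:P;
  reg_Y : f Hy = 'X }.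

(* The homomorphism is unique on Hoff1; its values outside Hoff1 are never used. *)
Definition Zreg (R : realType) (mul : Hoff -> Hoff -> Hoff) :
  Hoff -> {poly R} :=
  xget (fun=> 0) [set f | is_regularization mul f].

Definition zeta_reg (R : realType) (mul : Hoff -> Hoff -> Hoff)
    (k : seq nat) : R :=
  (Zreg R mul (zword k)).[0].

(* The 2^(r-1) indices k_1 [] ... [] k_r with each [] a comma or a plus, for
   (k_1, ..., k_r) = k1 :: k. *)
Fixpoint comma_plus (k1 : nat) (k : seq nat) : seq (seq nat) :=
  if k is k2 :: k' then
    [seq k1 :: m | m <- comma_plus k2 k'] ++ comma_plus (k1 + k2)%N k'
  else [:: [:: k1]].

Definition zeta_star_reg (R : realType) (mul : Hoff -> Hoff -> Hoff)
    (k : seq nat) : R :=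
  if k is k1 :: k' then \sum_(m <- comma_plus k1 k') zeta_reg R mul m else 1.

(* [g] is the inverse of the bijection f : P -> {1, ..., #P}. *)
Definition poset_word (d : Order.disp_t) (P : finPOrderType d)
    (delta : P -> letter) : Hoff :=
  \sum_(g : {ffun 'I_#|P| -> P} |
        injectiveb g && [forall i, forall j, (g i < g j)%O ==> (i < j)%N])
    wmon [seq delta (g i) | i <- enum 'I_#|P|].

(* The element p_{i,m} is [Tagged _ (m - 1)] with tag [i - 1]. *)
Definition star_poset (k : seq nat) : Type :=
  {i : 'I_(size k) & 'I_(nth 0%N k i)}.

HB.instance Definition _ (k : seq nat) :=
  Finite.copy (star_poset k) {i : 'I_(size k) & 'I_(nth 0%N k i)}.

Section StarPoset.
Variable k : seq nat.
Implicit Types p q : star_poset k.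

Definition star_gen : rel (star_poset k) := fun p q =>
  ((tag q == tag p :> nat) && (tagged q == (tagged p).+1 :> nat)) ||
  [&& tag q == (tag p).+1 :> nat, tagged p == 0%N :> nat &
      (tagged q).+1 == nth 0%N k (tag q)].

Definition star_le : rel (star_poset k) := connect star_gen.

Definition star_rank p : nat := (tag p + tagged p)%N.

Lemma star_gen_rank p q : star_gen p q -> (star_rank p < star_rank q)%N.
Proof.
rewrite /star_gen /star_rank => /orP[/andP[/eqP e1 /eqP e2]|].
  by rewrite [X in (_ < X + _)%N]e1 e2 addnS.
case/and3P => /eqP e1 /eqP-> _.
by rewrite [X in (_ < X + _)%N]e1 addn0 leq_addr.
Qed.

Lemma star_le_rank p q : star_le p q -> p = q \/ (star_rank p < star_rank q)%N.
Proof.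
case/connectP => s; elim: s p => [|a s IHs] p /=; first by left.
case/andP => /star_gen_rank pa as_ /(IHs _ as_)[<-|aq]; right=> //.
exact: ltn_trans aq.
Qed.

Lemma star_le_refl : reflexive star_le. Proof. exact: connect0. Qed.

Lemma star_le_anti : antisymmetric star_le.
Proof.
move=> p q /andP[/star_le_rank[//|pq] /star_le_rank[//|qp]].
by have := ltn_trans pq qp; rewrite ltnn.
Qed.

Lemma star_le_trans : transitive star_le. Proof. exact: connect_trans. Qed.
End StarPoset.

Fact star_display : Order.disp_t. Proof. exact: Order.Disp tt tt. Qed.

HB.instance Definition _ (k : seq nat) :=
  Order.Le_isPOrder.Build star_display (star_poset k)
    (@star_le_refl k) (@star_le_anti k) (@star_le_trans k).

Definition star_label (k : seq nat) (p : star_poset k) : letter :=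
  if tagged p == 0%N :> nat then ly else lx.

Definition wstar (k : seq nat) : Hoff :=
  @poset_word star_display (star_poset k) (@star_label k).

Definition zeta_star_KY (R : realType) (k : seq nat) : R :=
  (Zreg R sh (wstar k)).[0].

(* Coefficient of t^n.  Each l_j in the inner sum is at most n, so (l_{i+1},
   ..., l_r) ranges over tuples in 'I_n.+1 with sum n. *)
Definition symm_star (R : realType) (zs : seq nat -> R) (k : seq nat)
    (n : nat) : R :=
  \sum_(i < (size k).+1)
    (-1) ^+ sumn (drop i k) * zs (take i k) *
    \sum_(l : (size k - i).-tuple 'I_n.+1 | (\sum_(a <- l) a)%N == n)
      let s := zip (drop i k) (map val l) in
      (\prod_(p <- s) 'C(p.1 + p.2 - 1, p.2))%:R *
      zs (rev [seq (p.1 + p.2)%N | p <- s]).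

(* Main.v *)
(* A regularization is determined by a character of a quasi-shuffle product on
   words (lists with the last letter first): a polynomial in T is built from the
   values of the character by formal integration in the number of leading
   letters [y].  The harmonic values come from truncated sums, the shuffle values
   from power series of multiple polylogarithms.  Comparing the generating series
   over leading 1's gives [zeta^*(1^m t) = sum_j C_j zeta^sh(1^(m-j) t)], where
   [C(u) = exp(sum_(i >= 2) (-1)^(i-1) zeta(i) u^i / i)]; so [C(u) C(-u) = 1]
   modulo [zeta(2)], since the even zeta values are multiples of [zeta(2)] by
   Euler's recursion.

   The relation passes to the star values, [zeta^{star,*}] being the [twist] of
   [zeta^{star,sh}] by [C(u)].  The Kaneko-Yamamoto star values satisfy the
   antipode relation with [zeta^sh] (compare p_{i,1} with the top p_{i+1,k_{i+1}}
   of the next chain), as [zeta^{star,*}] does with [zeta^*]; hence they are the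
   [twist] of [zeta^{star,*}] by [C(-u)].  Twisting by [d(u)] both factors of the
   symmetric sum multiplies the terms by the coefficients of [d(u) d(-u)], which
   vanish modulo [zeta(2)] in positive degree. *)

From HB Require Import structures.
From mathcomp Require Import all_boot all_order all_algebra.
From mathcomp Require Import finmap.
From mathcomp.multinomials Require Import monalg.
From mathcomp Require Import boolp classical_sets cardinality fsbigop reals constructive_ereal.
From mathcomp Require Import ereal topology normedtype sequences esum.
From mathcomp Require Import ring lra zify.
Require Import Defs.

Set Implicit Arguments.
Unset Strict Implicit.
Unset Printing Implicit Defensive.

Import Order.TTheory GRing.Theory Num.Theory.
Import numFieldNormedType.Exports.

Local Open Scope ring_scope.

(** * Formal power series *)

(** [Zreg] is chosen by [xget] among all regularizations, so nothing is known of its values before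
    one regularization has been exhibited and shown unique on H^1. The obstacle is that truncated
    values diverge on words with leading [y]. Replacing a character by the value at T = tau of its
    regularization polynomial keeps it multiplicative for every tau, and multiplies its generating
    series over leading [y] by exp(tau u). With tau the opposite of the value of [y] itself (a
    harmonic number, or the series -log(1 - z)), the limit exists and is a character that kills [y].
    Both limits involve the same series: over leading ones, the shuffle values have generating
    series [Ginf t] and the harmonic values have [Cinf * Ginf t]. The two regularizations are
    thereby compared without the Gamma function or asymptotic expansions, and [Cinf] is controlled
    through its logarithmic derivative. Evenness enters only there: Euler's recursion is derived
    from finite double sums, so that the value of zeta(2) is never computed. *)

Definition fps (A : comNzRingType) : Type := nat -> A.

HB.instance Definition _ (A : comNzRingType) := Choice.copy (fps A) (nat -> A).

Section FormalPowerSeries.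
Variable A : comNzRingType.
Implicit Types f g h : fps A.

Definition fps_add f g : fps A := fun n => f n + g n.
Definition fps_opp f : fps A := fun n => - f n.
Definition fps_zero : fps A := fun=> 0.

Fact fps_addA : associative fps_add.
Proof. by move=> f g h; apply/funext => n; rewrite /fps_add addrA. Qed.
Fact fps_addC : commutative fps_add.
Proof. by move=> f g; apply/funext => n; rewrite /fps_add addrC. Qed.
Fact fps_add0 : left_id fps_zero fps_add.
Proof. by move=> f; apply/funext => n; rewrite /fps_add add0r. Qed.
Fact fps_addN : left_inverse fps_zero fps_opp fps_add.
Proof. by move=> f; apply/funext => n; rewrite /fps_add addNr. Qed.

HB.instance Definition _ :=
  GRing.isZmodule.Build (fps A) fps_addA fps_addC fps_add0 fps_addN.

Definition fps_mul f g : fps A := fun n => \sum_(i < n.+1) f i * g (n - i)%N.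
Definition fpsC (a : A) : fps A := fun n => a *+ (n == 0%N).

(** A coefficient of a product depends on finitely many coefficients, so the ring axioms can be
    inherited from truncations in [{poly A}]. *)
Lemma fps_mul_poly N f g n : (n <= N)%N ->
  fps_mul f g n = (\poly_(i < N.+1) f i * \poly_(i < N.+1) g i)`_n.
Proof.
move=> nN; rewrite coefM; apply: eq_bigr => i _; rewrite !coef_poly.
rewrite !ltnS (leq_trans _ nN) ?(leq_ord i) //.
by rewrite (leq_trans _ nN) ?leq_subr.
Qed.

Lemma fps_truncM N f g :
  \poly_(i < N.+1) fps_mul f g i
  = take_poly N.+1 (\poly_(i < N.+1) f i * \poly_(i < N.+1) g i).
Proof.
apply/polyP => i; rewrite coef_poly coef_take_poly; case: ltnP => // iN.
by rewrite (fps_mul_poly f g (N := N)).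
Qed.

Fact fps_mulC : commutative fps_mul.
Proof.
by move=> f g; apply/funext => n; rewrite !(fps_mul_poly _ _ (leqnn n)) mulrC.
Qed.

Lemma fps_mul_trunc f g n :
  fps_mul f g n = (\poly_(i < n.+1) f i * \poly_(i < n.+1) g i)`_n.
Proof. exact: fps_mul_poly. Qed.

Lemma coef_mul_take N (p q : {poly A}) n : (n < N)%N ->
  (take_poly N p * q)`_n = (p * q)`_n.
Proof.
move=> nN; rewrite !coefM; apply: eq_bigr => i _.
by rewrite coef_take_poly (leq_ltn_trans (leq_ord i) nN).
Qed.

Fact fps_mulA : associative fps_mul.
Proof.
move=> f g h; apply/funext => n; rewrite !(fps_mul_trunc _ _ n) !fps_truncM.
by rewrite coef_mul_take // mulrC coef_mul_take // mulrC mulrA.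
Qed.

Fact fps_mul1 : left_id (fpsC 1) fps_mul.
Proof.
move=> f; apply/funext => n; rewrite /fps_mul big_ord_recl /fpsC mul1r subn0.
by rewrite big1 ?addr0 // => i _; rewrite mul0r.
Qed.

Fact fps_mulDl : left_distributive fps_mul +%R.
Proof.
move=> f g h; apply/funext => n; transitivity (fps_mul f h n + fps_mul g h n) => //.
by rewrite /fps_mul -big_split /=; apply: eq_bigr => i _; rewrite mulrDl.
Qed.

Fact fps_oner_neq0 : fpsC 1 != 0.
Proof.
apply/eqP => /(congr1 (fun f => f 0%N)); rewrite /fpsC mulr1n => /eqP.
by rewrite oner_eq0.
Qed.

HB.instance Definition _ := GRing.Zmodule_isComNzRing.Build (fps A)
  fps_mulA fps_mulC fps_mul1 fps_mulDl fps_oner_neq0.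

Lemma fpsDE f g n : (f + g) n = f n + g n. Proof. by []. Qed.
Lemma fpsNE f n : (- f) n = - f n. Proof. by []. Qed.
Lemma fps0E n : (0 : fps A) n = 0. Proof. by []. Qed.
Lemma fps1E n : (1 : fps A) n = (n == 0%N)%:R. Proof. by []. Qed.
Lemma fpsME f g n : (f * g) n = \sum_(i < n.+1) f i * g (n - i)%N.
Proof. by []. Qed.
Lemma fps_sumE I (r : seq I) (P : pred I) (F : I -> fps A) n :
  (\sum_(i <- r | P i) F i) n = \sum_(i <- r | P i) F i n.
Proof. by elim/big_rec2: _ => // i x y _ <-. Qed.
Lemma fpsMnE f m n : (f *+ m) n = f n *+ m.
Proof. by elim: m => // m IHm; rewrite !mulrS -IHm. Qed.

Lemma fpsP f g : (forall n, f n = g n) -> f = g.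
Proof. by move=> fg; apply/funext. Qed.

Lemma fpsCM a f n : (fpsC a * f) n = a * f n.
Proof.
rewrite fpsME big_ord_recl subn0 big1 ?addr0 // => i _.
by rewrite /fpsC mul0r.
Qed.

Definition fpsX : fps A := fun n => (n == 1%N)%:R.

Lemma fpsXM0 f : (fpsX * f) 0%N = 0.
Proof. by rewrite fpsME big_ord1 mul0r. Qed.

Lemma fpsXMS f n : (fpsX * f) n.+1 = f n.
Proof.
rewrite fpsME !big_ord_recl /fpsX mul0r add0r mul1r subn1 big1 ?addr0 //.
by move=> i _; rewrite mul0r.
Qed.

(** The Euler operator u d/du. Unlike the derivative it does not shift degrees; over the reals a
    series is determined by its image and its constant term. *)
Definition fps_theta f : fps A := fun n => f n *+ n.

Lemma fps_thetaD f g : fps_theta (f + g) = fps_theta f + fps_theta g.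
Proof. by apply: fpsP => n; rewrite /fps_theta !fpsDE mulrnDl. Qed.

Lemma fps_thetaM f g : fps_theta (f * g) = fps_theta f * g + f * fps_theta g.
Proof.
apply: fpsP => n; rewrite /fps_theta fpsDE !fpsME -sumrMnl -big_split /=.
apply: eq_bigr => i _; rewrite mulrnAl mulrnAr -mulrnDr subnKC //.
exact: leq_ord.
Qed.

Definition fps_neg f : fps A := fun n => (-1) ^+ n * f n.

Lemma fps_negM f g : fps_neg (f * g) = fps_neg f * fps_neg g.
Proof.
apply: fpsP => n; rewrite /fps_neg !fpsME mulr_sumr; apply: eq_bigr => i _.
by rewrite mulrACA -exprD subnKC // leq_ord.
Qed.

Lemma fps_neg_theta f : fps_theta (fps_neg f) = fps_neg (fps_theta f).
Proof. by apply: fpsP => n; rewrite /fps_theta /fps_neg mulrnAr. Qed.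

End FormalPowerSeries.

(** * Quasi-shuffle products of words *)

Section QuasiShuffle.
Variables (T : eqType) (c : T -> T -> seq T).
Implicit Types (s t w : seq T).

(* Words are written with the outermost (last) letter first, since the products
   are defined by recursion on the last letter; [c a b] lists the contractions
   of [a] and [b] (none for the shuffle product). *)
Fixpoint qsh s : seq T -> seq (seq T) :=
  fix qsh_s t : seq (seq T) :=
    match s, t with
    | [::], _ => [:: t]
    | _, [::] => [:: s]
    | a :: s', b :: t' =>
        [seq a :: w | w <- qsh s' t] ++ [seq b :: w | w <- qsh_s t'] ++
        [seq z :: w | z <- c a b, w <- qsh s' t']
    end.

Lemma qsh0s t : qsh [::] t = [:: t]. Proof. by case: t. Qed.
Lemma qshs0 s : qsh s [::] = [:: s]. Proof. by case: s. Qed.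
Lemma qsh_cons a s b t : qsh (a :: s) (b :: t) =
  [seq a :: w | w <- qsh s (b :: t)] ++ [seq b :: w | w <- qsh (a :: s) t] ++
  [seq z :: w | z <- c a b, w <- qsh s t].
Proof. by []. Qed.

Lemma big_qsh_cons (M : nmodType) (F : seq T -> M) a s b t :
  \sum_(w <- qsh (a :: s) (b :: t)) F w =
    \sum_(w <- qsh s (b :: t)) F (a :: w) +
    \sum_(w <- qsh (a :: s) t) F (b :: w) +
    \sum_(z <- c a b) \sum_(w <- qsh s t) F (z :: w).
Proof.
by rewrite qsh_cons !big_cat /= !big_map big_allpairs_dep /= addrA.
Qed.

Definition is_char (V : pred (seq T)) (A : comNzRingType) (chi : seq T -> A) :=
  forall s t, V s -> V t -> chi s * chi t = \sum_(w <- qsh s t) chi w.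

(** [V] selects the words of H^1 and [y] is the letter sent to T. By [dom_contr] no contraction
    produces [y], which makes the removal of a leading [y] a derivation of the quasi-shuffle
    product. *)
Record domain (V : pred (seq T)) (y : T) : Prop := Domain {
  dom_nil : V [::];
  dom_y : forall s, V s -> V (y :: s);
  dom_tail : forall a s, V (a :: s) -> V s;
  dom_qsh : forall s t w, V s -> V t -> w \in qsh s t -> V w;
  dom_contr : forall a s b t, V (a :: s) -> V (b :: t) -> y \notin c a b }.

End QuasiShuffle.

Arguments qsh : simpl never.

(** * Formal antiderivatives and the regularization polynomial *)

Section Antiderivative.
Variables (A : comNzRingType) (iv : nat -> A).
Hypothesis ivP : forall n, n.+1%:R * iv n = 1.

(** The inverses of the positive integers are supplied as [iv] because the coefficients are taken
    both in the reals and in the power series over them, which do not form a field. *)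
Definition integral (p : {poly A}) : {poly A} :=
  \poly_(i < (size p).+1) if i is j.+1 then iv j * p`_j else 0.

Lemma coef_integral p i : (integral p)`_i = if i is j.+1 then iv j * p`_j else 0.
Proof.
rewrite coef_poly; case: i => [|j] //; rewrite ltnS.
by case: ltnP => // ?; rewrite nth_default // mulr0.
Qed.

Lemma deriv_integral p : (integral p)^`() = p.
Proof.
apply/polyP => i; rewrite coef_deriv coef_integral -mulr_natl mulrA ivP.
by rewrite mul1r.
Qed.

Lemma integral0 p : (integral p).[0] = 0.
Proof. by rewrite horner_coef0 coef_integral. Qed.

Lemma poly_deriv_inj (p q : {poly A}) : p^`() = q^`() -> p.[0] = q.[0] -> p = q.
Proof.
move=> dpq; rewrite !horner_coef0 => pq0; apply/polyP => -[//|i].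
move/(congr1 (fun r : {poly A} => iv i * r`_i)): dpq.
have ivK x : iv i * (x *+ i.+1) = x.
  by rewrite -[x *+ _]mulr_natl mulrA (mulrC (iv i)) ivP mul1r.
by rewrite !coef_deriv !ivK.
Qed.

End Antiderivative.

Section RegularizationPolynomial.
Variables (T : eqType) (c : T -> T -> seq T) (V : pred (seq T)) (y : T).
Hypothesis domV : domain c V y.
Variables (A : comNzRingType) (iv : nat -> A) (chi : seq T -> A).
Hypothesis ivP : forall n, n.+1%:R * iv n = 1.
Implicit Types (s t w : seq T).

(* The polynomial [\sum_j chi (d^j s) 'X^j / j!], where [d] removes a leading
   [y] and kills the words that do not start with [y].  As [d] is a derivation,
   this is multiplicative when [chi] is. *)
Fixpoint reg_poly s : {poly A} :=
  if s is a :: s' then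
    (chi s)%:P + (if a == y then integral iv (reg_poly s') else 0)
  else (chi s)%:P.
Arguments reg_poly : simpl never.

Lemma reg_poly_nil : reg_poly [::] = (chi [::])%:P. Proof. by []. Qed.

Lemma reg_poly_cons a s : reg_poly (a :: s) =
  (chi (a :: s))%:P + (if a == y then integral iv (reg_poly s) else 0).
Proof. by []. Qed.

Definition dreg_poly s : {poly A} :=
  if s is a :: s' then if a == y then reg_poly s' else 0 else 0.

Lemma deriv_reg_poly s : (reg_poly s)^`() = dreg_poly s.
Proof.
case: s => [|a s]; first exact: derivC.
rewrite reg_poly_cons derivD derivC add0r /=; case: eqP => _.
  exact: deriv_integral.
exact: linear0.
Qed.

Lemma reg_poly0 s : (reg_poly s).[0] = chi s.
Proof.
case: s => [|a s]; first by rewrite hornerC.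
rewrite reg_poly_cons hornerD hornerC; case: eqP => _; rewrite ?integral0 ?horner0 addr0 //.
Qed.

(** Both sides have the same value at 0, as [chi] is a character. Their derivatives agree by
    induction on the total length: differentiation removes a leading [y], which obeys the Leibniz
    rule, and contracted letters are never [y]. *)
Lemma reg_polyM : chi [::] = 1 -> is_char c V chi -> is_char c V reg_poly.
Proof.
move=> chi1 chiM.
suff H n s t : (size s + size t <= n)%N -> V s -> V t ->
    reg_poly s * reg_poly t = \sum_(w <- qsh c s t) reg_poly w.
  by move=> s t; apply: H (leqnn _).
elim: n s t => [|n IHn] s t.
  case: s t => [|//] [|//] _ _ _.
  by rewrite qsh0s big_seq1 reg_poly_nil chi1 mul1r.
case: s => [|a s]; first by rewrite qsh0s big_seq1 reg_poly_nil chi1 mul1r.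
case: t => [|b t]; first by rewrite qshs0 big_seq1 reg_poly_nil chi1 mulr1.
move=> /= st Vs Vt; have {}st : (size s + size t < n)%N by lia.
apply: (poly_deriv_inj ivP); last first.
  rewrite hornerM !reg_poly0 chiM // horner_sum; apply: eq_bigr => w _; exact/esym/reg_poly0.
rewrite derivM !deriv_reg_poly [RHS]linear_sum /=.
under eq_bigr => w _ do rewrite deriv_reg_poly.
rewrite (big_qsh_cons c dreg_poly) /=.
have -> : \sum_(z <- c a b) \sum_(w <- qsh c s t)
    (if z == y then reg_poly w else 0) = 0.
  rewrite big_seq big1 // => z zc; rewrite big1 // => w _.
  by case: eqP => // zy; rewrite zy (negPf (dom_contr domV Vs Vt)) in zc.
rewrite addr0; congr (_ + _); case: eqP => _.
- rewrite IHn //=; [lia|exact: (dom_tail domV Vs)].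
- by rewrite mul0r big1.
- rewrite IHn //=; exact: (dom_tail domV Vt).
- by rewrite mulr0 big1.
Qed.

Lemma reg_poly_horner tau : chi [::] = 1 -> is_char c V chi ->
  is_char c V (fun s => (reg_poly s).[tau]).
Proof.
move=> chi1 chiM s t Vs Vt; rewrite -hornerM reg_polyM //; exact: horner_sum.
Qed.

Definition fact_inv j : A := \prod_(i < j) iv i.

Lemma reg_polyE m s : ohead s != Some y -> reg_poly (nseq m y ++ s) =
  \poly_(j < m.+1) (fact_inv j * chi (nseq (m - j) y ++ s)).
Proof.
move=> hs; elim: m => [|m IHm].
  apply/polyP => i; rewrite coef_poly; case: s hs => [|a s] /= hs.
    by rewrite reg_poly_nil coefC; case: i => [|i] //=; rewrite /fact_inv big_ord0 mul1r.
  have /negPf ay : a != y by apply: contra hs => /eqP->.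
  by rewrite reg_poly_cons ay addr0 coefC; case: i => [|i] //=; rewrite /fact_inv big_ord0 mul1r.
rewrite [nseq _ _ ++ _]/= reg_poly_cons eqxx; apply/polyP => i; rewrite coefD coefC coef_integral coef_poly.
case: i => [|i] /=; first by rewrite addr0 /fact_inv big_ord0 mul1r.
rewrite add0r IHm coef_poly !ltnS subSS; case: leqP => _; last by rewrite mulr0.
by rewrite /fact_inv big_ord_recr /= mulrA [iv i * _]mulrC.
Qed.

(** The right-hand side is the coefficient of u^m in exp(tau u) times the generating series of [chi]
    over leading [y]. The hypothesis makes [m] the exact number of leading [y]. *)
Lemma reg_poly_hornerE m s tau : ohead s != Some y ->
  (reg_poly (nseq m y ++ s)).[tau] =
  \sum_(j < m.+1) fact_inv j * tau ^+ j * chi (nseq (m - j) y ++ s).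
Proof.
move=> hs; rewrite reg_polyE // horner_poly; apply: eq_bigr => j _.
by rewrite mulrAC.
Qed.

End RegularizationPolynomial.

(* Multiplying by [y] raises the number of leading [y]'s by one, up to words
    with fewer leading [y]'s. *)
Section LeadingLetters.
Variables (T : eqType) (c : T -> T -> seq T) (V : pred (seq T)) (y : T).
Hypothesis domV : domain c V y.

Fixpoint lead (s : seq T) : nat :=
  if s is a :: s' then if a == y then (lead s').+1 else 0 else 0.

Lemma qsh_y s : V s -> exists2 r,
  perm_eq (qsh c [:: y] s) (nseq (lead s).+1 (y :: s) ++ r) &
  forall w, w \in r -> (lead w <= lead s)%N.
Proof.
have Vy : V [:: y] by exact: dom_y domV _ (dom_nil domV).
elim: s => [|a s IHs] Vs; first by exists [::].
have [r rE rP] := IHs (dom_tail domV Vs).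
have leadc w : w \in [seq z :: w | z <- c y a, w <- qsh c [::] s] ->
    lead w = 0%N.
  move=> /allpairsPdep[z [w' [zc _ ->]]] /=.
  by case: eqP => // zy; rewrite zy (negPf (dom_contr domV Vy Vs)) in zc.
rewrite qsh_cons qsh0s [lead (a :: s)]/=; case: (eqVneq a y) => ay; last first.
  exists ([seq a :: w | w <- qsh c [:: y] s] ++
          [seq z :: w | z <- c y a, w <- qsh c [::] s]).
    by [].
  move=> w; rewrite mem_cat => /orP[/mapP[w' _ ->] /=|/leadc-> //].
  by rewrite (negPf ay).
exists ([seq a :: w | w <- r] ++
        [seq z :: w | z <- c y a, w <- qsh c [::] s]); last first.
  move=> w; rewrite mem_cat => /orP[/mapP[w' /rP w'r ->] /=|/leadc-> //].
  by rewrite ay eqxx ltnS.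
subst a; apply: (@perm_trans _ ([:: y :: y :: s] ++
    [seq y :: w | w <- nseq (lead s).+1 (y :: s) ++ r] ++
    [seq z :: w | z <- c y y, w <- qsh c [::] s])).
  apply: (@perm_cat _ [:: y :: y :: s] [:: y :: y :: s]) => //.
  by rewrite perm_cat2r perm_map.
by rewrite map_cat map_nseq -!catA.
Qed.

Lemma lead_nseq s : exists s', s = nseq (lead s) y ++ s' /\ ohead s' != Some y.
Proof.
elim: s => [|a s [s' [IHs hs']]] /=; first by exists [::].
case: eqP => [->|ay]; first by exists s'; split => //=; congr (_ :: _).
by exists (a :: s); split => //=; apply/eqP => -[].
Qed.

End LeadingLetters.

(** * The algebra of words *)

Lemma mcoeff_wmon s (m : {fmonom bool}) : (wmon s)@_m = (s == m :> seq bool)%:R.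
Proof. by rewrite /wmon mcoeffU1 fmP. Qed.

Lemma wmon0 : wmon [::] = 1.
Proof.
apply/malgP => m; rewrite mcoeff_wmon mcoeff1; congr (_%:R).
by rewrite [mone](fmoneE bool) fmP eq_sym.
Qed.

Lemma wmon_cat s t : wmon (s ++ t) = wmon s * wmon t.
Proof.
have -> : wmon s * wmon t = << 1 * 1 *g mmul (FMonom s) (FMonom t) >>.
  exact: fgmulUU.
by rewrite mulr1 [mmul _ _](fmmulE (FMonom s) (FMonom t)).
Qed.

Lemma malg_scalerAr (K : monomType) (A : comNzRingType) (a : A)
  (g h : {malg A[K]}) : g * (a *: h) = a *: (g * h).
Proof.
apply/malgP => m; rewrite [RHS]mcoeffZ.
rewrite (mcoeffMlw m (fsubset_refl (msupp g)) (msuppZ_le a h)) mcoeffMl.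
rewrite mulr_sumr; apply: eq_bigr => i _; rewrite mulr_sumr.
apply: eq_bigr => j _; rewrite mcoeffZ; case: eqP => _; last by rewrite mulr0.
by rewrite !mulr1n mulrCA.
Qed.

Lemma Hoff_scalerAr (a : rat) (x z : Hoff) : x * (a *: z) = a *: (x * z).
Proof. exact: malg_scalerAr. Qed.

Lemma wmon_expand (w : Hoff) : w = \sum_(u <- msupp w) w@_u *: wmon u.
Proof.
rewrite {1}(monalgE w); apply: eq_bigr => u _; apply/malgP => m.
by rewrite mcoeffZ mcoeff_wmon mcoeffU mulr_natr fmP.
Qed.

Lemma msupp_sum_wmon (I : eqType) (r : seq I) (a : I -> rat) (F : I -> seq bool) (m : {fmonom bool}) :
  m \in msupp (\sum_(i <- r) a i *: wmon (F i)) ->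
  exists2 i, i \in r & F i = m :> seq bool.
Proof.
rewrite -mcoeff_neq0 raddf_sum /= => nz.
have /hasP[i ir /eqP Fi] : has (fun i => F i == m :> seq bool) r.
  apply: contraNT nz => /hasPn nh; rewrite big_seq big1 // => i ir.
  by rewrite mcoeffZ mcoeff_wmon (negPf (nh i ir)) mulr0.
by exists i.
Qed.

(** The words spanning H^1 and H^0; the default letters let the empty word satisfy both
    conditions. *)
Definition word1 (u : seq bool) : bool := head ly u == ly.
Definition word0 (u : seq bool) : bool := word1 u && (last lx u == lx).

Lemma msupp_Hoff1 (w : Hoff) (u : {fmonom bool}) : Hoff1 w -> u \in msupp w -> word1 u.
Proof.
case=> [a [v ->]]; rewrite [in X in _ -> X]/word1.
have -> : a%:A + Hy * v =
    \sum_(p <- (a, [::]) :: [seq (v@_u, ly :: (u : seq bool)) | u <- msupp v])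
      p.1 *: wmon p.2.
  rewrite big_cons big_map [wmon _]wmon0; congr +%R.
  rewrite {1}(wmon_expand v) mulr_sumr; apply: eq_bigr => m _.
  by rewrite -cat1s wmon_cat; exact: Hoff_scalerAr.
move/(@msupp_sum_wmon _ _ fst snd) => [p]; rewrite in_cons => /orP[/eqP-> <- //|].
by case/mapP => m _ -> <-.
Qed.

Lemma msupp_Hoff0 (w : Hoff) (u : {fmonom bool}) : Hoff0 w -> u \in msupp w -> word0 u.
Proof.
case=> [a [v ->]].
have -> : a%:A + Hy * v * Hx = \sum_(p <- (a, [::]) ::
    [seq (v@_u, ly :: rcons (u : seq bool) lx) | u <- msupp v]) p.1 *: wmon p.2.
  rewrite big_cons big_map [wmon _]wmon0; congr +%R.
  rewrite {1}(wmon_expand v) mulr_sumr mulr_suml; apply: eq_bigr => m _.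
  rewrite -cats1 -cat1s !wmon_cat /= mulrA -/Hy -/Hx.
  by rewrite Hoff_scalerAr -scalerAl.
move/(@msupp_sum_wmon _ _ fst snd) => [p]; rewrite in_cons => /orP[/eqP-> <- //|].
by case/mapP => m _ -> <-; rewrite /word0 /word1 /= last_rcons.
Qed.

Lemma Hoff1_wmon u : word1 u -> Hoff1 (wmon u).
Proof.
case: u => [|a u]; first by exists 1, 0; rewrite wmon0 mulr0 addr0 scale1r.
rewrite /word1 /= => /eqP->; exists 0, (wmon u).
by rewrite scale0r add0r -cat1s wmon_cat.
Qed.

Lemma Hoff0_wmon u : word0 u -> Hoff0 (wmon u).
Proof.
case/andP; case: u => [|a u].
  by exists 1, 0; rewrite wmon0 mulr0 mul0r addr0 scale1r.
rewrite /word1 /= => /eqP->; case/lastP: u => [//|u b]; rewrite last_rcons => /eqP->.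
exists 0, (wmon u).
by rewrite scale0r add0r -cats1 -cat1s !wmon_cat mulrA.
Qed.

Lemma Hoff1_0 : Hoff1 0.
Proof. by exists 0, 0; rewrite mulr0 addr0 scale0r. Qed.

Lemma Hoff_addACA (p q r s : Hoff) : (p + q) + (r + s) = (p + r) + (q + s).
Proof. exact: addrACA. Qed.

Lemma Hoff1_comb (a : rat) u v : Hoff1 u -> Hoff1 v -> Hoff1 (a *: u + v).
Proof.
move=> [b [u' ->]] [d [v' ->]]; exists (a * b + d), (a *: u' + v').
rewrite mulrDr Hoff_scalerAr scalerDr scalerDl scalerA.
exact: Hoff_addACA.
Qed.

Lemma Hoff1_sum (I : eqType) (r : seq I) (F : I -> Hoff) :
  (forall i, i \in r -> Hoff1 (F i)) -> Hoff1 (\sum_(i <- r) F i).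
Proof.
move=> HF; rewrite big_seq; elim/big_ind: _ => //; first exact: Hoff1_0.
by move=> u v Hu Hv; rewrite -[u]scale1r; apply: Hoff1_comb.
Qed.

(** * Regularizations coming from quasi-shuffle characters *)

Definition nat_inv (R : realType) (n : nat) : R := n.+1%:R^-1.

Lemma nat_invP (R : realType) n : n.+1%:R * nat_inv R n = 1.
Proof. by rewrite mulfV // pnatr_eq0. Qed.

Section Regularization.
Variables (R : realType) (T : eqType) (c : T -> T -> seq T).
Variables (V : pred (seq T)) (y : T) (wd : seq T -> seq bool).
Variables (dec : seq bool -> seq T) (op : seq bool -> seq bool -> Hoff).
Hypothesis domV : domain c V y.
Hypothesis wdK : forall s, V s -> dec (wd s) = s.
Hypothesis wd1 : forall s, V s -> word1 (wd s).
Hypothesis dec1 : forall u, word1 u -> V (dec u) /\ wd (dec u) = u.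
Hypothesis lead_wd : forall s, V s -> (lead y s == 0%N) = word0 (wd s).
Hypothesis wdy : wd [:: y] = [:: ly].
Hypothesis opE : forall s t, V s -> V t ->
  op (wd s) (wd t) = \sum_(w <- qsh c s t) wmon (wd w).

Notation mul := (bilinear_ext op).

Section Existence.
Variable chi : seq T -> R.
Hypotheses (chi1 : chi [::] = 1) (chiy : chi [:: y] = 0).
Hypothesis chiM : is_char c V chi.
Hypothesis chi0 : forall s, V s -> lead y s = 0%N ->
  chi s = zeta R (rev (rev_index (wd s))).

Notation iv := (@nat_inv R).

(** Defined on every monomial in order to be linear on the whole algebra; on words that start with x
    its values carry no meaning. *)
Definition word_reg (w : Hoff) : {poly R} :=
  mmap (polyC \o ratr) (fun u : {fmonom bool} => reg_poly y iv chi (dec u))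
    (w : {malg rat[{fmonom bool}]}).

Lemma word_reg_wmon s : V s -> word_reg (wmon (wd s)) = reg_poly y iv chi s.
Proof. by move=> Vs; rewrite /word_reg mmapU /= wdK // rmorph1 mul1r. Qed.

Lemma word_regD u v : word_reg (u + v) = word_reg u + word_reg v.
Proof.
suff H (g h : {malg rat[{fmonom bool}]}) :
    word_reg (g + h) = word_reg g + word_reg h by exact: H.
exact: mmapD.
Qed.

Lemma word_regZ (a : rat) v : word_reg (a *: v) = (ratr a : R) *: word_reg v.
Proof.
rewrite /word_reg (mmapEw (msuppZ_le _ _)) mmapE scaler_sumr.
apply: eq_bigr => k _; rewrite mcoeffZ /= (rmorphM (@ratr R)) polyCM -mulrA.
by rewrite mul_polyC.
Qed.

Lemma word_reg_sum I (r : seq I) (P : pred I) (F : I -> Hoff) :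
  word_reg (\sum_(i <- r | P i) F i) = \sum_(i <- r | P i) word_reg (F i).
Proof.
apply: (big_morph word_reg word_regD).
by rewrite -[0 in LHS](scale0r (0 : Hoff)) word_regZ rmorph0 scale0r.
Qed.

Lemma word_regP : is_regularization mul word_reg.
Proof.
split.
- by move=> a u v _ _; rewrite word_regD word_regZ.
- move=> u v Hu Hv; rewrite /mul word_reg_sum.
  rewrite {2}/word_reg mmapE mulr_suml [LHS]big_seq [RHS]big_seq.
  apply: eq_bigr => i iu; rewrite word_reg_sum {2}/word_reg mmapE mulr_sumr.
  rewrite [LHS]big_seq [RHS]big_seq; apply: eq_bigr => j jv.
  have [Vi iE] := dec1 (msupp_Hoff1 Hu iu).
  have [Vj jE] := dec1 (msupp_Hoff1 Hv jv).
  rewrite word_regZ -{1}iE -{1}jE opE // word_reg_sum /=.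
  rewrite mulrACA (reg_polyM domV (@nat_invP R) chi1 chiM) // -polyCM -(rmorphM (@ratr R)) mul_polyC.
  congr (_ *: _); rewrite [LHS]big_seq [RHS]big_seq.
  by apply: eq_bigr => w ws; rewrite word_reg_wmon //; apply: (dom_qsh domV) ws.
- move=> w Hw; rewrite /word_reg mmapE /Zmap rmorph_sum [LHS]big_seq [RHS]big_seq.
  apply: eq_bigr => u uw; have w0 := msupp_Hoff0 Hw uw.
  have [Vu uE] := dec1 (proj1 (andP w0)).
  rewrite rmorphM /=; congr (_ * _).
  have l0 : lead y (dec u) = 0%N by apply/eqP; rewrite lead_wd // uE.
  rewrite -{2}uE -chi0 //; case: (dec u) l0 => [//|a s].
  by rewrite reg_poly_cons /=; case: eqP => //; rewrite addr0.
- rewrite -[Hy]/(wmon [:: ly]) -wdy word_reg_wmon; last first.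
    by apply: (dom_y domV); apply: dom_nil domV.
  rewrite reg_poly_cons eqxx chiy reg_poly_nil chi1 add0r.
  apply/polyP => i; rewrite coef_integral coefX.
  by case: i => [|i] //; rewrite coefC; case: i => [|i]; rewrite /= ?mulr0 // mulr1 /nat_inv invr1.
Qed.

End Existence.

Lemma reg_sum (f : Hoff -> {poly R}) (I : eqType) (r : seq I) (F : I -> Hoff) :
  is_regularization mul f -> (forall i, i \in r -> Hoff1 (F i)) ->
  f (\sum_(i <- r) F i) = \sum_(i <- r) f (F i).
Proof.
move=> freg; elim: r => [|i r IHr] HF.
  rewrite !big_nil; have := reg_linear freg (-1) Hoff1_0 Hoff1_0.
  by rewrite scaler0 addr0 rmorphN1 scaleN1r addNr.
rewrite !big_cons -{1}[F i]scale1r (reg_linear freg).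
- rewrite rmorph1 scale1r IHr // => j jr; apply: HF.
  by rewrite in_cons jr orbT.
- by apply: HF; rewrite mem_head.
- by apply: Hoff1_sum => j jr; apply: HF; rewrite in_cons jr orbT.
Qed.

(** Induction on the number of leading [y]. The product of [y] with [s] is a positive integer
    multiple of [y :: s] plus words with at most as many leading [y] as [s]; the integer is
    cancelled in [{poly R}], which determines the value on [y :: s]. *)
Lemma reg_uniq (f g : Hoff -> {poly R}) s :
  is_regularization mul f -> is_regularization mul g -> V s ->
  f (wmon (wd s)) = g (wmon (wd s)).
Proof.
move=> freg greg; have [n] := ubnP (lead y s); elim: n s => // n IHn.
case=> [|a s] /=.
  move=> _ V0; have H0 : Hoff0 (wmon (wd [::])) by apply: Hoff0_wmon; rewrite -lead_wd.
  by rewrite (reg_H0 freg) // (reg_H0 greg).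
case: (eqVneq a y) => [->|ay] sn Vs; last first.
  have H0 : Hoff0 (wmon (wd (a :: s))).
    by apply: Hoff0_wmon; rewrite -lead_wd //= (negPf ay).
  by rewrite (reg_H0 freg) // (reg_H0 greg).
have Vs' := dom_tail domV Vs.
have Vy : V [:: y] by apply: (dom_y domV); apply: dom_nil domV.
have [r rE rP] := qsh_y domV Vs'.
have mulE (h : Hoff -> {poly R}) : is_regularization mul h ->
    h Hy * h (wmon (wd s)) = h (wmon (wd (y :: s))) *+ (lead y s).+1 +
      \sum_(w <- r) h (wmon (wd w)).
  move=> hreg; rewrite -(reg_mul hreg); [|exact: Hoff1_wmon|exact/Hoff1_wmon/wd1].
  have -> : mul Hy (wmon (wd s)) = \sum_(w <- qsh c [:: y] s) wmon (wd w).
    rewrite -opE // wdy /mul /bilinear_ext [Hy]/Hy /Hy /wmon !msuppU1.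
    by rewrite !big_seq_fset1 !mcoeffUU mulr1 scale1r.
  rewrite (reg_sum hreg); last first.
    by move=> w ws; apply/Hoff1_wmon/wd1/(dom_qsh domV Vy Vs').
  by rewrite (perm_big _ rE) big_cat big_nseq iter_addr_0.
have Vr w : w \in r -> V w.
  move=> wr; apply: (dom_qsh domV Vy Vs'); rewrite (perm_mem rE).
  by rewrite mem_cat wr orbT.
have Er : \sum_(w <- r) f (wmon (wd w)) = \sum_(w <- r) g (wmon (wd w)).
  rewrite !big_seq; apply: eq_bigr => w wr; apply: IHn; last exact: Vr.
  exact: leq_ltn_trans (rP w wr) _.
have := mulE f freg; rewrite (reg_Y freg) -(reg_Y greg) IHn //.
rewrite (mulE g greg) Er => /addIr.
rewrite -[LHS]mulr_natl -[RHS]mulr_natl => /mulfI/esym; apply.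
by rewrite -polyC_natr polyC_eq0 pnatr_eq0.
Qed.

(** A character with the right values on H^0 proves existence, hence [xget] returns a
    regularization; uniqueness then identifies its constant term on every word of H^1. *)
Lemma Zreg_char (chi : seq T -> R) : chi [::] = 1 -> chi [:: y] = 0 ->
  is_char c V chi ->
  (forall s, V s -> lead y s = 0%N -> chi s = zeta R (rev (rev_index (wd s)))) ->
  is_regularization mul (Zreg R mul) /\
  forall s, V s -> (Zreg R mul (wmon (wd s))).[0] = chi s.
Proof.
move=> chi1 chiy chiM chi0; have fP := word_regP chi1 chiy chiM chi0.
have ZP : is_regularization mul (Zreg R mul) by exact: xgetPex (ex_intro _ _ fP).
split=> // s Vs; rewrite (reg_uniq ZP fP Vs) word_reg_wmon // reg_poly0 //.
Qed.

End Regularization.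

(** * The shuffle and harmonic products as quasi-shuffles *)

Definition no_contr (a b : bool) : seq bool := [::].
(** Words are reversed, so the condition of starting with y bears on the last element. *)
Definition sh_dom : pred (seq bool) := fun s => last ly s == ly.

Lemma sh_domain : domain no_contr sh_dom ly.
Proof.
split=> //.
- by move=> a [|b s].
(* The last element of [a :: w'] is that of [w'] only when [w'] is nonempty, so the induction also
   has to track emptiness. *)
- suff H n s t w : (size s + size t <= n)%N -> sh_dom s -> sh_dom t ->
      w \in qsh no_contr s t -> sh_dom w /\ (w = [::] -> s = [::] /\ t = [::]).
    by move=> s t w Vs Vt ws; have [] := H _ s t w (leqnn _) Vs Vt ws.
  elim: n s t w => [|n IHn] s t w.
    by case: s t => [|//] [|//]; rewrite inE => _ _ _ /eqP->.
  case: s => [|a s]; first by rewrite qsh0s inE => _ _ Vt /eqP->.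
  case: t => [|b t]; first by rewrite qshs0 inE => _ Vs _ /eqP->.
  move=> st Vs Vt; rewrite qsh_cons !mem_cat; have {}st : (size s + size t < n)%N by move: st => /=; lia.
  case/or3P => [||//].
  + case/mapP => w' w's ->; split=> //; case: s st Vs w's => [|a' s] st Vs w's.
      by move: w's; rewrite qsh0s inE => /eqP->.
    have [||] := IHn _ _ _ _ _ Vt w's; [by move: st => /=; lia|by []|].
    by case: (w') => [_ /(_ erefl)[]|].
  + case/mapP => w' w's ->; split=> //; case: t st Vt w's => [|b' t] st Vt w's.
      by move: w's; rewrite qshs0 inE => /eqP->.
    have [||] := IHn _ _ _ _ Vs _ w's; [by move: st => /=; lia|by []|].
    by case: (w') => [_ /(_ erefl)[]|].
Qed.

Lemma sh_revE s t : sh_rev s t = \sum_(w <- qsh no_contr s t) wmon (rev w).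
Proof.
elim: s t => [|a s IHs] t; first by rewrite qsh0s big_seq1; case: t.
elim: t => [|b t IHt]; first by rewrite qshs0 big_seq1.
rewrite big_qsh_cons big_nil addr0.
have -> : sh_rev (a :: s) (b :: t) =
  sh_rev s (b :: t) * wmon [:: a] + sh_rev (a :: s) t * wmon [:: b] by [].
rewrite IHs IHt !mulr_suml; congr (_ + _); apply: eq_bigr => w _;
  by rewrite rev_cons -cats1 wmon_cat.
Qed.

Definition add_contr (k l : nat) : seq nat := [:: (k + l)%N].

Lemma harm_domain : domain add_contr is_index 1%N.
Proof.
split=> //.
- by move=> a s /andP[].
- suff H n s t w : (size s + size t <= n)%N -> is_index s -> is_index t ->
      w \in qsh add_contr s t -> is_index w.
    by move=> s t w; apply: H (leqnn _).
  elim: n s t w => [|n IHn] s t w; first by case: s t => [|//] [|//]; rewrite inE => _ _ _ /eqP->.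
  case: s => [|a s]; first by rewrite qsh0s inE => _ _ Vt /eqP->.
  case: t => [|b t]; first by rewrite qshs0 inE => _ Vs _ /eqP->.
  move=> st /andP[a0 Vs] /andP[b0 Vt]; rewrite qsh_cons !mem_cat.
  have {}st : (size s + size t < n)%N by move: st => /=; lia.
  move=> /or3P[/mapP[w' ws ->]|/mapP[w' ws ->]|].
  + by rewrite /= a0 (IHn s (b :: t)) //= ?b0 //; lia.
  + by rewrite /= b0 (IHn (a :: s) t) //= ?a0 //; lia.
  + rewrite orbF => /mapP[w' ws ->] /=.
    by rewrite (IHn s t) ?andbT //; lia.
- move=> a s b t /= /andP[a0 _] /andP[b0 _]; rewrite inE; lia.
Qed.

(* The word [z_{k_1} ... z_{k_r}], where the argument is [:: k_r; ...; k_1]. *)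
Fixpoint index_word (t : seq nat) : seq bool :=
  if t is k :: t' then index_word t' ++ ly :: nseq k.-1 lx else [::].

Lemma Hz_wmon k : Hz k = wmon (ly :: nseq k.-1 lx).
Proof.
rewrite /Hz -cat1s wmon_cat; congr (_ * _); elim: k.-1 => [|n IHn] /=.
  by rewrite wmon0 expr0.
by rewrite exprS IHn -cat1s wmon_cat.
Qed.

Lemma zwordE t : zword (rev t) = wmon (index_word t).
Proof.
elim: t => [|k t IHt]; first by rewrite /zword big_nil wmon0.
by rewrite /= wmon_cat -Hz_wmon -IHt /zword rev_cons -cats1 big_cat big_seq1.
Qed.

Lemma harm_revE s t :
  harm_rev s t = \sum_(w <- qsh add_contr s t) wmon (index_word w).
Proof.
elim: s t => [|a s IHs] t; first by rewrite qsh0s big_seq1 -zwordE; case: t.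
elim: t => [|b t IHt]; first by rewrite qshs0 big_seq1 -zwordE.
rewrite big_qsh_cons big_seq1.
have -> : harm_rev (a :: s) (b :: t) =
  harm_rev s (b :: t) * Hz a + harm_rev (a :: s) t * Hz b +
  harm_rev s t * Hz (a + b)%N by [].
rewrite !IHs IHt !mulr_suml !Hz_wmon; congr (_ + _ + _); apply: eq_bigr => w _;
  by rewrite -wmon_cat.
Qed.

Lemma rev_index_cat u v : rev_index (u ++ v) =
  foldl (fun k a => if a == ly then 1%N :: k else (head 0%N k).+1 :: behead k)
    (rev_index u) v.
Proof. exact: foldl_cat. Qed.

Lemma rev_index_rcons u a : rev_index (rcons u a) =
  if a == ly then 1%N :: rev_index u
  else (head 0%N (rev_index u)).+1 :: behead (rev_index u).
Proof. by rewrite -cats1 rev_index_cat. Qed.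

Lemma rev_index_word t : is_index t -> rev_index (index_word t) = t.
Proof.
elim: t => [|k t IHt] //= /andP[k0 /IHt tE]; rewrite -cat_rcons rev_index_cat.
rewrite rev_index_rcons tE eqxx.
have H n l : foldl (fun k a => if a == ly then 1%N :: k
     else (head 0%N k).+1 :: behead k) (l :: t) (nseq n lx) = (l + n)%N :: t.
  by elim: n l => [|n IHn] l /=; rewrite ?addn0 // IHn addSnnS.
by rewrite H; congr (_ :: _); lia.
Qed.

Lemma index_word1 t : word1 (index_word t).
Proof.
elim: t => //= k t; rewrite /word1; case: (index_word t) => //=.
Qed.

Lemma word1_index u : word1 u ->
  is_index (rev_index u) /\ index_word (rev_index u) = u.
Proof.
elim/last_ind: u => [|u a IHu] //; rewrite rev_index_rcons => ua.
have u1 : word1 u by case: u ua {IHu}.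
have [iu uE] := IHu u1; case: (eqVneq a ly) => [->|/=].
  by rewrite /= uE -cats1.
case: a ua => //; rewrite /word1; case: u u1 IHu iu uE => // b u u1 _ iu uE _ _.
case: (rev_index _) uE iu => [//|k t] <- /andP[k0 it]; split; first exact: it.
rewrite -cats1 /= -catA /=; congr (_ ++ _ :: _).
by case: k k0 => // k _ /=; rewrite cats1; elim: k => //= k <-.
Qed.

Lemma lead_index_word t : is_index t -> (lead 1%N t == 0%N) = word0 (index_word t).
Proof.
case: t => [|k t] //= /andP[k0 _]; rewrite /word0.
have -> /= := index_word1 (k :: t); rewrite last_cat /=.
by case: k k0 => [|[|k]] //= _; elim: k.
Qed.

Lemma lead_rev s : sh_dom s -> (lead ly s == 0%N) = word0 (rev s).
Proof.
rewrite /word0 /word1 /sh_dom; case: s => [|a s] //= sy.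
rewrite rev_cons last_rcons; case: (eqVneq a ly) => [->|] /=; first by rewrite andbF.
case: a sy => // sy _; rewrite -rev_cons.
have -> : head ly (rev (false :: s)) = last ly (false :: s).
  by rewrite -nth0 nth_rev //= subn1 nth_last.
by rewrite sy.
Qed.

Lemma word1_rev u : word1 u -> sh_dom (rev u) /\ rev (rev u) = u.
Proof.
rewrite revK /sh_dom /word1; case: u => //= a u aly; split=> //.
by rewrite rev_cons last_rcons.
Qed.

Lemma rev_word1 s : sh_dom s -> word1 (rev s).
Proof.
rewrite /sh_dom /word1; case/lastP: s => // s a; rewrite last_rcons.
by rewrite rev_rcons.
Qed.

Section ConcreteRegularizations.
Variable R : realType.

Lemma Zreg_sh_char (chi : seq bool -> R) : chi [::] = 1 -> chi [:: ly] = 0 ->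
  is_char no_contr sh_dom chi ->
  (forall s, sh_dom s -> lead ly s = 0%N ->
    chi s = zeta R (rev (rev_index (rev s)))) ->
  is_regularization sh (Zreg R sh) /\
  forall s, sh_dom s -> (Zreg R sh (wmon (rev s))).[0] = chi s.
Proof.
apply: (@Zreg_char R bool no_contr sh_dom ly rev rev).
- exact: sh_domain.
- by move=> s _; rewrite revK.
- exact: rev_word1.
- exact: word1_rev.
- exact: lead_rev.
- by [].
- by move=> s t _ _; rewrite sh_revE !revK.
Qed.

Lemma Zreg_harm_char (chi : seq nat -> R) : chi [::] = 1 -> chi [:: 1%N] = 0 ->
  is_char add_contr is_index chi ->
  (forall t, is_index t -> lead 1%N t = 0%N -> chi t = zeta R (rev t)) ->
  is_regularization harm (Zreg R harm) /\
  forall t, is_index t -> (Zreg R harm (zword (rev t))).[0] = chi t.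
Proof.
move=> chi1 chiy chiM chi0.
have [] := @Zreg_char R nat add_contr is_index 1%N index_word rev_index
  (fun u v => harm_rev (rev_index u) (rev_index v))
  harm_domain rev_index_word (fun s _ => index_word1 s) word1_index
  lead_index_word erefl _ chi chi1 chiy chiM.
- by move=> s t Vs Vt; rewrite !rev_index_word // harm_revE.
- by move=> s Vs ls; rewrite chi0 // rev_index_word.
by move=> hreg hval; split=> // t it; rewrite zwordE hval.
Qed.

End ConcreteRegularizations.

(** * Nested sums and the harmonic product *)

Section NestedSums.
Variable R : realType.
Implicit Types (s t : seq nat) (n N : nat).

(* [nterm [:: k_r; ...; k_1] n] is the part of the nested sum where [n_r = n],
   and [nsum] the sum over [n_r <= N]. *)
Fixpoint nterm t n : R :=
  if t is k :: t' then n%:R ^- k * \sum_(m < n) nterm t' m else (n == 0%N)%:R.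

Definition nsum t N : R := \sum_(n < N.+1) nterm t n.

Lemma nterm_cons0 k t : nterm (k :: t) 0 = 0.
Proof. by rewrite /= big_ord0 mulr0. Qed.

Lemma nterm_consS k t n : nterm (k :: t) n.+1 = n.+1%:R ^- k * nsum t n.
Proof. by []. Qed.

Lemma nsumS t N : nsum t N.+1 = nsum t N + nterm t N.+1.
Proof. by rewrite /nsum big_ord_recr. Qed.

Lemma nsum0 N : nsum [::] N = 1.
Proof. by rewrite /nsum big_ord_recl /= big1 ?addr0. Qed.

Lemma nsum_cons0 k t : nsum (k :: t) 0 = 0.
Proof. by rewrite /nsum big_ord1 nterm_cons0. Qed.

Lemma nsum_consS k t N :
  nsum (k :: t) N.+1 = nsum (k :: t) N + N.+1%:R ^- k * nsum t N.
Proof. by rewrite nsumS nterm_consS. Qed.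

(** Isolating in each factor the terms whose largest variable is N + 1 gives four products at level
    N. The three that involve N + 1 match the three kinds of terms in the quasi-shuffle recursion,
    and the fourth is the induction hypothesis. *)
Lemma nsumM N s t :
  nsum s N * nsum t N = \sum_(w <- qsh add_contr s t) nsum w N.
Proof.
elim: N s t => [|N IHN] [|k s] t; rewrite ?qsh0s ?big_seq1 ?nsum0 ?mul1r //.
- case: t => [|l t]; first by rewrite qshs0 big_seq1 nsum0 mulr1.
  rewrite nsum_cons0 mul0r (big_qsh_cons add_contr (fun w => nsum w 0)) big_seq1.
  by rewrite !big1 ?addr0 // => w _; rewrite nsum_cons0.
- case: t => [|l t]; first by rewrite qshs0 big_seq1 nsum0 mulr1.
  rewrite (big_qsh_cons add_contr (fun w => nsum w N.+1)) big_seq1.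
  under eq_bigr do rewrite nsum_consS.
  under [X in _ = _ + X + _]eq_bigr do rewrite nsum_consS.
  under [X in _ = _ + X]eq_bigr do rewrite nsum_consS.
  rewrite !big_split /= -!mulr_sumr -!IHN !nsum_consS.
  have := IHN (k :: s) (l :: t).
  rewrite (big_qsh_cons add_contr (fun w => nsum w N)) big_seq1 => E.
  rewrite mulrDl !mulrDr E exprD invfM; ring.
Qed.

Lemma nterm_ge0 t n : 0 <= nterm t n.
Proof.
elim: t n => [|k t IHt] n /=; first exact: ler0n.
by rewrite mulr_ge0 ?invr_ge0 ?exprn_ge0 ?ler0n // sumr_ge0.
Qed.

Lemma nsum_ge0 t N : 0 <= nsum t N.
Proof. by apply: sumr_ge0 => n _; exact: nterm_ge0. Qed.

Lemma nsum_nondecreasing t : nondecreasing_seq (nsum t).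
Proof.
by apply/nondecreasing_seqP => n; rewrite nsumS lerDl nterm_ge0.
Qed.

(* Dominates all nested sums up to a constant, while [half_prod n / (n + 1)^2]
   is still summable. *)
Definition half_prod n : R := \prod_(i < n) (1 + (2 * i.+1%:R)^-1).

Lemma half_prodS n : half_prod n.+1 = half_prod n * (1 + (2 * n.+1%:R)^-1).
Proof. by rewrite /half_prod big_ord_recr. Qed.

Lemma half_prod_ge0 n : 0 <= half_prod n.
Proof.
by apply: prodr_ge0 => i _; rewrite addr_ge0 // invr_ge0 mulr_ge0 ?ler0n.
Qed.

Lemma nsum_half_prod t N : is_index t -> nsum t N <= 2 ^+ size t * half_prod N.
Proof.
elim: t N => [|k t IHt] N /=.
  move=> _; rewrite nsum0 mul1r; elim: N => [|N IHN]; first by rewrite /half_prod big_ord0.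
  rewrite half_prodS mulrDr mulr1 (le_trans IHN) // lerDl.
  by rewrite mulr_ge0 ?half_prod_ge0 // invr_ge0 mulr_ge0 ?ler0n.
case/andP => k0 Vt; elim: N => [|N IHN].
  by rewrite nsum_cons0 mulr_ge0 ?half_prod_ge0 // exprn_ge0 ?ler0n.
rewrite nsum_consS half_prodS mulrDr mulr1 mulrDr lerD // exprS.
have -> : 2 * 2 ^+ size t * (half_prod N * (2 * N.+1%:R)^-1) =
    N.+1%:R^-1 * (2 ^+ size t * half_prod N).
  by rewrite invfM; move: (N.+1%:R^-1) => z; field.
apply: ler_pM; rewrite ?invr_ge0 ?exprn_ge0 ?ler0n ?nsum_ge0 ?IHt //.
rewrite lef_pV2 ?posrE ?exprn_gt0 ?ltr0n //.
by rewrite -{1}[N.+1%:R]expr1 ler_weXn2l // ler1n.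
Qed.

(** With x = N + 1, the right-hand side grows at each step by 2 [half_prod N] / (x (x + 1)), which
    is at least the new summand because 2x >= x + 1. The constant 4 is the one that gives equality
    at x = 1. *)
Lemma half_prod_sum N :
  \sum_(n < N) n.+1%:R ^- 2 * half_prod n <= 4 - 4 * half_prod N / N.+1%:R.
Proof.
elim: N => [|N IHN]; first by rewrite big_ord0 /half_prod big_ord0 divr1 mulr1 subrr.
rewrite big_ord_recr /= (le_trans (lerD IHN (lexx _))) // half_prodS.
set x : R := N.+1%:R; have x1 : 1 <= x by rewrite ler1n.
have -> : N.+2%:R = x + 1 :> R by rewrite -addn1 natrD.
have x0 : x != 0 by apply: lt0r_neq0; apply: lt_le_trans x1.
have x10 : x + 1 != 0 by apply: lt0r_neq0; rewrite ltr_pwDl // ; apply: le_trans x1.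
rewrite -subr_ge0.
have -> : 4 - 4 * (half_prod N * (1 + (2 * x)^-1)) / (x + 1)
    - (4 - 4 * half_prod N / x + x ^- 2 * half_prod N) =
    half_prod N * ((x - 1) / (x ^+ 2 * (x + 1))).
  move: (half_prod N) x x0 x10 {IHN x1} => h x x0 x10.
  by field; rewrite x0 x10.
rewrite mulr_ge0 ?half_prod_ge0 // divr_ge0 ?subr_ge0 //.
by rewrite mulr_ge0 ?exprn_ge0 ?addr_ge0 // (le_trans _ x1).
Qed.

Lemma nsum_bounded k t N : (1 < k)%N -> is_index t ->
  nsum (k :: t) N <= 2 ^+ size t * 4.
Proof.
move=> k1 Vt; case: N => [|N]; first by rewrite nsum_cons0 mulr_ge0 ?exprn_ge0 ?ler0n.
rewrite /nsum big_ord_recl nterm_cons0 add0r.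
have /le_trans -> // : \sum_(n < N.+1) nterm (k :: t) (lift ord0 n) <=
    2 ^+ size t * \sum_(n < N.+1) n.+1%:R ^- 2 * half_prod n.
  rewrite mulr_sumr ler_sum // => n _; rewrite lift0 nterm_consS mulrCA.
  apply: ler_pM; rewrite ?invr_ge0 ?exprn_ge0 ?ler0n ?nsum_ge0 ?nsum_half_prod //.
  rewrite lef_pV2 ?posrE ?exprn_gt0 ?ltr0n //.
  by rewrite ler_weXn2l // ler1n.
rewrite ler_wpM2l ?exprn_ge0 ?ler0n // (le_trans (half_prod_sum _)) // gerBl.
by rewrite divr_ge0 ?mulr_ge0 ?half_prod_ge0 ?ler0n.
Qed.

Lemma nsum_cvg t : is_index t -> lead 1%N t = 0%N -> cvgn (nsum t).
Proof.
case: t => [|k t] /=.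
  move=> _ _; have -> : nsum [::] = fun=> 1 by apply/funext => n; rewrite nsum0.
  exact: is_cvg_cst.
move=> /andP[k0 Vt]; case: (eqVneq k 1%N) => // k1 _.
apply: nondecreasing_is_cvgn; first exact: nsum_nondecreasing.
exists (2 ^+ size t * 4) => _ [N _ <-]; apply: nsum_bounded => //; lia.
Qed.

End NestedSums.

(** * Multiple zeta values as limits of truncated sums *)

Section ZetaLimit.
Local Open Scope classical_set_scope.
Variable R : realType.

(** Every finite subset of [S] lies in [L N] for N its largest rank, so the supremum over finite
    subsets is already reached along the exhaustion [L]. *)
Lemma esum_limit (T : choiceType) (S : set T) (a : T -> R) (L : nat -> seq T)
    (rank : T -> nat) (l : R) :
  (forall x, 0 <= a x) -> (forall N, uniq (L N)) ->
  (forall N x, x \in L N <-> S x /\ (rank x <= N)%N) ->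
  nondecreasing_seq (fun N => \sum_(x <- L N) a x) ->
  (fun N => \sum_(x <- L N) a x) @ \oo --> l ->
  fine (\esum_(x in S) (a x)%:E) = l.
Proof.
move=> a0 uL memL nd cvl.
have le_l N : \sum_(x <- L N) a x <= l.
  rewrite -(cvg_lim _ cvl) //; apply: nondecreasing_cvgn_le => //.
  by apply/cvg_ex; exists l.
have lower N : ((\sum_(x <- L N) a x)%:E <= \esum_(x in S) (a x)%:E)%E.
  apply: esum_ge; exists [set` L N]; first by split=> // x /= /memL[].
  by rewrite -fsbig_seq // sumEFin.
have upper : (\esum_(x in S) (a x)%:E <= l%:E)%E.
  apply: ge_ereal_sup => /= _ [F [finF FS] <-].
  have [s Fs] := (finite_seqP F).1 finF.
  pose N := \max_(x <- s) rank x.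
  have FL : {subset F <= [set` L N]}.
    move=> x; rewrite inE => Fx; rewrite inE /=; apply/memL; split; first exact: FS.
    by apply: leq_bigmax_seq => //; move: Fx; rewrite Fs.
  apply: (@le_trans _ _ (\sum_(x \in [set` L N]) (a x)%:E)%E).
    by apply: lee_fsum_nneg_subset => // x _; rewrite lee_fin.
  by rewrite -fsbig_seq // sumEFin lee_fin.
have lelow : (l%:E <= \esum_(x in S) (a x)%:E)%E.
  case E : (\esum_(x in S) (a x)%:E) upper lower => [e| |] //= _ lower.
    rewrite lee_fin; apply: (cvgr_to_le cvl); apply: nearW => N.
    by have := lower N; rewrite lee_fin.
  by have := lower 0%N.
by have /eqP -> : \esum_(x in S) (a x)%:E == l%:E by rewrite eq_le upper.
Qed.

Fixpoint incr_seqs r N : seq (seq nat) :=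
  if r is r'.+1 then [seq rcons n m.+1 | m <- iota 0 N, n <- incr_seqs r' m]
  else [:: [::]].

Lemma mem_incr_seqs r N n : (n \in incr_seqs r N) =
  [&& size n == r, path ltn 0%N n & (last 0 n <= N)%N].
Proof.
elim: r N n => [|r IHr] N n /=.
  by rewrite inE; case: n => //=.
apply/allpairsPdep/and3P => [[m [n' [mN n'r ->]]]|[]].
  move: n'r; rewrite IHr => /and3P[/eqP sn pn ln].
  rewrite size_rcons sn eqxx rcons_path pn last_rcons /= ltnS ln.
  by split=> //; move: mN; rewrite mem_iota.
case/lastP: n => [//|n m]; rewrite size_rcons rcons_path last_rcons eqSS.
move=> /eqP sn /andP[pn ln]; case: m ln => // m ln mN.
by exists m, n; rewrite mem_iota mN IHr sn eqxx pn; split.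
Qed.

Lemma incr_seqs_uniq r N : uniq (incr_seqs r N).
Proof.
elim: r N => [|r IHr] N //=; apply: allpairs_uniq_dep => //; first exact: iota_uniq.
by move=> [m n] [m' n'] _ _ /= /rcons_inj[-> <-].
Qed.

Lemma nsum_consE k t N : nsum R (k :: t) N =
  \sum_(0 <= m < N) m.+1%:R ^- k * nsum R t m.
Proof.
elim: N => [|N IHN]; first by rewrite nsum_cons0 big_geq.
by rewrite nsum_consS IHN big_nat_recr.
Qed.

Lemma sum_incr_seqs k N : \sum_(n <- incr_seqs (size k) N)
  \prod_(p <- zip n k) (p.1%:R : R) ^- p.2 = nsum R (rev k) N.
Proof.
elim/last_ind: k N => [|k l IHk] N.
  by rewrite big_seq1 big_nil nsum0.
rewrite size_rcons rev_rcons nsum_consE /= big_allpairs_dep /= /index_iota subn0.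
apply: eq_bigr => m _; rewrite -IHk mulr_sumr [LHS]big_seq [RHS]big_seq.
apply: eq_bigr => n; rewrite mem_incr_seqs => /and3P[/eqP sn _ _].
by rewrite zip_rcons // -cats1 big_cat big_seq1 mulrC.
Qed.

Lemma zeta_nsum k : admissible k -> nsum R (rev k) @ \oo --> zeta R k.
Proof.
case/andP => ik ak.
have cv : cvgn (nsum R (rev k)).
  apply: nsum_cvg; first by rewrite /is_index all_rev.
  by case/lastP: k ak {ik} => // k l; rewrite last_rcons rev_rcons /=; case: l => [|[|l]].
rewrite (_ : zeta R k = limn (nsum R (rev k))) //.
have E : (fun N => \sum_(n <- incr_seqs (size k) N)
    \prod_(p <- zip n k) (p.1%:R : R) ^- p.2) = nsum R (rev k).
  by apply/funext => N; rewrite sum_incr_seqs.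
apply: (@esum_limit _ _ _ (incr_seqs (size k)) (last 0%N)).
- move=> n; apply: prodr_ge0 => p _.
  by rewrite invr_ge0 exprn_ge0.
- exact: incr_seqs_uniq.
- move=> N n; rewrite mem_incr_seqs; split=> [/and3P[/eqP ? ? ?]//|].
  by move=> [/= [-> ->] ->]; rewrite eqxx.
- by rewrite E; exact: nsum_nondecreasing.
- by rewrite E.
Qed.

End ZetaLimit.

(** * The span of multiple zeta values *)

Section Limits.
Local Open Scope classical_set_scope.
Variable R : realType.

Lemma cvgn_ext (u v : nat -> R) (l : R) :
  (forall n, u n = v n) -> v @ \oo --> l -> u @ \oo --> l.
Proof. by move=> uv; have -> : u = v by apply/funext. Qed.

Lemma cvgn_sum (I : eqType) (r : seq I) (F : I -> nat -> R) (l : I -> R) :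
  (forall i, i \in r -> F i @ \oo --> l i) ->
  (fun N => \sum_(i <- r) F i N) @ \oo --> \sum_(i <- r) l i.
Proof.
elim: r => [|i r IHr] HF.
  by apply: (@cvgn_ext _ (fun=> 0)) => [n|]; rewrite big_nil //; apply: cvg_cst.
apply: (@cvgn_ext _ (fun N => F i N + \sum_(j <- r) F j N)) => [n|].
  by rewrite big_cons.
rewrite big_cons; apply: cvgD; first by apply: HF; rewrite mem_head.
by apply: IHr => j jr; apply: HF; rewrite in_cons jr orbT.
Qed.

End Limits.

Section Span.
Local Open Scope classical_set_scope.
Variable R : realType.
Notation span := (@MZV_span R).

Lemma span_zeta k : admissible k -> span (zeta R k).
Proof.
move=> ak; exists [:: (1, k)]; rewrite /= ak; split=> //.
by rewrite big_seq1 rmorph1 mul1r.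
Qed.

Lemma spanD a b : span a -> span b -> span (a + b).
Proof.
move=> [s [sa ->]] [t [ta ->]]; exists (s ++ t).
by rewrite all_cat sa ta big_cat.
Qed.

Lemma spanZ (q : rat) a : span a -> span (ratr q * a).
Proof.
move=> [s [sa ->]]; exists [seq (q * p.1, p.2) | p <- s].
rewrite all_map big_map; split=> //; rewrite mulr_sumr; apply: eq_bigr => p _.
by rewrite (rmorphM (@ratr R)) mulrA.
Qed.

Lemma span_sign n a : span a -> span ((-1) ^+ n * a).
Proof.
have -> : (-1) ^+ n = ratr ((-1) ^+ n) :> R by rewrite (rmorphXn (@ratr R)) rmorphN1.
exact: spanZ.
Qed.

Lemma span0 : span 0.
Proof. by exists [::]; rewrite big_nil. Qed.

Lemma zeta_nil : zeta R [::] = 1.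
Proof.
have h := @zeta_nsum R [::] erefl; rewrite -(cvg_lim _ h) //.
rewrite (_ : nsum R (rev [::]) = fun=> 1) ?lim_cst //.
by apply/funext => n; rewrite nsum0.
Qed.

Lemma span1 : span 1.
Proof. by rewrite -zeta_nil; apply: span_zeta. Qed.

Lemma span_rat (q : rat) : span (ratr q).
Proof. by rewrite -[ratr q]mulr1; apply/spanZ/span1. Qed.

Lemma spanN a : span a -> span (- a).
Proof. by move=> /(spanZ (-1)); rewrite rmorphN1 mulN1r. Qed.

Lemma spanB a b : span a -> span b -> span (a - b).
Proof. by move=> sa sb; apply/spanD/spanN. Qed.

Lemma span_sum (I : eqType) (r : seq I) (P : pred I) (F : I -> R) :
  (forall i, i \in r -> P i -> span (F i)) -> span (\sum_(i <- r | P i) F i).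
Proof.
move=> HF; rewrite big_seq_cond; elim/big_ind: _ => //; first exact: span0.
  exact: spanD.
by move=> i /andP[ir Pi]; apply: HF.
Qed.

Lemma span_sum_fin (I : finType) (P : pred I) (F : I -> R) :
  (forall i, P i -> span (F i)) -> span (\sum_(i | P i) F i).
Proof. by move=> HF; apply: span_sum => i _; apply: HF. Qed.

Definition radm (t : seq nat) : bool := is_index t && (lead 1%N t == 0%N).

Lemma radm_admissible t : radm t = admissible (rev t).
Proof.
rewrite /radm /admissible /is_index all_rev; case: t => [|k t] //=.
rewrite rev_cons last_rcons; case: (posnP k) => //= k0.
by congr (_ && _); case: (eqVneq k 1%N) => [->|] //=; lia.
Qed.

Lemma nsum_radm t : radm t -> nsum R t @ \oo --> zeta R (rev t).
Proof.
by move=> tr; have := @zeta_nsum R (rev t); rewrite -radm_admissible revK; apply.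
Qed.

Lemma qsh_radm s t w : radm s -> radm t -> w \in qsh add_contr s t -> radm w.
Proof.
case/andP=> is_ ls /andP[it lt] ws; rewrite /radm (dom_qsh harm_domain is_ it ws).
case: s t is_ ls it lt ws => [|k s] [|l t]; rewrite ?qsh0s ?qshs0 ?inE => is_ ls it lt.
- by move/eqP->.
- by move/eqP->.
- by move/eqP->.
rewrite qsh_cons !mem_cat => /or3P[|/mapP[w' _ ->]|].
- by move=> /mapP[w' _ ->] /=; move: ls => /=; case: (k == 1%N).
- by move: lt => /=; case: (l == 1%N).
rewrite orbF => /mapP[w' _ ->] /=.
by case/andP: is_ => k0 _; case/andP: it => l0 _; case: (eqVneq (k + l)%N 1%N) => //; lia.
Qed.

Lemma zetaM s t : radm s -> radm t -> zeta R (rev s) * zeta R (rev t) =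
  \sum_(w <- qsh add_contr s t) zeta R (rev w).
Proof.
move=> rs rt; have h1 : (fun N => \sum_(w <- qsh add_contr s t) nsum R w N) @ \oo -->
    zeta R (rev s) * zeta R (rev t).
  under eq_fun do rewrite -nsumM.
  by apply: cvgM; apply: nsum_radm.
have h2 : (fun N => \sum_(w <- qsh add_contr s t) nsum R w N) @ \oo -->
    \sum_(w <- qsh add_contr s t) zeta R (rev w).
  by apply: cvgn_sum => w ws; apply/nsum_radm/(qsh_radm rs rt).
exact: (cvg_unique _ h1 h2).
Qed.

Lemma spanM a b : span a -> span b -> span (a * b).
Proof.
move=> [s [sa ->]] [t [ta ->]]; rewrite mulr_suml; apply: span_sum => p ps _.
rewrite mulr_sumr; apply: span_sum => q qt _; rewrite mulrACA -(rmorphM (@ratr R)).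
apply: spanZ; rewrite -[p.2]revK -[q.2]revK.
have rp : radm (rev p.2) by rewrite radm_admissible revK (allP sa).
have rq : radm (rev q.2) by rewrite radm_admissible revK (allP ta).
rewrite zetaM //; apply: span_sum => w ws _; apply: span_zeta.
by rewrite -radm_admissible; apply: qsh_radm ws.
Qed.

(** Functions of the truncation bound, closed under products by [nsumM]; they serve as weights on
    the largest variable of a convergent sum. *)
Definition nsum_comb (F : nat -> R) : Prop := exists2 L : seq (rat * seq nat),
  all (fun p => is_index p.2) L &
  forall n, F n = \sum_(p <- L) ratr p.1 * nsum R p.2 n.

Lemma nsum_combD F G : nsum_comb F -> nsum_comb G -> nsum_comb (fun n => F n + G n).
Proof.
move=> [s sa Fs] [t ta Gt]; exists (s ++ t); first by rewrite all_cat sa.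
by move=> n; rewrite big_cat -Fs -Gt.
Qed.

Lemma nsum_combZ (q : rat) F : nsum_comb F -> nsum_comb (fun n => ratr q * F n).
Proof.
move=> [s sa Fs]; exists [seq (q * p.1, p.2) | p <- s]; first by rewrite all_map.
move=> n; rewrite big_map Fs mulr_sumr; apply: eq_bigr => p _.
by rewrite (rmorphM (@ratr R)) mulrA.
Qed.

Lemma nsum_comb_nsum t : is_index t -> nsum_comb (nsum R t).
Proof.
move=> it; exists [:: (1, t)]; rewrite /= ?it // => n.
by rewrite big_seq1 rmorph1 mul1r.
Qed.

Lemma nsum_comb_ext F G : (forall n, F n = G n) -> nsum_comb F -> nsum_comb G.
Proof. by move=> FG [s sa Fs]; exists s => // n; rewrite -FG. Qed.

Lemma nsum_comb0 : nsum_comb (fun=> 0).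
Proof. by exists [::] => // n; rewrite big_nil. Qed.

Lemma nsum_comb_sum (I : eqType) (r : seq I) (F : I -> nat -> R) :
  (forall i, i \in r -> nsum_comb (F i)) ->
  nsum_comb (fun n => \sum_(i <- r) F i n).
Proof.
elim: r => [|i r IHr] HF.
  by apply: nsum_comb_ext nsum_comb0 => n; rewrite big_nil.
apply: (@nsum_comb_ext (fun n => F i n + \sum_(j <- r) F j n)).
  by move=> n; rewrite big_cons.
apply: nsum_combD; first by apply: HF; rewrite mem_head.
by apply: IHr => j jr; apply: HF; rewrite in_cons jr orbT.
Qed.

Lemma nsum_combM F G : nsum_comb F -> nsum_comb G -> nsum_comb (fun n => F n * G n).
Proof.
move=> [s sa Fs] [t ta Gt].
apply: (@nsum_comb_ext (fun n => \sum_(p <- s) \sum_(q <- t)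
    ratr (p.1 * q.1) * \sum_(w <- qsh add_contr p.2 q.2) nsum R w n)).
  move=> n; rewrite Fs Gt mulr_suml; apply: eq_bigr => p _.
  rewrite mulr_sumr; apply: eq_bigr => q _.
  by rewrite -nsumM (rmorphM (@ratr R)) mulrACA.
apply: nsum_comb_sum => p ps; apply: nsum_comb_sum => q qt; apply: nsum_combZ.
apply: nsum_comb_sum => w ws; apply: nsum_comb_nsum.
exact: (dom_qsh harm_domain (allP sa _ ps) (allP ta _ qt) ws).
Qed.

(** All variables of [w] are bounded by n, the largest variable of [t]. So the leading exponent of
    the result is [k], or [k + l] when the bound is attained; it stays at least 2 and convergence is
    preserved. *)
Lemma nterm_nsum t w : radm t -> is_index w -> exists2 L : seq (seq nat),
  all radm L & forall n, nterm R t n * nsum R w n = \sum_(v <- L) nterm R v n.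
Proof.
case: t => [|k t] /andP[it lt] iw.
  case: w iw => [|l w] iw.
    by exists [:: [::]] => // -[|m]; rewrite big_seq1 nsum0 mulr1.
  by exists [::] => // -[|m]; rewrite big_nil ?nsum_cons0 ?mulr0 //= mul0r.
have k1 : (1 < k)%N by move: it lt => /= /andP[]; case: k => [|[]].
have it' : is_index t by case/andP: it.
case: w iw => [|l w] iw.
  exists [:: k :: t] => [|m]; first by rewrite all_seq1 /radm it.
  by rewrite big_seq1 nsum0 mulr1.
exists ([seq k :: v | v <- qsh add_contr t (l :: w)] ++
        [seq (k + l)%N :: v | v <- qsh add_contr t w]).
  rewrite all_cat !all_map; apply/andP; split; apply/allP => v vs; rewrite /radm /=.
    by rewrite (dom_qsh harm_domain it' iw vs) andbT; case: (eqVneq _ 1%N) => /=; lia.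
  case/andP: iw => l0 iw.
  by rewrite (dom_qsh harm_domain it' iw vs) andbT; case: (eqVneq _ 1%N) => /=; lia.
move=> [|m].
  rewrite nterm_cons0 mul0r big1_seq // => v /andP[_].
  by rewrite mem_cat => /orP[] /mapP[v' _ ->]; rewrite nterm_cons0.
rewrite big_cat !big_map nterm_consS nsum_consS.
under eq_bigr do rewrite nterm_consS.
under [X in _ = _ + X]eq_bigr do rewrite nterm_consS.
by rewrite -!mulr_sumr -!nsumM exprD invfM; ring.
Qed.

Lemma sum_nterm_cvg t F : radm t -> nsum_comb F ->
  exists2 a, span a & (fun N => \sum_(n < N.+1) nterm R t n * F n) @ \oo --> a.
Proof.
move=> rt [s sa Fs].
have H p : p \in s -> exists2 a, span a &
    (fun N => \sum_(n < N.+1) nterm R t n * nsum R p.2 n) @ \oo --> a.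
  move=> ps; have [L La LE] := nterm_nsum rt (allP sa _ ps).
  exists (\sum_(v <- L) zeta R (rev v)).
    apply: span_sum => v vL _.
    by apply: span_zeta; rewrite -radm_admissible (allP La).
  apply: (@cvgn_ext _ _ (fun N => \sum_(v <- L) nsum R v N)) => [N|].
    by under eq_bigr do rewrite LE; rewrite exchange_big.
  by apply: cvgn_sum => v vL; apply/nsum_radm/(allP La).
pose l (p : rat * seq nat) : R :=
  lim ((fun N => \sum_(n < N.+1) nterm R t n * nsum R p.2 n) @ \oo).
exists (\sum_(p <- s) ratr p.1 * l p).
  apply: span_sum => p /H[a sa' acv] _; apply: spanZ.
  by rewrite /l (cvg_lim _ acv).
apply: (@cvgn_ext _ _ (fun N => \sum_(p <- s) ratr p.1 *
    \sum_(n < N.+1) nterm R t n * nsum R p.2 n)) => [N|].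
  under [RHS]eq_bigr do rewrite mulr_sumr.
  rewrite exchange_big /=; apply: eq_bigr => n _; rewrite Fs mulr_sumr.
  by apply: eq_bigr => p _; rewrite mulrCA.
apply: cvgn_sum => p /H[a sa' acv]; apply: cvgM; first exact: cvg_cst.
by rewrite /l (cvg_lim _ acv).
Qed.

End Span.

(** * Generating functions in the number of leading ones *)

Section GeneratingFunctions.
Local Open Scope classical_set_scope.
Variable R : realType.
Implicit Types (t : seq nat) (m n N : nat) (f g : fps R).
Notation X := (@fpsX R).
Notation iv := (@nat_inv R).

Definition lin n : fps R := 1 + fpsC n.+1%:R^-1 * X.
Definition linv n : fps R := fun i => (- n.+1%:R^-1) ^+ i.
Definition Eser N : fps R := \prod_(n < N) lin n.
Definition Kser N : fps R := \prod_(n < N) linv n.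
Definition ones m t : seq nat := nseq m 1%N ++ t.
Definition Sser t N : fps R := fun m => nsum R (ones m t) N.
Definition Gser t N : fps R := \sum_(n < N.+1) fpsC (nterm R t n) * Kser n.

Lemma fpsCXM a f m : (fpsC a * X * f) m = if m is i.+1 then a * f i else 0.
Proof. by rewrite -mulrA fpsCM; case: m => [|m]; rewrite ?fpsXM0 ?mulr0 // fpsXMS. Qed.

Lemma lin0 n f : (lin n * f) 0%N = f 0%N.
Proof. by rewrite mulrDl mul1r fpsDE fpsCXM addr0. Qed.

Lemma linS n f m : (lin n * f) m.+1 = f m.+1 + n.+1%:R^-1 * f m.
Proof. by rewrite mulrDl mul1r fpsDE fpsCXM. Qed.

Lemma lin_inv n : lin n * linv n = 1.
Proof.
apply: fpsP => -[|m]; first by rewrite lin0 fps1E /linv expr0.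
by rewrite linS fps1E /linv exprS mulNr addrC subrr.
Qed.

Lemma EserS N : Eser N.+1 = lin N * Eser N.
Proof. by rewrite /Eser big_ord_recr mulrC. Qed.

Lemma KserS N : Kser N.+1 = linv N * Kser N.
Proof. by rewrite /Kser big_ord_recr mulrC. Qed.

Lemma EserK N : Eser N * Kser N = 1.
Proof.
elim: N => [|N IHN]; first by rewrite /Eser /Kser !big_ord0 mulr1.
by rewrite EserS KserS mulrACA lin_inv mul1r.
Qed.

Lemma SserS t N : Sser t N.+1 = lin N * Sser t N + fpsC (nterm R t N.+1).
Proof.
apply: fpsP => -[|m]; rewrite fpsDE.
  by rewrite lin0 /Sser nsumS /fpsC mulr1n.
by rewrite linS /Sser /ones /= nsum_consS expr1 /fpsC mulr0n addr0.
Qed.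

(** Variation of constants for the recursion [SserS]: [Eser] solves its homogeneous part, and [Gser]
    accumulates the inhomogeneous terms divided by that solution. For [radm t] all divergence in N
    is thus confined to [Eser]. *)
Lemma SserE t N : Sser t N = Eser N * Gser t N.
Proof.
elim: N => [|N IHN].
  rewrite /Eser /Gser /Kser big_ord0 big_ord1 big_ord0 mul1r mulr1.
  apply: fpsP => -[|m]; rewrite /Sser /ones /= ?nsum_cons0 //.
  by rewrite /nsum big_ord1 /fpsC mulr1n.
rewrite SserS IHN /Gser [in RHS]big_ord_recr mulrDr {1}EserS mulrA; congr (_ + _).
by rewrite mulrCA EserK mulr1.
Qed.

Lemma EserE m N : Eser N m = nsum R (nseq m 1%N) N.
Proof.
have -> : nseq m 1%N = ones m [::] by rewrite /ones cats0.
rewrite -/(Sser [::] N m) SserE.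
have -> : Gser [::] N = 1; last by rewrite mulr1.
rewrite /Gser big_ord_recl /Kser big_ord0 mulr1 big1 ?addr0 //.
by move=> i _; apply: fpsP => k; rewrite fpsCM mul0r.
Qed.

(** The equation [Eser N * Kser N = 1] expresses each coefficient of the inverse through earlier
    ones and nested sums over ones, with coefficients independent of N. *)
Lemma Kser_comb m : nsum_comb (fun N => Kser N m).
Proof.
elim/ltn_ind: m => m IHm; case: m IHm => [|m] IHm.
  apply: (@nsum_comb_ext _ (nsum R [::])); last exact: nsum_comb_nsum.
  move=> n; have /(congr1 (fun f : fps R => f 0%N)) := EserK n.
  by rewrite fpsME big_ord1 fps1E EserE !nsum0 mul1r => ->.
apply: (@nsum_comb_ext _ (fun N => ratr (-1) *
    \sum_(i <- index_iota 0 m.+1) nsum R (nseq (m - i).+1 1%N) N * Kser N i)).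
  move=> N; have /(congr1 (fun f : fps R => f m.+1)) := EserK N.
  rewrite mulrC fpsME fps1E big_ord_recr /= subnn EserE nsum0 mulr1 addrC.
  move/eqP; rewrite addr_eq0 => /eqP ->; rewrite rmorphN1 mulN1r; congr (- _).
  rewrite big_mkord; apply: eq_bigr => i _.
  by rewrite EserE mulrC subSn // -ltnS.
apply: nsum_combZ; apply: nsum_comb_sum => i; rewrite mem_index_iota => /andP[_ im].
apply: nsum_combM; last exact: IHm.
by apply: nsum_comb_nsum; rewrite /is_index all_nseq orbT.
Qed.

Definition fps_cvg (F : nat -> fps R) (G : fps R) :=
  forall m, (fun N => F N m) @ \oo --> G m.

Lemma fps_cvgM F F' G G' : fps_cvg F G -> fps_cvg F' G' ->
  fps_cvg (fun N => F N * F' N) (G * G').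
Proof.
move=> FG FG' m; apply: (@cvgn_ext _ _
    (fun N => \sum_(i <- index_enum 'I_m.+1) F N i * F' N (m - i)%N)) => //.
apply: (@cvgn_sum R 'I_m.+1 (index_enum _)
  (fun i N => F N i * F' N (m - i)%N) (fun i => G i * G' (m - i)%N)).
by move=> i _; apply: cvgM.
Qed.

Definition fps_span f := forall m, MZV_span (f m).

Lemma fps_spanM f g : fps_span f -> fps_span g -> fps_span (f * g).
Proof.
by move=> sf sg m; rewrite fpsME; apply: span_sum_fin => i _; apply: spanM.
Qed.

Lemma fps_span_neg f : fps_span f -> fps_span (fps_neg f).
Proof. by move=> sf i; apply: span_sign. Qed.

Lemma Gser_cvg t : radm t -> exists2 G, fps_span G & fps_cvg (Gser t) G.
Proof.
move=> rt; pose G : fps R := fun m => limn (fun N => Gser t N m).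
have H m : exists2 a, MZV_span a & (fun N => Gser t N m) @ \oo --> a.
  have [a sa acv] := sum_nterm_cvg rt (Kser_comb m).
  exists a => //; apply: cvgn_ext acv => N.
  by rewrite /Gser fps_sumE; apply: eq_bigr => n _; rewrite fpsCM.
exists G => m; have [a sa acv] := H m; first by rewrite /G (cvg_lim _ acv).
by rewrite /G (cvg_lim _ acv).
Qed.

(** The differential equation is a recursion: coefficient m + 1 of [F N] is 1 / (m + 1) times a
    finite sum of products of earlier coefficients with those of [Q N]. Convergence and membership
    in the span therefore pass from [Q] to [F]. *)
Lemma theta_cvg (F Q : nat -> fps R) (Q' : fps R) :
  (forall N, fps_theta (F N) = F N * Q N) -> (forall N, F N 0%N = 1) ->
  (forall N, Q N 0%N = 0) -> fps_cvg Q Q' -> fps_span Q' ->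
  exists G, [/\ fps_span G, fps_cvg F G, G 0%N = 1 & fps_theta G = G * Q'].
Proof.
move=> thF F0 Q0 QQ' sQ'.
have Q'0 : Q' 0%N = 0.
  have h : (fun=> 0 : R) @ \oo --> Q' 0%N by apply: cvgn_ext (QQ' 0%N) => N; rewrite Q0.
  by apply: (cvg_unique _ h (cvg_cst 0)).
have recF N m : F N m.+1 = m.+1%:R^-1 * \sum_(i <- index_iota 0 m.+1) F N i * Q N (m.+1 - i)%N.
  have /(congr1 (fun f : fps R => f m.+1)) := thF N.
  rewrite fpsME big_ord_recr /= subnn Q0 mulr0 addr0 /fps_theta => E.
  rewrite big_mkord -E -[F N _ *+ _]mulr_natl.
  by rewrite mulKf // pnatr_eq0.
pose G : fps R := fun m => limn (fun N => F N m).
have H m : MZV_span (G m) /\ (fun N => F N m) @ \oo --> G m.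
  elim/ltn_ind: m => -[|m] IHm.
    have cv1 : (fun N => F N 0%N) @ \oo --> (1 : R).
      by apply: (@cvgn_ext _ _ (fun=> 1)) => //; apply: cvg_cst.
    rewrite /G (cvg_lim _ cv1) //; split=> //; exact: span1.
  have cvm : (fun N => F N m.+1) @ \oo -->
      m.+1%:R^-1 * \sum_(i <- index_iota 0 m.+1) G i * Q' (m.+1 - i)%N.
    apply: (@cvgn_ext _ _ (fun N => m.+1%:R^-1 *
        \sum_(i <- index_iota 0 m.+1) F N i * Q N (m.+1 - i)%N)) => //.
    apply: cvgM; first exact: cvg_cst.
    apply: cvgn_sum => i; rewrite mem_index_iota => /andP[_ im].
    by apply: cvgM; [apply: (IHm i im).2 | apply: QQ'].
  rewrite /G (cvg_lim _ cvm) //; split=> //.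
  have -> : m.+1%:R^-1 = ratr m.+1%:R^-1 :> R.
    by rewrite (fmorphV (@ratr R)) (rmorph_nat (@ratr R)).
  apply: spanZ; apply: span_sum => i; rewrite mem_index_iota => /andP[_ im] _.
  by apply: spanM => //; apply: (IHm i im).1.
have G0 : G 0%N = 1.
  rewrite /G (_ : (fun N => F N 0%N) = fun=> 1) ?lim_cst //.
  exact/funext.
exists G; split=> //; [by move=> m; apply: (H m).1 | by move=> m; apply: (H m).2 |].
apply: fpsP => m.
have h1 : (fun N => fps_theta (F N) m) @ \oo --> fps_theta G m.
  rewrite /fps_theta -[G m *+ m]mulr_natr; under eq_fun do rewrite -[_ *+ m]mulr_natr.
  by apply: cvgM; [apply: (H m).2 | apply: cvg_cst].
have h2 : (fun N => fps_theta (F N) m) @ \oo --> (G * Q') m.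
  apply: (@cvgn_ext _ _ (fun N => (F N * Q N) m)) => [N|]; first by rewrite thF.
  have FG : fps_cvg F G by move=> i; apply: (H i).2.
  by have := fps_cvgM FG QQ'; apply.
exact: (cvg_unique _ h1 h2).
Qed.

Definition expser (a : R) : fps R := fun m => fact_inv iv m * a ^+ m.

Lemma theta_expser a : fps_theta (expser a) = expser a * (fpsC a * X).
Proof.
apply: fpsP => m; rewrite mulrC fpsCXM; case: m => [|m] //; rewrite /fps_theta /expser.
rewrite /fact_inv big_ord_recr /= exprS -mulr_natl.
have := nat_invP R m; set x := iv m; set p := \prod_(i < m) _ => xP.
rewrite [LHS](_ : _ = (m.+1%:R * x) * (a * (p * a ^+ m))); last by ring.
by rewrite xP mul1r.
Qed.

(** By Newton's identities, u times the logarithmic derivative of [Eser N]: power sums of the 1/n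
    against their elementary symmetric functions. *)
Definition Qser N : fps R := fun i =>
  if i is j.+1 then (-1) ^+ j * nsum R [:: i] N else 0.

Lemma nsum1E k N : nsum R [:: k] N = \sum_(n < N) n.+1%:R ^- k.
Proof.
rewrite nsum_consE big_mkord; apply: eq_bigr => n _; by rewrite nsum0 mulr1.
Qed.

Lemma theta_Eser N : fps_theta (Eser N) = Eser N * Qser N.
Proof.
elim: N => [|N IHN].
  rewrite /Eser big_ord0 mul1r; apply: fpsP => -[|m]; rewrite /fps_theta fps1E //=.
  by rewrite nsum1E big_ord0 mulr0 mul0rn.
have thl : fps_theta (lin N) = lin N * (fpsC N.+1%:R^-1 * X * linv N).
  rewrite mulrCA lin_inv mulr1; apply: fpsP => m; rewrite /fps_theta /lin fpsDE.
  rewrite fps1E -[fpsC _ * X]mulr1 fpsCXM; case: m => [|m] //=; rewrite add0r fps1E.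
  by case: m => [|m] /=; rewrite ?mulr1 ?mulr0 ?mul0rn.
have QS : Qser N.+1 = fpsC N.+1%:R^-1 * X * linv N + Qser N.
  apply: fpsP => m; rewrite fpsDE fpsCXM; case: m => [|m]; first by rewrite addr0.
  rewrite /Qser !nsum1E big_ord_recr /= mulrDr addrC; congr (_ + _).
  by rewrite /linv [in RHS]exprNn exprS invfM exprVn mulrCA.
by rewrite EserS fps_thetaM IHN thl QS; ring.
Qed.

(* [Cser N] is the regularized version of [Eser N], where the harmonic number
   has been cancelled. *)
Definition Cser N : fps R := expser (- nsum R [:: 1%N] N) * Eser N.

Lemma theta_Cser N : fps_theta (Cser N) =
  Cser N * (fpsC (- nsum R [:: 1%N] N) * X + Qser N).
Proof.
by rewrite /Cser fps_thetaM theta_expser theta_Eser mulrDr mulrA [_ * Eser N]mulrAC; ring.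
Qed.

(** The coefficient of degree 1 would be the harmonic series; it is 0 because the exponential factor
    of [Cser] removes it for every N. *)
Definition Qlim : fps R := fun i =>
  if i is j.+2 then (-1) ^+ j.+1 * zeta R [:: i] else 0.

Lemma Cser_cvg : exists C : fps R,
  [/\ fps_span C, fps_cvg Cser C, C 0%N = 1 & fps_theta C = C * Qlim].
Proof.
apply: (theta_cvg theta_Cser).
- move=> N; rewrite /Cser fpsME big_ord1 /expser /fact_inv big_ord0 expr0 EserE nsum0.
  by rewrite !mul1r.
- by move=> N; rewrite fpsDE -[fpsC _ * X]mulr1 fpsCXM addr0.
- move=> m; case: m => [|[|m]].
  + apply: (@cvgn_ext _ _ (fun=> 0)) => [N|]; last exact: cvg_cst.
    by rewrite fpsDE -[fpsC _ * X]mulr1 fpsCXM addr0.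
  + apply: (@cvgn_ext _ _ (fun=> 0)) => [N|]; last exact: cvg_cst.
    by rewrite fpsDE -[fpsC _ * X]mulr1 fpsCXM fps1E /= mulr1 mul1r addNr.
  + apply: (@cvgn_ext _ _ (fun N => (-1) ^+ m.+1 * nsum R [:: m.+2] N)) => [N|].
      by rewrite fpsDE -[fpsC _ * X]mulr1 fpsCXM fps1E /= mulr0 add0r.
    by apply: cvgM; [exact: cvg_cst | apply: (@zeta_nsum R [:: m.+2])].
- move=> [|[|m]]; [exact: span0 | exact: span0 |].
  by apply/span_sign/span_zeta.
Qed.

End GeneratingFunctions.

(** * Euler's recursion for even zeta values *)

Section Euler.
Local Open Scope classical_set_scope.
Variable R : realType.
Implicit Types (a b m n N : nat).

Definition hsum n : R := \sum_(i < n) i.+1%:R^-1.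

Lemma hsumS n : hsum n.+1 = hsum n + n.+1%:R^-1.
Proof. by rewrite /hsum big_ord_recr. Qed.

Lemma hsum_le n d : hsum (n + d) - hsum n <= d%:R / n.+1%:R.
Proof.
elim: d => [|d IHd]; first by rewrite addn0 subrr mul0r.
rewrite addnS hsumS addrAC -[d.+1%:R]natr1 mulrDl mul1r lerD //.
by rewrite lef_pV2 ?posrE ?ltr0n // ler_nat ltnS leq_addr.
Qed.

Lemma hsum_ge n d : 0 <= hsum (n + d) - hsum n.
Proof.
elim: d => [|d IHd]; first by rewrite addn0 subrr.
by rewrite addnS hsumS addrAC addr_ge0 // invr_ge0.
Qed.

(* With the convention 1 / 0 = 0, the term [a = b] does not contribute to sums
   of [inv_diff]. *)
Definition inv_diff a b : R := (b%:R ^+ 2 - a%:R ^+ 2)^-1.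

Lemma inv_diffE a b : (0 < a)%N -> a != b ->
  2 * a%:R * inv_diff a b = (b%:R - a%:R)^-1 - (b%:R + a%:R)^-1.
Proof.
move=> a0 ab; rewrite /inv_diff.
have ba : b%:R - a%:R != 0 :> R by rewrite subr_eq0 eqr_nat eq_sym.
have ba' : b%:R + a%:R != 0 :> R by rewrite -natrD pnatr_eq0; lia.
by rewrite subr_sqr; field; rewrite ba ba'.
Qed.

Lemma sum_inv_diff_lt a M : (M <= a)%N -> 2 * a.+1%:R *
    (\sum_(b < M) inv_diff a.+1 b.+1) =
  hsum (a - M) - hsum a + hsum a.+1 - hsum (M + a.+1).
Proof.
elim: M => [|M IHM] Ma; first by rewrite big_ord0 mulr0 subn0 add0n; lra.
rewrite big_ord_recr /= mulrDr IHM; last exact: ltnW.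
rewrite inv_diffE; [|by []|]; last by lia.
have -> : (a - M = (a - M.+1).+1)%N by lia.
rewrite (hsumS (a - _)) addSn (hsumS (M + _)).
have -> : (a - M.+1).+1%:R = - (M.+1%:R - a.+1%:R) :> R.
  rewrite opprB -natrB; last by lia.
  by congr (_%:R); lia.
rewrite invrN -natrD addSn; ring.
Qed.

(** A finite form of the value 3 / (4 A^2) for the sum of 1 / (b^2 - A^2) over b different from A =
    a + 1. After partial fractions, 3 / (2A) arises as H_A - H_(A-1) = 1/A plus the excluded term 1
    / (2A); the remaining harmonic numbers form the error. *)
Lemma sum_inv_diff a N : (a < N)%N -> 2 * a.+1%:R *
    (\sum_(b < N) inv_diff a.+1 b.+1) =
  3 / 2 * a.+1%:R^-1 - (hsum (N + a.+1) - hsum (N - a.+1)).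
Proof.
elim: N => // N IHN; rewrite ltnS leq_eqVlt => /orP[/eqP <-|aN].
  rewrite big_ord_recr /= [inv_diff _ _]/inv_diff subrr invr0 addr0.
  rewrite sum_inv_diff_lt // !subnn addSn (hsumS (a + _)).
  have -> : hsum a.+1 = hsum a + a.+1%:R^-1 by rewrite hsumS.
  have -> : (a + a.+1).+1%:R = 2 * a.+1%:R :> R.
    by rewrite -natrM; congr (_%:R); lia.
  rewrite [hsum 0]big_ord0 invfM; by move: (a.+1%:R^-1) => x; field.
rewrite big_ord_recr /= mulrDr IHN // inv_diffE //; last by rewrite eqSS; lia.
rewrite addSn (hsumS (N + _)) subSn // (hsumS (N - _)).
have -> : (N - a.+1).+1%:R = N.+1%:R - a.+1%:R :> R.
  rewrite -natrB; last by lia.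
  by congr (_%:R); lia.
rewrite -natrD addSn; ring.
Qed.

Definition power_sum m N : R := \sum_(a < N) a.+1%:R ^- m.

(** A geometric sum. For x = 1/a^2 and y = 1/b^2 the last factor is [inv_diff a b]. *)
Lemma sum_mixed_powers (x y : R) m : x != 0 -> y != 0 -> x != y ->
  \sum_(k < m) x ^+ k.+1 * y ^+ (m - k)%N = (x ^+ m - y ^+ m) * (y^-1 - x^-1)^-1.
Proof.
move=> x0 y0 xy; have yx : y^-1 - x^-1 != 0 by rewrite subr_eq0 (inj_eq invr_inj) eq_sym.
apply: (mulIf yx); rewrite mulfVK //.
have -> : y^-1 - x^-1 = (x - y) / (x * y) by field; rewrite x0 y0.
rewrite [x ^+ m - _]subrXX mulrCA; congr (_ * _); rewrite mulr_suml.
rewrite [RHS](reindex_inj rev_ord_inj); apply: eq_bigr => k _ /=.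
have km := ltn_ord k.
have -> : (m.-1 - (m - k.+1) = k)%N by lia.
have -> : (m - k = (m - k.+1).+1)%N by lia.
by rewrite !exprS; field; rewrite x0 y0.
Qed.

Definition euler_error m N : R := \sum_(a < N)
  a.+1%:R ^- (2 * m).+1 * (hsum (N + a.+1) - hsum (N - a.+1)).

(** The finite form of Euler's (n + 1/2) zeta(2n) = sum of zeta(2j) zeta(2n - 2j), with n = m + 1.
    In the double sum over a and b, the diagonal gives m times the power sum. Off the diagonal the
    geometric sums split into two parts exchanged by swapping a and b, and summing one of them over
    b first leaves 3/2 and the error. *)
Lemma power_sum_recursion m N :
  \sum_(k < m) power_sum (2 * k.+1) N * power_sum (2 * (m - k)) N =
  (m%:R + 3 / 2) * power_sum (2 * m.+1) N - euler_error m N.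
Proof.
pose x a : R := a.+1%:R ^- 2.
have xE a j : a.+1%:R ^- (2 * j) = x a ^+ j by rewrite /x exprVn -exprM.
have nz a : a.+1%:R != 0 :> R by rewrite pnatr_eq0.
have -> : \sum_(k < m) power_sum (2 * k.+1) N * power_sum (2 * (m - k)) N =
    \sum_(a < N) \sum_(b < N) \sum_(k < m) x a ^+ k.+1 * x b ^+ (m - k)%N.
  under [RHS]eq_bigr do rewrite exchange_big.
  rewrite [RHS]exchange_big; apply: eq_bigr => k _.
  rewrite mulr_suml; apply: eq_bigr => a _; rewrite mulr_sumr.
  by apply: eq_bigr => b _; rewrite !xE.
have E (a b : 'I_N) : \sum_(k < m) x a ^+ k.+1 * x b ^+ (m - k)%N =
    (m%:R * x a ^+ m.+1) *+ (b == a) + x a ^+ m * inv_diff a.+1 b.+1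
      + x b ^+ m * inv_diff b.+1 a.+1.
  have Nd : inv_diff b.+1 a.+1 = - inv_diff a.+1 b.+1.
    by rewrite /inv_diff -opprB invrN.
  rewrite Nd mulrN -addrA -mulrBl; case: (eqVneq b a) => [->|ba].
    rewrite [inv_diff _ _]/inv_diff !subrr mul0r addr0 mulr1n.
    rewrite (eq_bigr (fun=> x a ^+ m.+1)); last first.
      by move=> k _; rewrite -exprD; congr (_ ^+ _); have := ltn_ord k; lia.
    by rewrite sumr_const card_ord mulr_natl.
  rewrite mulr0n add0r sum_mixed_powers ?invr_eq0 ?expf_neq0 //.
    by rewrite /x !invrK.
  rewrite /x (inj_eq invr_inj) eqrXn2 // ?eqr_nat //; apply: contra ba.
  by rewrite eqSS => /eqP ab; apply/eqP/val_inj.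
under eq_bigr => a _ do (under eq_bigr => b _ do rewrite E).
under eq_bigr do rewrite !big_split /=.
rewrite !big_split /= [X in _ + X]exchange_big /= -addrA -mulr2n.
have -> : \sum_(a < N) \sum_(b < N) (m%:R * x a ^+ m.+1) *+ (b == a) =
    m%:R * power_sum (2 * m.+1) N.
  rewrite mulr_sumr; apply: eq_bigr => a _; rewrite xE (bigD1 a) //= eqxx big1 ?addr0 //.
  by move=> b /negPf->.
rewrite mulrDl -addrA; congr (_ + _).
rewrite -[LHS]mulr_natl mulr_sumr /power_sum mulr_sumr /euler_error -sumrB.
apply: eq_bigr => a _; rewrite -mulr_sumr.
have := sum_inv_diff (ltn_ord a).
move: (\sum_(b < N) _) (hsum _ - hsum _) => s h sE.
have -> : s = (2 * a.+1%:R)^-1 * (3 / 2 * a.+1%:R^-1 - h).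
  by rewrite -sE mulKf // mulf_neq0 ?pnatr_eq0.
have -> : a.+1%:R ^+ (2 * m.+1) = a.+1%:R ^+ (2 * m) * a.+1%:R * a.+1%:R :> R.
  by rewrite mulnS addnC addn2 !exprSr.
rewrite -xE exprSr.
move: (a.+1%:R : R) (nz a) => A A0; have := expf_neq0 (2 * m) A0.
by move: (A ^+ _) => P P0; field; rewrite A0 P0.
Qed.

(** With A = a + 1 and n = N + 1, the 2A terms of the harmonic difference are at most 1 / (n - A)
    each, and A^(2m+1) >= A^3. What remains is 2 / (A^2 (n - A)) = (2/n) (1/A^2 + 1 / (A (n - A))),
    where A (n - A) >= N. *)
Lemma euler_error_le m N : (0 < m)%N ->
  0 <= euler_error m N <= 2 / N.+1%:R * (power_sum 2 N + 1).
Proof.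
move=> m0; have term (a : 'I_N) : hsum (N + a.+1) - hsum (N - a.+1) =
    hsum ((N - a.+1) + 2 * a.+1) - hsum (N - a.+1).
  by congr (hsum _ - _); have := ltn_ord a; lia.
apply/andP; split.
  apply: sumr_ge0 => a _; rewrite mulr_ge0 ?invr_ge0 ?exprn_ge0 //.
  by rewrite term hsum_ge.
apply: (@le_trans _ _ (\sum_(a < N) 2 / N.+1%:R * (a.+1%:R ^- 2 + N%:R^-1))).
  apply: ler_sum => a _; have aN := ltn_ord a.
  rewrite term; set A : R := a.+1%:R; set n : R := N.+1%:R.
  have A1 : 1 <= A by rewrite ler1n.
  have BE : (N - a.+1).+1%:R = n - A.
    by rewrite /n /A -natrB; [congr (_%:R); lia|lia].
  have B1 : 1 <= n - A by rewrite -BE ler1n.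
  have A0 : 0 < A by apply: lt_le_trans A1.
  have B0 : 0 < n - A by apply: lt_le_trans B1.
  have n0 : 0 < n by rewrite ltr0n.
  apply: (@le_trans _ _ (A ^- 3 * (2 * A / (n - A)))).
    apply: ler_pM; rewrite ?invr_ge0 ?exprn_ge0 ?hsum_ge //.
      rewrite lef_pV2 ?posrE ?exprn_gt0 //.
      by apply: ler_weXn2l => //; lia.
    by rewrite -BE (le_trans (hsum_le _ _)) // natrM.
  have NE : N%:R = n - 1 by rewrite /n -natr1 addrK.
  rewrite NE; clearbody A n; have -> : A ^- 3 * (2 * A / (n - A)) = 2 / n * (A ^- 2 + (A * (n - A))^-1).
    by field; rewrite (lt0r_neq0 A0) (lt0r_neq0 B0) (lt0r_neq0 n0).
  apply: ler_wpM2l; first by rewrite divr_ge0 // ltW.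
  rewrite lerD2l lef_pV2 ?posrE ?mulr_gt0 //; last by lra.
  have : 0 <= (A - 1) * (n - A - 1) by rewrite mulr_ge0 // subr_ge0.
  lra.
rewrite -mulr_sumr ler_wpM2l ?divr_ge0 // big_split /= lerD2l.
rewrite sumr_const card_ord -[_ *+ N]mulr_natl; case: (posnP N) => [->|N0].
  by rewrite mul0r.
by rewrite mulfV // pnatr_eq0 -lt0n.
Qed.

End Euler.

(** * The ideal generated by zeta(2) *)

Section Zeta2Ideal.
Local Open Scope classical_set_scope.
Variable R : realType.

Definition zeta2_ideal (a : R) : Prop :=
  exists2 c, MZV_span c & a = zeta R [:: 2%N] * c.

Lemma zeta2_ideal0 : zeta2_ideal 0.
Proof. by exists 0; [exact: span0 | rewrite mulr0]. Qed.

Lemma zeta2_idealD a b : zeta2_ideal a -> zeta2_ideal b -> zeta2_ideal (a + b).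
Proof.
by move=> [c sc ->] [d sd ->]; exists (c + d); [exact: spanD | rewrite mulrDr].
Qed.

Lemma zeta2_idealM a b : MZV_span a -> zeta2_ideal b -> zeta2_ideal (a * b).
Proof.
by move=> sa [d sd ->]; exists (a * d); [exact: spanM | rewrite mulrCA].
Qed.

Lemma zeta2_ideal_sum (I : eqType) (r : seq I) (P : pred I) (F : I -> R) :
  (forall i, i \in r -> P i -> zeta2_ideal (F i)) ->
  zeta2_ideal (\sum_(i <- r | P i) F i).
Proof.
move=> HF; rewrite big_seq_cond; elim/big_ind: _ => //; first exact: zeta2_ideal0.
  exact: zeta2_idealD.
by move=> i /andP[ir Pi]; apply: HF.
Qed.

Lemma zeta_single_cvg k : (1 < k)%N -> nsum R [:: k] @ \oo --> zeta R [:: k].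
Proof.
by move=> k1; apply: (@zeta_nsum R [:: k]); rewrite /admissible /= k1 andbT; lia.
Qed.

Lemma euler_error_cvg m : (0 < m)%N -> euler_error R m @ \oo --> (0 : R).
Proof.
move=> m0; apply: (@squeeze_cvgr _ _ _ _ (fun=> 0) (fun N => 2 / N.+1%:R * (power_sum R 2 N + 1))).
- by apply: nearW => N; apply: euler_error_le.
- exact: cvg_cst.
- have -> : (0 : R) = 2 * 0 * (zeta R [:: 2%N] + 1) by rewrite mulr0 mul0r.
  apply: cvgM; first by apply: cvgM; [exact: cvg_cst | exact: cvg_harmonic].
  apply: cvgD; last exact: cvg_cst.
  by apply: cvgn_ext (zeta_single_cvg (isT : (1 < 2)%N)) => N; rewrite nsum1E.
Qed.

Lemma zeta_even_recursion m : (0 < m)%N ->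
  \sum_(k < m) zeta R [:: (2 * k.+1)%N] * zeta R [:: (2 * (m - k))%N] =
  (m%:R + 3 / 2) * zeta R [:: (2 * m.+1)%N].
Proof.
move=> m0.
have h1 : (fun N => \sum_(k <- index_enum 'I_m) power_sum R (2 * k.+1) N * power_sum R (2 * (m - k)) N)
    @ \oo --> \sum_(k <- index_enum 'I_m) zeta R [:: (2 * k.+1)%N] * zeta R [:: (2 * (m - k))%N].
  apply: (@cvgn_sum R 'I_m (index_enum _)
    (fun k N => power_sum R (2 * k.+1) N * power_sum R (2 * (m - k)) N)
    (fun k => zeta R [:: (2 * k.+1)%N] * zeta R [:: (2 * (m - k))%N])) => k _.
  have km := ltn_ord k; apply: cvgM.
    apply: cvgn_ext (zeta_single_cvg (_ : (1 < 2 * k.+1)%N)) => [N|]; last by lia.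
    by rewrite nsum1E.
  apply: cvgn_ext (zeta_single_cvg (_ : (1 < 2 * (m - k))%N)) => [N|]; last by lia.
  by rewrite nsum1E.
have h2 : (fun N => \sum_(k <- index_enum 'I_m) power_sum R (2 * k.+1) N * power_sum R (2 * (m - k)) N)
    @ \oo --> (m%:R + 3 / 2) * zeta R [:: (2 * m.+1)%N] - 0.
  apply: cvgn_ext (power_sum_recursion R m) _; apply: cvgB; last exact: euler_error_cvg.
  apply: cvgM; first exact: cvg_cst.
  apply: cvgn_ext (zeta_single_cvg (_ : (1 < 2 * m.+1)%N)) => [N|]; last by lia.
  by rewrite nsum1E.
by rewrite subr0 in h2; exact: (cvg_unique _ h1 h2).
Qed.

Lemma zeta_even_ideal m : zeta2_ideal (zeta R [:: (2 * m.+1)%N]).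
Proof.
elim/ltn_ind: m => -[|m] IHm.
  by exists 1; [exact: span1 | rewrite mulr1].
have := zeta_even_recursion (isT : (0 < m.+1)%N); set q := (_ + 3 / 2) => E.
have q0 : q != 0 by rewrite lt0r_neq0 // addr_gt0 // divr_gt0.
rewrite (_ : zeta R _ = ratr (m.+1%:R + 3 / 2)^-1 *
    \sum_(k < m.+1) zeta R [:: (2 * k.+1)%N] * zeta R [:: (2 * (m.+1 - k))%N]).
  apply: zeta2_idealM; first exact: span_rat.
  apply: zeta2_ideal_sum => k _ _; rewrite mulrC; apply: zeta2_idealM.
    apply: span_zeta; rewrite /admissible /= andbT; have := ltn_ord k; lia.
  by apply: IHm; have := ltn_ord k.
rewrite E (_ : ratr _ = q^-1) ?mulKf //.
rewrite (fmorphV (@ratr R)) (rmorphD (@ratr R)) (rmorphM (@ratr R)).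
by rewrite (fmorphV (@ratr R)) !(rmorph_nat (@ratr R)).
Qed.

End Zeta2Ideal.

(** * The harmonic regularization *)

Section HarmonicRegularization.
Local Open Scope classical_set_scope.
Variable R : realType.
Notation iv := (@nat_inv R).

Definition Cinf : fps R := fun m => limn (fun N => Cser R N m).
Definition Ginf (t : seq nat) : fps R := fun m => limn (fun N => Gser R t N m).

Lemma CinfP : [/\ fps_span Cinf, fps_cvg (Cser R) Cinf, Cinf 0%N = 1 &
  fps_theta Cinf = Cinf * Qlim R].
Proof.
have [C [sC cC C0 thC]] := Cser_cvg R.
suff -> : Cinf = C by [].
by apply: fpsP => m; rewrite /Cinf (cvg_lim _ (cC m)).
Qed.

Lemma GinfP t : radm t -> fps_span (Ginf t) /\ fps_cvg (Gser R t) (Ginf t).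
Proof.
move=> /(Gser_cvg R)[G sG cG]; suff -> : Ginf t = G by [].
by apply: fpsP => m; rewrite /Ginf (cvg_lim _ (cG m)).
Qed.

Lemma Ginf_nil : Ginf [::] = 1.
Proof.
apply: fpsP => m; rewrite /Ginf (_ : (fun N => _) = fun=> (1 : fps R) m) ?lim_cst //.
apply/funext => N; congr (_ m).
rewrite /Gser big_ord_recl /Kser big_ord0 mulr1 big1 ?addr0 //.
by move=> i _; apply: fpsP => k; rewrite fpsCM mul0r.
Qed.

(* In [C(u) C(-u)] only the even zeta values survive. *)
Lemma Cinf_neg_ideal m : (0 < m)%N -> zeta2_ideal ((Cinf * fps_neg Cinf) m).
Proof.
have [sC _ C0 thC] := CinfP; set D := Cinf * _.
have sN : fps_span (fps_neg Cinf) by exact: fps_span_neg.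
have thD : fps_theta D = D * (Qlim R + fps_neg (Qlim R)).
  by rewrite /D fps_thetaM fps_neg_theta thC fps_negM; ring.
have Q0 j : zeta2_ideal ((Qlim R + fps_neg (Qlim R)) j).
  rewrite fpsDE /fps_neg /Qlim; case: j => [|[|j]]; rewrite ?mulr0 ?addr0; try exact: zeta2_ideal0.
  rewrite [(-1) ^+ j.+2]exprS mulrA -mulrA -[X in X + _]mul1r -mulrDl mulN1r.
  case: (boolP (odd j)) => oj.
    by rewrite exprS -signr_odd oj /= expr1 mulrNN mulr1 subrr mul0r; exact: zeta2_ideal0.
  have -> : [:: j.+2] = [:: (2 * (j./2).+1)%N].
    by rewrite -[j in LHS](odd_double_half j) (negPf oj) add0n; congr [:: _]; lia.
  rewrite mulrA; apply: zeta2_idealM; last exact: zeta_even_ideal.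
  have -> : (-1) ^+ j.+1 = ratr ((-1) ^+ j.+1) :> R.
    by rewrite (rmorphXn (@ratr R)) rmorphN1.
  by apply: spanM; [apply: spanB; [exact: span1|]|]; exact: span_rat.
case: m => // m _.
have /(congr1 (fun f : fps R => f m.+1)) := thD.
rewrite {1}/fps_theta -mulr_natl => /(congr1 (fun x => m.+1%:R^-1 * x)).
rewrite mulKf ?pnatr_eq0 // => ->.
have -> : m.+1%:R^-1 = ratr m.+1%:R^-1 :> R.
  by rewrite (fmorphV (@ratr R)) (rmorph_nat (@ratr R)).
apply: zeta2_idealM; first exact: span_rat.
rewrite fpsME; apply: zeta2_ideal_sum => i _ _; apply: zeta2_idealM; last exact: Q0.
by apply: fps_spanM.
Qed.

(** Evaluation at T = -H_N makes the value at [[:: 1%N]] equal to H_N - H_N = 0 before any limit,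
    and each truncation remains a character. *)
Definition harm_approx (t : seq nat) (N : nat) : R :=
  (reg_poly 1%N iv (fun t => nsum R t N) t).[- nsum R [:: 1%N] N].

Definition harm_reg (t : seq nat) : R := limn (harm_approx t).

Lemma harm_approxE m t N : ohead t != Some 1%N ->
  harm_approx (ones m t) N = (Cser R N * Gser R t N) m.
Proof.
move=> ht; rewrite /harm_approx /ones reg_poly_hornerE // /Cser -mulrA -SserE fpsME.
by apply: eq_bigr.
Qed.

Lemma radm_ohead t : radm t -> ohead t != Some 1%N.
Proof. by case: t => // a t /andP[_] /=; case: (eqVneq a 1%N). Qed.

Lemma index_ones t : is_index t -> exists m s, t = ones m s /\ radm s.
Proof.
move=> it; have [s [tE hs]] := lead_nseq 1%N t.
exists (lead 1%N t), s; split=> //; rewrite /radm; apply/andP; split.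
  by move: it; rewrite tE /is_index all_cat => /andP[].
by case: s hs {tE} => //= a s; case: (eqVneq a 1%N) => // ->.
Qed.

Lemma harm_reg_cvg m t : radm t ->
  harm_approx (ones m t) @ \oo --> (Cinf * Ginf t) m.
Proof.
move=> rt; have [_ cC _ _] := CinfP; have [_ cG] := GinfP rt.
apply: (@cvgn_ext _ _ (fun N => (Cser R N * Gser R t N) m)) => [N|].
  exact/harm_approxE/radm_ohead.
by have := fps_cvgM cC cG; apply.
Qed.

Lemma harm_regE m t : radm t -> harm_reg (ones m t) = (Cinf * Ginf t) m.
Proof. by move=> rt; rewrite /harm_reg (cvg_lim _ (@harm_reg_cvg m _ rt)). Qed.

Lemma harm_approx_cvg t : is_index t -> harm_approx t @ \oo --> harm_reg t.
Proof.
move=> /index_ones[m [s [-> rs]]]; rewrite harm_regE //; exact: harm_reg_cvg.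
Qed.

Lemma harm_reg_char : is_char add_contr is_index harm_reg.
Proof.
move=> s t is_ it.
have h1 : (fun N => \sum_(w <- qsh add_contr s t) harm_approx w N) @ \oo -->
    harm_reg s * harm_reg t.
  apply: (@cvgn_ext _ _ (fun N => harm_approx s N * harm_approx t N)) => [N|].
    rewrite (reg_poly_horner harm_domain (@nat_invP R)) //; first exact: nsum0.
    by move=> s' t' _ _; apply: nsumM.
  by apply: cvgM; apply: harm_approx_cvg.
have h2 : (fun N => \sum_(w <- qsh add_contr s t) harm_approx w N) @ \oo -->
    \sum_(w <- qsh add_contr s t) harm_reg w.
  apply: cvgn_sum => w ws; apply: harm_approx_cvg.
  exact: (dom_qsh harm_domain is_ it ws).
exact: (cvg_unique _ h1 h2).
Qed.

Lemma harm_reg_radm t : radm t -> harm_reg t = zeta R (rev t).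
Proof.
move=> rt; rewrite /harm_reg -(cvg_lim _ (@nsum_radm R _ rt)) //; congr (limn _).
apply/funext => N; rewrite /harm_approx -[t in LHS]/(nseq 0 1%N ++ t).
rewrite reg_poly_hornerE ?radm_ohead // big_ord1 /fact_inv big_ord0 expr0 !mul1r.
by [].
Qed.

Lemma harm_reg_nil : harm_reg [::] = 1.
Proof. by rewrite harm_reg_radm // zeta_nil. Qed.

Lemma harm_reg_one : harm_reg [:: 1%N] = 0.
Proof.
rewrite -[[:: _]]/(ones 1 [::]) harm_regE // Ginf_nil mulr1.
have [_ _ _ /(congr1 (fun f : fps R => f 1%N))] := CinfP.
by rewrite /fps_theta mulr1n fpsME !big_ord_recl big_ord0 /= !mulr0 !addr0.
Qed.

Lemma harm_reg_span t : is_index t -> MZV_span (harm_reg t).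
Proof.
move=> /index_ones[m [s [-> rs]]]; rewrite harm_regE //; apply: fps_spanM.
  by have [] := CinfP.
by have [] := GinfP rs.
Qed.

Lemma Zreg_harmE : is_regularization harm (Zreg R harm) /\
  forall k, is_index k -> zeta_reg R harm k = harm_reg (rev k).
Proof.
have [] := @Zreg_harm_char R harm_reg harm_reg_nil harm_reg_one harm_reg_char.
  by move=> t it /eqP lt; apply: harm_reg_radm; rewrite /radm it.
move=> hreg hval; split=> // k ik; rewrite /zeta_reg -[k in LHS]revK hval //.
by rewrite /is_index all_rev.
Qed.

End HarmonicRegularization.

(** * The shuffle regularization *)

Arguments nterm : simpl never.

Section DoubleSeries.
Local Open Scope classical_set_scope.
Variable R : realType.

Lemma sum_triangle (f : nat -> nat -> R) N :
  \sum_(n < N.+1) \sum_(i < n.+1) f i (n - i)%N =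
  \sum_(i < N.+1) \sum_(l < (N - i).+1) f i l.
Proof.
elim: N => [|N IHN]; first by rewrite !big_ord1.
rewrite big_ord_recr IHN [in RHS]big_ord_recr /= subnn big_ord1.
rewrite [X in _ + X = _]big_ord_recr /= subnn addrA; congr (_ + _).
rewrite -big_split; apply: eq_bigr => i _; rewrite [in RHS]subSn; last exact: leq_ord.
by rewrite [in RHS]big_ord_recr /= subSn // leq_ord.
Qed.

(** Tonelli's theorem for summation along antidiagonals. A triangle is bounded by its rows, and the
    rectangle i <= M, l <= N lies in the triangle of size N + M. *)
Lemma double_series (f : nat -> nat -> R) (b : nat -> R) (S : R) :
  (forall i l, 0 <= f i l) ->
  (forall i, (fun N => \sum_(l < N.+1) f i l) @ \oo --> b i) ->
  (fun N => \sum_(i < N.+1) b i) @ \oo --> S ->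
  (fun N => \sum_(n < N.+1) \sum_(i < n.+1) f i (n - i)%N) @ \oo --> S.
Proof.
move=> f0 fb bS.
have nd (g : nat -> R) : (forall n, 0 <= g n) ->
    nondecreasing_seq (fun N => \sum_(n < N.+1) g n).
  by move=> g0; apply/nondecreasing_seqP => n; rewrite [leRHS]big_ord_recr lerDl.
have le_lim (g : nat -> R) l N : (forall n, 0 <= g n) ->
    (fun N => \sum_(n < N.+1) g n) @ \oo --> l -> \sum_(n < N.+1) g n <= l.
  move=> g0 gl; rewrite -(cvg_lim _ gl) //; apply: nondecreasing_cvgn_le; first exact: nd.
  by apply/cvg_ex; exists l.
have b0 i : 0 <= b i.
  by apply: (le_trans _ (le_lim (f i) _ 0%N (f0 i) (fb i))); apply: sumr_ge0.
pose g n := \sum_(i < n.+1) f i (n - i)%N.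
have g0 n : 0 <= g n by apply: sumr_ge0.
have up N : \sum_(n < N.+1) g n <= S.
  rewrite sum_triangle (le_trans _ (le_lim b _ N b0 bS)) //.
  by apply: ler_sum => i _; apply: le_lim.
have : cvgn (fun N => \sum_(n < N.+1) g n).
  by apply: nondecreasing_is_cvgn; [exact: nd | exists S => _ [N _ <-]; apply: up].
move=> /cvg_ex[c cc]; suff -> : S = c by [].
apply/eqP; rewrite eq_le; apply/andP; split; last first.
  by apply: (cvgr_to_le cc); apply: nearW.
apply: (cvgr_to_le bS); apply: nearW => M.
have cM : (fun N => \sum_(i <- index_enum 'I_M.+1) \sum_(l < N.+1) f i l) @ \oo -->
    \sum_(i <- index_enum 'I_M.+1) b i.
  by apply: (@cvgn_sum R 'I_M.+1 _ (fun i N => \sum_(l < N.+1) f i l)).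
apply: (cvgr_to_le cM); apply: nearW => N.
apply: (@le_trans _ _ (\sum_(n < (N + M).+1) g n)); last exact: le_lim.
rewrite sum_triangle.
apply: (@le_trans _ _ (\sum_(i < M.+1) \sum_(l < (N + M - i).+1) f i l)).
  apply: ler_sum => i _.
  have -> : (N + M - i)%N = (N + (M - i))%N by rewrite addnBA // leq_ord.
  by apply: (nd (f i)) => //; rewrite leq_addr.
rewrite -(big_mkord xpredT (fun i => \sum_(l < (N + M - i).+1) f i l)).
rewrite -(big_mkord xpredT (fun i => \sum_(l < (N + M - i).+1) f i l)).
have MN : (M.+1 <= (N + M).+1)%N by rewrite ltnS leq_addl.
rewrite [leRHS](big_cat_nat (leq0n M.+1) MN) lerDl; apply: sumr_ge0 => i _; exact: sumr_ge0.
Qed.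

(** For m + 1 the quotient is, up to a vanishing correction, the Cesaro mean of the quotients for
    m. *)
Lemma nsum_ones_mean m : (fun N => nsum R (nseq m 1%N) N / N.+1%:R) @ \oo --> (0 : R).
Proof.
elim: m => [|m IHm].
  apply: (@cvgn_ext _ _ (fun N => N.+1%:R^-1)) => [N|]; last exact: cvg_harmonic.
  by rewrite nsum0 mul1r.
have h := cesaro IHm.
have -> : (0 : R) = 0 - 0 by rewrite subr0.
(* The mean runs over N + 1 terms while the nested sum stops before N, hence the subtracted last
   term. *)
apply: (@cvgn_ext _ _ (fun N => arithmetic_mean (fun N => nsum R (nseq m 1%N) N / N.+1%:R) N
    - (nsum R (nseq m 1%N) N / N.+1%:R) * N.+1%:R^-1)) => [N|]; last first.
  apply: cvgB => //; have -> : (0 : R) = 0 * 0 by rewrite mulr0.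
  by apply: cvgM => //; exact: cvg_harmonic.
rewrite /arithmetic_mean /= nsum_consE /series /= big_nat_recr //= mulrDr.
rewrite [X in _ + X - _]mulrC addrK mulrC; congr (_ * _); apply: eq_bigr => n _.
by rewrite expr1 mulrC.
Qed.

(* [\sum_l nterm [:: 1; ...; 1] l / (i + l) = h_m(1, 1/2, ..., 1/i) / i], by
   summation by parts. *)
Lemma beta_sum m i :
  (fun N => \sum_(l < N.+1) nterm R (nseq m 1%N) l * (i%:R / (i + l)%:R)) @ \oo -->
  (-1) ^+ m * Kser R i m *+ ((i != 0%N) || (m != 0%N)).
Proof.
(* The Boolean factor vanishes only for i = m = 0: there 0 / 0 = 0 makes the sum zero, while the
   coefficient of [Kser] is 1. *)
elim: m i => [|m IHm] i.
  rewrite orbF; apply: (@cvgn_ext _ _ (fun=> Kser R i 0%N *+ (i != 0%N))) => [N|]; last first.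
    by rewrite expr0 mul1r; exact: cvg_cst.
  rewrite big_ord_recl /= big1 ?addr0; last by move=> j _; rewrite mul0r.
  rewrite mul1r addn0; have -> : Kser R i 0%N = 1.
    have /(congr1 (fun f : fps R => f 0%N)) := EserK R i.
    by rewrite fpsME big_ord1 fps1E EserE nsum0 mul1r.
  by case: i => [|i]; rewrite ?mul0r // divff // pnatr_eq0.
rewrite orbT mulr1n; elim: i => [|i IHi].
  apply: (@cvgn_ext _ _ (fun=> 0)) => [N|].
    by rewrite big1 // => l _; rewrite mul0r mulr0.
  by rewrite /Kser big_ord0 fps1E mulr0; exact: cvg_cst.
(* The recursion in i comes from [Kser R i = lin R i * Kser R i.+1]. The final [- 0] is the limit of
   the boundary term of the summation by parts, controlled by [nsum_ones_mean]. *)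
have KE : (-1) ^+ m.+1 * Kser R i.+1 m.+1 = (-1) ^+ m.+1 * Kser R i m.+1 +
    (i.+1%:R^-1 * ((-1) ^+ m * Kser R i.+1 m *+ ((i.+1 != 0%N) || (m != 0%N))) - 0).
  have -> : Kser R i = lin R i * Kser R i.+1 by rewrite KserS mulrA lin_inv mul1r.
  by rewrite linS /= exprS mulr1n subr0; ring.
rewrite KE; apply: (@cvgn_ext _ _ (fun N =>
    \sum_(l < N.+1) nterm R (nseq m.+1 1%N) l * (i%:R / (i + l)%:R) +
    (i.+1%:R^-1 * (\sum_(l < N.+1) nterm R (nseq m 1%N) l * (i.+1%:R / (i.+1 + l)%:R)) -
     (nsum R (nseq m 1%N) N / N.+1%:R) * (N.+1%:R / (i.+1 + N)%:R)))) => [N|]; last first.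
  apply: cvgD => //; apply: cvgB; first by apply: cvgM => //; exact: cvg_cst.
  have hm := @nsum_ones_mean m.
  apply: (@squeeze_cvgr _ _ _ _ (fun=> 0) (fun N => nsum R (nseq m 1%N) N / N.+1%:R)) => //.
    apply: nearW => N; rewrite mulr_ge0 ?divr_ge0 ?nsum_ge0 //=.
    rewrite ler_piMr ?divr_ge0 ?nsum_ge0 // ler_pdivrMr ?ltr0n // mul1r ler_nat.
    by rewrite addSn ltnS leq_addl.
  exact: cvg_cst.
elim: N => [|N IHN].
  rewrite !big_ord1 nterm_cons0 !mul0r add0r /nsum big_ord1 addn0.
  have : i.+1%:R != 0 :> R by rewrite pnatr_eq0.
  by move: (nterm _ _ _) (i.+1%:R : R) => t x x0; field.
rewrite big_ord_recr IHN {IHN} [in RHS]big_ord_recr [X in _ = _ + (_ * X - _)]big_ord_recr /=.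
rewrite nterm_consS nsumS expr1.
move: (\sum_(l < _) _) (\sum_(l < _) _) (nsum R _ _) (nterm R _ _) => s1 s2 s3 s4.
rewrite !natrD -!natr1; set x : R := i%:R; set y : R := N%:R.
have x0 : 0 <= x by exact: ler0n.
have y0 : 0 <= y by exact: ler0n.
clearbody x y; field; rewrite !lt0r_neq0 //; lra.
Qed.

End DoubleSeries.

(** * Polylogarithm series and their regularized values at 1 *)

Section ShuffleRegularization.
Local Open Scope classical_set_scope.
Variable R : realType.
Implicit Types (s : seq bool) (f g : fps R).

(* The power series of the multiple polylogarithm of a word. *)
Fixpoint li s : fps R :=
  if s is a :: s' then
    fun n => n%:R^-1 * (if a == ly then \sum_(m < n) li s' m else li s' n)
  else 1.

Lemma li_cons a s n : li (a :: s) n =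
  n%:R^-1 * (if a == ly then \sum_(m < n) li s m else li s n).
Proof. by []. Qed.
Arguments li : simpl never.

Definition geo : fps R := fun n => (n != 0%N)%:R.

Lemma geoM f n : (geo * f) n = \sum_(m < n) f m.
Proof.
rewrite mulrC fpsME big_ord_recr /= subnn mulr0 addr0; apply: eq_bigr => i _.
by rewrite /geo -lt0n subn_gt0 ltn_ord mulr1.
Qed.

Lemma li0 a s : li (a :: s) 0%N = 0.
Proof. by rewrite li_cons invr0 mul0r. Qed.

(** The forms dz / (1 - z) and dz / z of iterated integrals, with an extra factor z because
    [fps_theta] is z d/dz. *)
Definition dlog (a : bool) : fps R := if a == ly then geo else 1.

(** The excluded word [[:: lx]] would stand for log z, which is not a power series. *)
Lemma theta_li a s : (a = ly) \/ (s <> [::]) ->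
  fps_theta (li (a :: s)) = dlog a * li s.
Proof.
move=> as_; apply: fpsP => n; rewrite /fps_theta li_cons -[LHS]mulr_natl /dlog.
case: n => [|n]; first rewrite mul0r.
  case: eqP as_ => [_ _|_ [//|]]; first by rewrite geoM big_ord0.
  by case: s => // b s _; rewrite mul1r li0.
by rewrite mulVKf ?pnatr_eq0 //; case: eqP => _; rewrite ?geoM ?mul1r.
Qed.

Lemma fps_theta1 : fps_theta (1 : fps R) = 0.
Proof. by apply: fpsP => -[|n]; rewrite /fps_theta fps1E ?mul0rn. Qed.

Lemma fps_signM m f n : ((-1) ^+ m * f) n = (-1) ^+ m * f n.
Proof.
elim: m => [|m IHm]; first by rewrite !expr0 !mul1r.
by rewrite exprS -mulrA mulN1r fpsNE IHm exprS mulN1r mulNr.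
Qed.

Lemma theta_inj f g : fps_theta f = fps_theta g -> f 0%N = g 0%N -> f = g.
Proof.
move=> fg fg0; apply: fpsP => -[//|n].
have /(congr1 (fun h : fps R => h n.+1)) := fg; rewrite /fps_theta.
by rewrite -[LHS]mulr_natl -[RHS]mulr_natl => /mulfI; apply; rewrite pnatr_eq0.
Qed.

Lemma sh_dom_cons a s : sh_dom (a :: s) -> a = ly \/ s <> [::].
Proof. by rewrite /sh_dom; case: s => [/= /eqP ->|b s _]; [left | right]. Qed.

Lemma qsh_neq_nil s t w : w \in qsh no_contr s t -> w = [::] -> s = [::] /\ t = [::].
Proof.
case: s => [|a s]; first by rewrite qsh0s inE => /eqP->.
case: t => [|b t]; first by rewrite qshs0 inE => /eqP->.
rewrite qsh_cons !mem_cat => /or3P[/mapP[w' _ ->]|/mapP[w' _ ->]|] //.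
Qed.

Lemma fps_theta_sum (I : Type) (r : seq I) (F : I -> fps R) :
  fps_theta (\sum_(i <- r) F i) = \sum_(i <- r) fps_theta (F i).
Proof.
apply: (big_morph (@fps_theta R)); first exact: fps_thetaD.
by apply: fpsP => n; rewrite /fps_theta fps0E mul0rn.
Qed.

(** Iterated integrals multiply by shuffling: by the Leibniz rule and induction on the total length
    both sides have the same image under [fps_theta], and for nonempty words both have constant term
    0. *)
Lemma li_char : is_char no_contr sh_dom li.
Proof.
suff H n s t : (size s + size t <= n)%N -> sh_dom s -> sh_dom t ->
    li s * li t = \sum_(w <- qsh no_contr s t) li w.
  by move=> s t; apply: H (leqnn _).
elim: n s t => [|n IHn] s t.
  by case: s t => [|//] [|//] _ _ _; rewrite qsh0s big_seq1 mul1r.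
case: s => [|a s]; first by rewrite qsh0s big_seq1 mul1r.
case: t => [|b t]; first by rewrite qshs0 big_seq1 mulr1.
move=> st Vs Vt; have {}st : (size s + size t < n)%N by move: st => /=; lia.
rewrite (big_qsh_cons no_contr li) big_nil addr0.
have nil1 w : w \in qsh no_contr s (b :: t) -> w <> [::].
  by move=> /qsh_neq_nil h /h[].
have nil2 w : w \in qsh no_contr (a :: s) t -> w <> [::].
  by move=> /qsh_neq_nil h /h[].
apply: theta_inj; last first.
  rewrite fpsME big_ord1 li0 mul0r fpsDE !fps_sumE !big1 ?addr0 // => w _; exact: li0.
rewrite fps_thetaM fps_thetaD !fps_theta_sum !theta_li; try exact: sh_dom_cons.
congr (_ + _).
  rewrite -mulrA IHn //=; [|by rewrite addnS|exact: (dom_tail sh_domain Vs)].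
  rewrite mulr_sumr [LHS]big_seq [RHS]big_seq; apply: eq_bigr => w /nil1 ws.
  by rewrite theta_li //; right.
rewrite mulrCA IHn //=; last exact: (dom_tail sh_domain Vt).
rewrite mulr_sumr [LHS]big_seq [RHS]big_seq; apply: eq_bigr => w /nil2 ws.
by rewrite theta_li //; right.
Qed.

Definition fps_inv (n : nat) : fps R := fpsC (nat_inv R n).

Lemma fps_invP n : n.+1%:R * fps_inv n = 1.
Proof.
rewrite mulr_natl; apply: fpsP => m; rewrite fpsMnE fps1E /fps_inv /fpsC.
by case: m => [|m]; rewrite /= ?mulr0n ?mul0rn // mulr1n -[LHS]mulr_natl nat_invP.
Qed.

(** Since [li [:: ly]] is -log(1 - z), this is evaluation at T = log(1 - z), which sends the letter
    y to 0 and removes the logarithmic divergence at z = 1. *)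
Definition sh_approx s : fps R := (reg_poly ly fps_inv li s).[- li [:: ly]].

Lemma sh_approx_char : is_char no_contr sh_dom sh_approx.
Proof. by apply: (reg_poly_horner sh_domain fps_invP) => //; exact: li_char. Qed.

(** The series log(1 - z)^j / j!. *)
Definition log_pow j : fps R := fact_inv fps_inv j * (- li [:: ly]) ^+ j.

Lemma theta_log_pow j : fps_theta (log_pow j.+1) = - (geo * log_pow j).
Proof.
have thL : fps_theta (- li [:: ly]) = - geo.
  have -> : fps_theta (- li [:: ly]) = - fps_theta (li [:: ly]).
    by apply: fpsP => n; rewrite /fps_theta !fpsNE mulNrn.
  by rewrite theta_li ?mulr1 //; left.
have thC f : fps_theta (fact_inv fps_inv j.+1 * f) = fact_inv fps_inv j.+1 * fps_theta f.
  suff h : exists c, fact_inv fps_inv j.+1 = fpsC c.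
    have [c ->] := h; apply: fpsP => n; rewrite /fps_theta !fpsCM mulrnAr //.
  elim: j.+1 => [|k [c IHk]]; first by exists 1; rewrite /fact_inv big_ord0.
  exists (c * nat_inv R k); rewrite /fact_inv big_ord_recr /= -/(fact_inv _ _) IHk.
  by apply: fpsP => n; rewrite fpsCM /fps_inv /fpsC mulrnAr.
have thX k : fps_theta ((- li [:: ly]) ^+ k) = - (geo * (- li [:: ly]) ^+ k.-1 *+ k).
  elim: k => [|k IHk].
    by rewrite mulr0n oppr0 expr0 fps_theta1.
  rewrite exprS fps_thetaM thL IHk; case: k {IHk} => [|k] /=.
    by rewrite !expr0 mulr0n; ring.
  by rewrite [in RHS]mulrS mulNr mulrN mulrnAr opprD mulrCA -exprS.
rewrite /log_pow thC thX /= /fact_inv big_ord_recr /=.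
rewrite -[geo * _ *+ _]mulr_natl; move: (fps_invP j).
move: (fps_inv j) (\prod_(i < j) _) (_ ^+ j) => x p l xP.
rewrite mulrN; congr (- _).
rewrite [LHS](_ : _ = (j.+1%:R * x) * (geo * (p * l))); last by ring.
by rewrite xP mul1r.
Qed.

Lemma log_powE j : log_pow j = (-1) ^+ j * li (nseq j ly).
Proof.
elim: j => [|j IHj]; first by rewrite /log_pow /fact_inv big_ord0 !expr0.
apply: theta_inj; last first.
  rewrite /log_pow exprSr mulrA fpsME big_ord1 fpsNE li0 oppr0 mulr0.
  by rewrite fpsME big_ord1 li0 mulr0.
rewrite theta_log_pow IHj.
have thN f : fps_theta ((-1) ^+ j.+1 * f) = (-1) ^+ j.+1 * fps_theta f.
  by apply: fpsP => n; rewrite /fps_theta !fps_signM mulrnAr.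
by rewrite thN theta_li; [rewrite /dlog eqxx exprS; ring | left].
Qed.

Lemma sh_approxE m s : ohead s != Some ly -> sh_approx (nseq m ly ++ s) =
  \sum_(j < m.+1) log_pow j * li (nseq (m - j) ly ++ s).
Proof. exact: reg_poly_hornerE. Qed.

(** Differentiating [log_pow] and differentiating a word with leading y both bring out [geo], with
    opposite signs, so the sum over j telescopes. Only the derivative of [li s] in the term j = m
    survives. *)
Lemma theta_sh_approx m s : ohead s != Some ly ->
  fps_theta (sh_approx (nseq m ly ++ s)) = (-1) ^+ m * li (nseq m ly) * fps_theta (li s).
Proof.
move=> hs; rewrite sh_approxE // fps_theta_sum big_ord_recr /= subnn.
rewrite -log_powE fps_thetaM addrA -[RHS]add0r; congr (_ + _).
case: m => [|m].
  rewrite big_ord0 add0r /log_pow /fact_inv big_ord0 expr0 mulr1.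
  by rewrite fps_theta1 mul0r.
rewrite theta_log_pow (eq_bigr (fun i : 'I_m.+1 =>
    fps_theta (log_pow i) * li (nseq (m.+1 - i) ly ++ s) +
    geo * log_pow i * li (nseq (m - i) ly ++ s))); last first.
  move=> i _; rewrite fps_thetaM subSn ?leq_ord // theta_li; last by left.
  by rewrite /dlog eqxx; ring.
rewrite big_split /= [X in _ + X + _]big_ord_recr /= big_ord_recl subnn.
have -> : fps_theta (log_pow 0) = 0.
  by rewrite log_powE expr0 mul1r; exact: fps_theta1.
rewrite mul0r add0r (eq_bigr (fun i : 'I_m =>
    - (geo * log_pow i * li (nseq (m - i) ly ++ s)))); last first.
  by move=> i _; rewrite lift0 theta_log_pow subSS mulNr.
rewrite sumrN; ring.
Qed.

Definition sh_reg s : R := limn (fun N => \sum_(n < N.+1) sh_approx s n).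

Definition index_rword (t : seq nat) : seq bool := rev (index_word t).

Lemma index_rword_cons k t : index_rword (k :: t) = nseq k.-1 lx ++ ly :: index_rword t.
Proof. by rewrite /index_rword /= rev_cat rev_cons rev_nseq cat_rcons. Qed.

Lemma index_rword_ones m t : index_rword (ones m t) = nseq m ly ++ index_rword t.
Proof. by elim: m => // m IHm; rewrite index_rword_cons /= -IHm. Qed.

Lemma index_rword_dom t : sh_dom (index_rword t).
Proof. by have [] := word1_rev (index_word1 t). Qed.

Lemma sh_dom_index s : sh_dom s -> exists2 t, is_index t & s = index_rword t.
Proof.
move=> /rev_word1/word1_index[it tE]; exists (rev_index (rev s)) => //.
by rewrite /index_rword tE revK.
Qed.

Lemma li_index_rword t n : is_index t -> li (index_rword t) n = nterm R t n.
Proof.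
elim: t n => [|k t IHt] n /=.
  by rewrite -[li _]/(1 : fps R) fps1E.
case/andP => k0 it; rewrite index_rword_cons.
have H j s : li (nseq j lx ++ s) n = n%:R ^- j * li s n.
  elim: j => [|j IHj]; first by rewrite expr0 invr1 mul1r.
  by rewrite li_cons /= IHj exprS invfM mulrA.
rewrite H li_cons eqxx /nterm -/(nterm R) mulrA -invfM -exprSr prednK //.
by congr (_ * _); apply: eq_bigr => m _; rewrite IHt.
Qed.

Lemma li_nseq_ly m n : li (nseq m ly) n = nterm R (nseq m 1%N) n.
Proof.
rewrite -li_index_rword; last by rewrite /is_index all_nseq orbT.
by rewrite -[nseq m 1%N]cats0 -/(ones m [::]) index_rword_ones cats0.
Qed.

Lemma ohead_index_rword t : radm t -> ohead (index_rword t) != Some ly.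
Proof.
case: t => // k t /andP[/andP[k0 _]] /=; rewrite index_rword_cons.
by case: k k0 => [|[|k]].
Qed.

Lemma li_ge0 s n : 0 <= li s n.
Proof.
elim: s n => [|a s IHs] n.
  by rewrite -[li _]/(1 : fps R) fps1E.
rewrite li_cons mulr_ge0 ?invr_ge0 //; case: eqP => _ //; exact: sumr_ge0.
Qed.

Lemma sh_approx_coef m t n : radm t -> sh_approx (index_rword (ones m t)) n =
  if n is 0%N then ((m == 0%N) && (t == [::]))%:R else
  (-1) ^+ m * \sum_(i < n.+1) li (nseq m ly) (n - i)%N * (li (index_rword t) i *+ i) / n%:R.
Proof.
move=> rt; rewrite index_rword_ones; case: n => [|n].
  rewrite sh_approxE ?ohead_index_rword // fps_sumE big_ord_recr /= subnn.
  rewrite [nseq 0 ly ++ _]/= fpsME big_ord1 log_powE big1 ?add0r; last first.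
    move=> i _; rewrite fpsME big_ord1; case: (m - i)%N (subn_gt0 i m) => [|j].
      by rewrite ltn_ord.
    by move=> _; rewrite [nseq _ _ ++ _]/= li0 mulr0.
  case: m => [|m]; last first.
    by rewrite fpsME big_ord1 li0 mulr0 mul0r.
  rewrite expr0 mul1r -[li (nseq 0 ly)]/(1 : fps R) fps1E mul1r li_index_rword; last by case/andP: rt.
  by case: t {rt} => [|k t] //; rewrite nterm_cons0.
have /(congr1 (fun f : fps R => f n.+1)) := theta_sh_approx m (ohead_index_rword rt).
rewrite {1}/fps_theta -[X in X = _ -> _]mulr_natl => /(congr1 (fun x => n.+1%:R^-1 * x)).
rewrite mulKf ?pnatr_eq0 // => ->.
rewrite -mulrA fps_signM mulrCA; congr (_ * _).
rewrite [li _ * _]mulrC [LHS]mulrC fpsME mulr_suml; apply: eq_bigr => i _.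
by rewrite /fps_theta [X in X / _]mulrC.
Qed.

(** A coefficient of [sh_approx] is an antidiagonal sum over i + l = n. Up to the sign (-1)^m its
    terms are nonnegative, so the sum over l may be taken first; [beta_sum] evaluates it as a
    coefficient of [Kser R i], and the sum over i is then the defining series of [Ginf]. *)
Lemma sh_reg_sums m t : radm t -> (forall n, 0 <= (-1) ^+ m * sh_approx (index_rword (ones m t)) n) /\
  (fun N => \sum_(n < N.+1) sh_approx (index_rword (ones m t)) n) @ \oo --> Ginf R t m.
Proof.
move=> rt; have it : is_index t by case/andP: rt.
have sqr1 : (-1) ^+ m * (-1) ^+ m = 1 :> R by rewrite -exprD -signr_odd oddD addbb.
have nn n : 0 <= (-1) ^+ m * sh_approx (index_rword (ones m t)) n.
  rewrite sh_approx_coef //; case: n => [|n].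
    case: m {sqr1} => [|m]; first by rewrite expr0 mul1r ler0n.
    by rewrite [_ == 0%N]/= mulr0n mulr0.
  rewrite mulrA sqr1 mul1r; apply: sumr_ge0 => i _.
  by rewrite divr_ge0 ?mulr_ge0 ?li_ge0 // mulrn_wge0 // li_ge0.
split=> //; have [_ cG] := GinfP R rt.
(* For the empty word the value sits in the constant coefficient, which the weights i / n do not
   see. *)
case: (eqVneq t [::]) => [t0|t0].
  subst t; apply: (@cvgn_ext _ _ (fun=> Ginf R [::] m)); last exact: cvg_cst.
  move=> N; rewrite big_ord_recl sh_approx_coef // eqxx andbT Ginf_nil fps1E.
  rewrite [X in _ + X]big1 /= ?addr0 // => i _.
  rewrite sh_approx_coef //= big1 ?mulr0 // => j _.
  rewrite -[li [::]]/(1 : fps R) fps1E.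
  by case: (val j) => [|?]; rewrite /= ?mulr0n ?mul0rn mulr0 mul0r.
have -> : Ginf R t m = (-1) ^+ m * ((-1) ^+ m * Ginf R t m) by rewrite mulrA sqr1 mul1r.
pose f i l : R := li (nseq m ly) l * (li (index_rword t) i *+ i) / (i + l)%:R.
have t0' : t != [::] by [].
have li00 : li (index_rword t) 0%N = 0.
  by rewrite li_index_rword //; case: t t0' {rt it nn cG t0 f} => // k t _; rewrite nterm_cons0.
apply: (@cvgn_ext _ _ (fun N => (-1) ^+ m * \sum_(n < N.+1) \sum_(i < n.+1) f i (n - i)%N)).
  move=> N; rewrite mulr_sumr; apply: eq_bigr => n _; rewrite sh_approx_coef //.
  case: (val n) => [|n'].
    by rewrite big_ord1 /f addn0 invr0 mulr0 mulr0 (negPf t0') andbF.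
  by congr (_ * _); apply: eq_bigr => i _; rewrite /f subnKC // leq_ord.
apply: cvgM; first exact: cvg_cst.
apply: (@double_series _ _ (fun i => nterm R t i * ((-1) ^+ m * Kser R i m))).
- by move=> i l; rewrite divr_ge0 ?mulr_ge0 ?mulrn_wge0 ?li_ge0.
- move=> i; rewrite -li_index_rword //.
  apply: (@cvgn_ext _ _ (fun N => li (index_rword t) i *
      \sum_(l < N.+1) nterm R (nseq m 1%N) l * (i%:R / (i + l)%:R))).
    move=> N; rewrite mulr_sumr; apply: eq_bigr => l _.
    by rewrite /f -li_nseq_ly -mulr_natl; ring.
  case: i => [|i].
    apply: (@cvgn_ext _ _ (fun=> 0)) => [N|]; first by rewrite li00 mul0r.
    by rewrite li00 mul0r; exact: cvg_cst.
  have h := @beta_sum R m i.+1; rewrite orTb mulr1n in h.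
  by apply: cvgM; [exact: cvg_cst | exact: h].
- apply: (@cvgn_ext _ _ (fun N => (-1) ^+ m * Gser R t N m)) => [N|]; last first.
    by apply: cvgM; [exact: cvg_cst | exact: cG].
  rewrite /Gser fps_sumE mulr_sumr; apply: eq_bigr => n _.
  by rewrite fpsCM mulrCA.
Qed.

Lemma sh_regE m t : radm t -> sh_reg (index_rword (ones m t)) = Ginf R t m.
Proof. by move=> rt; rewrite /sh_reg (cvg_lim _ (sh_reg_sums m rt).2). Qed.

(** The constant sign of the coefficients is recorded because convergence alone would not justify
    Cauchy products; it makes [double_series] applicable. *)
Lemma sh_reg_signed s : sh_dom s -> exists2 e : R, e * e = 1 &
  (forall n, 0 <= e * sh_approx s n) /\
  (fun N => \sum_(n < N.+1) sh_approx s n) @ \oo --> sh_reg s.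
Proof.
move=> /sh_dom_index[t /index_ones[m [t' [-> rt']]] ->].
exists ((-1) ^+ m); first by rewrite -exprD -signr_odd oddD addbb.
by rewrite sh_regE //; apply: sh_reg_sums.
Qed.

Lemma sh_reg_char : is_char no_contr sh_dom sh_reg.
Proof.
move=> s t Vs Vt.
have [e ee [e0 ecv]] := sh_reg_signed Vs; have [d dd [d0 dcv]] := sh_reg_signed Vt.
have edE a b : e * d * ((e * a) * (d * b)) = a * b.
  transitivity ((e * e) * (d * d) * (a * b)); first by ring.
  by rewrite ee dd !mul1r.
have h1 : (fun N => \sum_(n < N.+1) (sh_approx s * sh_approx t) n) @ \oo -->
    sh_reg s * sh_reg t.
  have -> : sh_reg s * sh_reg t = e * d * ((e * sh_reg s) * (d * sh_reg t)).
    by rewrite edE.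
  apply: (@cvgn_ext _ _ (fun N => e * d * \sum_(n < N.+1) \sum_(i < n.+1)
      (e * sh_approx s i) * (d * sh_approx t (n - i)%N))).
    move=> N; rewrite mulr_sumr; apply: eq_bigr => n _.
    rewrite fpsME mulr_sumr; apply: eq_bigr => i _.
    by rewrite edE.
  apply: cvgM; first exact: cvg_cst.
  apply: (@double_series _ (fun i l => (e * sh_approx s i) * (d * sh_approx t l))
     (fun i => (e * sh_approx s i) * (d * sh_reg t))).
  - by move=> i l; rewrite mulr_ge0.
  - move=> i; apply: (@cvgn_ext _ _ (fun N => (e * sh_approx s i) * (d * \sum_(n < N.+1) sh_approx t n))).
      by move=> N; rewrite !mulr_sumr.
    by apply: cvgM; [exact: cvg_cst | apply: cvgM => //; exact: cvg_cst].
  - apply: (@cvgn_ext _ _ (fun N => (e * \sum_(n < N.+1) sh_approx s n) * (d * sh_reg t))).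
      by move=> N; rewrite mulr_sumr mulr_suml.
    by apply: cvgM; [apply: cvgM => //; exact: cvg_cst | exact: cvg_cst].
have h2 : (fun N => \sum_(n < N.+1) (sh_approx s * sh_approx t) n) @ \oo -->
    \sum_(w <- qsh no_contr s t) sh_reg w.
  apply: (@cvgn_ext _ _ (fun N => \sum_(w <- qsh no_contr s t) \sum_(n < N.+1) sh_approx w n)).
    move=> N; rewrite exchange_big; apply: eq_bigr => n _ /=.
    by rewrite sh_approx_char // fps_sumE.
  apply: cvgn_sum => w ws.
  by have [e' _ [_ wcv]] := sh_reg_signed (dom_qsh sh_domain Vs Vt ws).
exact: (cvg_unique _ h1 h2).
Qed.

Lemma sh_reg_radm t : radm t -> sh_reg (index_rword t) = zeta R (rev t).
Proof.
move=> rt; rewrite -[t in LHS]/(ones 0 t) sh_regE // -(harm_reg_radm R rt).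
rewrite -[t in RHS]/(ones 0 t) harm_regE // fpsME big_ord1.
by have [_ _ -> _] := CinfP R; rewrite mul1r.
Qed.

Lemma Zreg_shE : is_regularization sh (Zreg R sh) /\
  forall s, sh_dom s -> (Zreg R sh (wmon (rev s))).[0] = sh_reg s.
Proof.
apply: Zreg_sh_char.
- by rewrite -[[::]]/(index_rword [::]) sh_reg_radm // zeta_nil.
- by rewrite -[[:: ly]]/(index_rword (ones 1 [::])) sh_regE // Ginf_nil.
- exact: sh_reg_char.
move=> s /sh_dom_index[t it ->] /eqP ls.
rewrite [rev (index_rword t)]revK rev_index_word // sh_reg_radm // /radm it.
by move: ls; rewrite lead_rev ?index_rword_dom // [rev (index_rword t)]revK lead_index_word.
Qed.

Definition shz (t : seq nat) : R := sh_reg (index_rword t).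

Lemma zeta_reg_shE k : zeta_reg R sh k = shz (rev k).
Proof.
have [_ h] := Zreg_shE; rewrite /zeta_reg -[k in LHS]revK zwordE.
by rewrite -[index_word _]revK h //; exact: index_rword_dom.
Qed.

Lemma harm_reg_shz m t : radm t -> harm_reg R (ones m t) =
  \sum_(j < m.+1) Cinf R j * shz (ones (m - j) t).
Proof.
by move=> rt; rewrite harm_regE // fpsME; apply: eq_bigr => j _; rewrite /shz sh_regE.
Qed.

Lemma shz_span t : is_index t -> MZV_span (shz t).
Proof.
by move=> /index_ones[m [s [-> rs]]]; rewrite /shz sh_regE //; have [] := GinfP R rs.
Qed.

End ShuffleRegularization.

(** * Star sums *)

Section CommaPlus.

Lemma index_take_drop (k : seq nat) : is_index k ->
  (forall i, is_index (take i k)) /\ (forall i, is_index (drop i k)).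
Proof.
by move=> ik; split=> i; apply/allP => a; [move/mem_take | move/mem_drop]; apply: (allP ik).
Qed.

Definition cps (t : seq nat) : seq (seq nat) :=
  if t is a :: t' then comma_plus a t' else [:: [::]].

Definition add_head (b : nat) (m : seq nat) : seq nat :=
  if m is h :: m' then (b + h)%N :: m' else [::].

Definition add_last (b : nat) (m : seq nat) : seq nat := rev (add_head b (rev m)).

Lemma comma_plus_neq0 a t m : m \in comma_plus a t -> m != [::].
Proof.
elim: t a m => [|b t IHt] a m /=; first by rewrite inE => /eqP->.
by rewrite mem_cat => /orP[/mapP[m' _ ->]|/IHt].
Qed.

Lemma comma_plus_add b a t : comma_plus (b + a) t = [seq add_head b m | m <- comma_plus a t].
Proof.
elim: t b a => [|c t IHt] b a //=; rewrite map_cat -map_comp -addnA -IHt.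
by congr (_ ++ _); apply: eq_map.
Qed.

Lemma add_last_cons b a m : m != [::] -> add_last b (a :: m) = a :: add_last b m.
Proof.
case: m => // h m _; rewrite /add_last rev_cons.
have : rev (h :: m) != [::] by rewrite -size_eq0 size_rev.
by case: (rev _) => //= h' m' _; rewrite -rcons_cons rev_rcons.
Qed.

Lemma comma_plus_rcons b a t : perm_eq (comma_plus a (rcons t b))
  ([seq rcons m b | m <- comma_plus a t] ++ [seq add_last b m | m <- comma_plus a t]).
Proof.
elim: t a => [|c t IHt] a /=; first by rewrite /add_last /= addnC.
rewrite !map_cat perm_sym -!map_comp /= perm_catACA perm_sym.
apply: perm_cat => //.
have /perm_trans -> // := perm_map (cons a) (IHt c).
rewrite map_cat -!map_comp /=.
rewrite (_ : map (cons a \o add_last b) _ = map (add_last b \o cons a) (comma_plus c t)) //.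
by apply/eq_in_map => m /comma_plus_neq0 m0 /=; rewrite add_last_cons.
Qed.

(** Star values are defined on indices, whereas characters live on reversed words; merging
    neighbours is compatible with the reversal, up to the order of the list. *)
Lemma cps_rev t : perm_eq [seq rev m | m <- cps (rev t)] (cps t).
Proof.
case: t => // b t; elim: t b => [|a t IHt] b //.
rewrite rev_cons [cps (_ :: _)]/= comma_plus_add.
have {}IHt := IHt a; rewrite [cps (a :: t)]/= in IHt.
case E : (rev (a :: t)) IHt => [|a' t'] IHt.
  by move/(congr1 size): E; rewrite size_rev.
have /perm_trans -> // : perm_eq (map rev (cps (rcons (a' :: t') b)))
    (map rev ([seq rcons m b | m <- comma_plus a' t'] ++
              [seq add_last b m | m <- comma_plus a' t'])).
  by apply: perm_map; apply: comma_plus_rcons.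
rewrite map_cat -!map_comp; apply: perm_cat.
  rewrite (eq_map (g := cons b \o rev)); last by move=> m /=; rewrite rev_rcons.
  by rewrite map_comp; apply: perm_map.
rewrite (eq_map (g := add_head b \o rev)); last by move=> m /=; rewrite /add_last revK.
by rewrite map_comp; apply: perm_map.
Qed.

Lemma comma_plus_index a t m : (0 < a)%N -> is_index t ->
  m \in comma_plus a t -> is_index m.
Proof.
elim: t a m => [|b t IHt] a m a0 /=; first by rewrite inE => _ /eqP->; rewrite /= a0.
case/andP => b0 it; rewrite mem_cat => /orP[/mapP[m' m't ->]|].
  by rewrite /= a0 (IHt b).
by apply: IHt => //; rewrite addn_gt0 a0.
Qed.

Lemma cps_index t m : is_index t -> m \in cps t -> is_index m.
Proof.
by case: t => [_|a t /andP[a0 it]]; [rewrite inE => /eqP-> | apply: comma_plus_index].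
Qed.

Variable R : comNzRingType.
Implicit Types (z : seq nat -> R) (d : nat -> R).

Definition star z (t : seq nat) : R := \sum_(m <- cps t) z m.

(** Multiplication by the series d of the generating series of [z] over the number of leading ones;
    [twist_ones] is the explicit form. *)
Fixpoint twist d z (t : seq nat) : R :=
  d 0%N * z t +
  (if t is a :: t' then if a == 1%N then twist (fun j => d j.+1) z t' else 0 else 0).

(** Entries being positive, a merged index starts with 1 only if the original one does and a comma
    follows. Stripping leading ones therefore commutes with merging. *)
Lemma star_twist d z t : is_index t -> star (twist d z) t = twist d (star z) t.
Proof.
elim: t d => [|a t IHt] d /=; first by rewrite /star !big_seq1 /= addr0.
case/andP => a0 it.
have E m : twist d z m = d 0%N * z m +
    (if m is b :: m' then if b == 1%N then twist (fun j => d j.+1) z m' else 0 else 0).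
  by case: m.
rewrite {1}/star (eq_bigr _ (fun m _ => E m)) big_split /= -mulr_sumr; congr (_ + _).
case: t it IHt => [|b t] it IHt.
  rewrite big_seq1; case: eqP => // _.
  by rewrite -IHt // /star big_seq1.
rewrite [comma_plus _ _]/= big_cat big_map /= [X in _ + X]big1_seq ?addr0; last first.
  move=> m /= mt; rewrite comma_plus_add in mt.
  case/mapP: mt => m' m't ->; case: m' m't => // h m' m't /=.
  have /andP[h0 _] : is_index (h :: m') by apply: (cps_index it m't).
  by case: eqP => //; move: a0 h0; lia.
case: eqP => _; last by rewrite big1.
exact: IHt.
Qed.

Lemma twist_ones d z m t : ohead t != Some 1%N -> twist d z (ones m t) =
  \sum_(j < m.+1) d j * z (ones (m - j) t).
Proof.
move=> ht; elim: m d => [|m IHm] d.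
  rewrite big_ord1 /ones /=; case: t ht => [|a t] /=; rewrite ?addr0 //.
  by case: (eqVneq a 1%N) => [-> //|_]; rewrite addr0.
rewrite big_ord_recl subn0 {1}/ones /= -/(ones m t) IHm; congr (_ + _).
Qed.

(** * Twisting prefixes and suffixes of an index *)

Section Positions.
Variable k : seq nat.
Local Notation r := (size k).

(** Twisting strips ones next to a cut of [k], so the cut moves across a run of ones: backwards for
    the prefix ([twist_take]), forwards for the suffix ([twist_drop]). *)
Definition ones_between p q := (p <= q)%N && all (pred1 1%N) (drop p (take q k)).

Lemma ones_between_refl p : ones_between p p.
Proof. by rewrite /ones_between leqnn drop_oversize // size_take_min geq_minl. Qed.

Lemma ones_betweenS p q : (q < r)%N -> (p <= q)%N ->
  ones_between p q.+1 = ones_between p q && (nth 0%N k q == 1%N).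
Proof.
move=> qr pq; rewrite /ones_between pq (leqW pq) (take_nth 0%N qr) drop_rcons.
  by rewrite all_rcons /= andbC.
by rewrite size_take_min leq_min pq (leq_trans pq (ltnW qr)).
Qed.

Lemma ones_between_split p i q : (p <= i)%N -> (i <= q)%N ->
  ones_between p q = ones_between p i && ones_between i q.
Proof.
move=> pi iq; rewrite /ones_between pi iq (leq_trans pi iq) /=.
have {1}-> : take q k = take i k ++ drop i (take q k).
  by rewrite -[in LHS](cat_take_drop i (take q k)) take_takel.
rewrite drop_cat size_take_min; case: (leqP i r) => ir.
  case: ltnP => [_|ip]; first by rewrite all_cat.
  have -> : p = i by apply/eqP; rewrite eqn_leq pi.
  by rewrite subnn drop0 [drop i (take i k)]drop_oversize // size_take_min geq_minl.
have nil : drop i (take q k) = [::].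
  by rewrite drop_oversize // size_take_min (leq_trans (geq_minr _ _)) // ltnW.
rewrite nil /= andbT; case: ltnP => [_|rp]; first by rewrite cats0.
by rewrite drop_oversize // size_take_min (leq_trans (geq_minr _ _)).
Qed.

Lemma twist_take d z i : (i <= r)%N -> twist d z (rev (take i k)) =
  \sum_(p < i.+1 | ones_between p i) d (i - p)%N * z (rev (take p k)).
Proof.
elim: i d => [|i IHi] d ir.
  by rewrite big_mkcond big_ord1 ones_between_refl take0 /= addr0.
rewrite {1}(take_nth 0%N ir) rev_rcons /= big_mkcond big_ord_recr /=.
rewrite ones_between_refl subnn (take_nth 0%N ir) rev_rcons addrC; congr (_ + _).
case: eqP => ki; last first.
  rewrite big1 // => p _; rewrite ones_betweenS //; last exact: leq_ord.
  by case: eqP => //; rewrite andbF.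
rewrite (IHi _ (ltnW ir)) [LHS]big_mkcond; apply: eq_bigr => p _.
rewrite ones_betweenS //; last exact: leq_ord.
by rewrite ki eqxx andbT subSn // leq_ord.
Qed.

Lemma twist_drop d z i : (i <= r)%N -> twist d z (drop i k) =
  \sum_(q < r.+1 | ones_between i q) d (q - i)%N * z (drop q k).
Proof.
move=> ir; have [n] := ubnP (r - i)%N; elim: n i d ir => // n IHn i d ir rin.
have ones_lt (q : 'I_r.+1) : (q < i)%N -> ones_between i q = false.
  by move=> qi; rewrite /ones_between leqNgt qi.
rewrite (bigD1 (inord i)) /= inordK ?ltnS // ?ones_between_refl // subnn.
case: (ltnP i r) => [ilt|ri]; last first.
  rewrite drop_oversize //= addr0 [X in _ + X]big1 ?addr0 // => q /andP[/andP[iq _] qi].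
  case/eqP: qi; apply/val_inj; rewrite /= inordK ?ltnS //; apply/eqP.
  by rewrite eqn_leq iq (leq_trans (leq_ord q)).
rewrite (drop_nth 0%N ilt) /=; congr (_ + _).
have split q : (i < q)%N -> ones_between i q = (nth 0%N k i == 1%N) && ones_between i.+1 q.
  by move=> iq; rewrite (ones_between_split (leqnSn i) iq) ones_betweenS // ones_between_refl.
case: eqP => ki; last first.
  rewrite big1 // => q /andP[iq qi]; have iq' : (i < q)%N.
    rewrite ltn_neqAle; case/andP: (iq) => -> _; rewrite andbT.
    by apply: contra qi => /eqP iE; apply/eqP/val_inj; rewrite /= inordK // ltnS.
  by move: iq; rewrite split //; case: eqP.
rewrite IHn //; last by move: rin; lia.
apply: eq_big => [q|q /andP[iq _]].
  case: (ltngtP i q) => [iq|qi|iq].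
  - rewrite split // ki eqxx /=; case: (ones_between _ _) => //=; apply/esym/eqP.
    by move/(congr1 val); rewrite /= inordK ?ltnS //; lia.
  - by rewrite (ones_lt q qi) /ones_between leqNgt (ltnW qi : (q < i.+1)%N).
  - have -> : q = inord i by apply/val_inj; rewrite /= inordK ?ltnS.
    by rewrite eqxx andbF /ones_between inordK ?ltnS // ltnn.
by rewrite -subSn // subSS.
Qed.

(** For fixed p and q the original cut i runs from p to q, and the products of coefficients add up
    to the coefficient of degree q - p in the product of the two series. *)
Lemma twist_conv (d e L M L' M' : nat -> R) :
  (forall i, (i <= r)%N -> L' i = \sum_(p < i.+1 | ones_between p i) d (i - p)%N * L p) ->
  (forall i, (i <= r)%N -> M' i = \sum_(q < r.+1 | ones_between i q) e (q - i)%N * M q) ->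
  \sum_(i < r.+1) L' i * M' i =
  \sum_(p < r.+1) \sum_(q < r.+1 | ones_between p q)
    ((d : fps R) * (e : fps R)) (q - p)%N * (L p * M q).
Proof.
move=> LE ME.
have LE' (i : 'I_r.+1) : L' i = \sum_(p < r.+1 | ones_between p i) d (i - p)%N * L p.
  rewrite LE ?leq_ord //.
  rewrite (big_ord_widen_cond r.+1 (fun p => ones_between p i) (fun p => d (i - p)%N * L p)) //.
  apply: eq_bigl => p; rewrite /ones_between ltnS.
  by case: (leqP p i); rewrite ?andbF ?andbT.
under eq_bigr => i _ do rewrite LE' (ME i (leq_ord i)) mulr_suml.
under eq_bigr => i _ do under eq_bigr => p _ do rewrite mulr_sumr.
rewrite (exchange_big_dep xpredT) //=; apply: eq_bigr => p _.
rewrite (exchange_big_dep (fun q : 'I_r.+1 => ones_between p q)) /=; last first.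
  move=> i q /[dup] /andP[pi _] pio /[dup] /andP[iq _] iqo.
  by rewrite (ones_between_split pi iq) pio.
apply: eq_bigr => q pq; have pq' : (p <= q)%N by case/andP: pq.
rewrite (eq_bigl (fun i : 'I_r.+1 => (p <= i < q.+1)%N)); last first.
  move=> i; apply/andP/andP => [[/andP[pi _] /andP[iq _]]|[pi iq]].
    by rewrite pi ltnS.
  by apply/andP; rewrite -(ones_between_split pi).
rewrite (eq_bigr (fun i : 'I_r.+1 => d (i - p)%N * e (q - i)%N * (L p * M q))); last first.
  by move=> i _; rewrite mulrACA.
rewrite -mulr_suml; congr (_ * _); rewrite fpsME.
rewrite -(big_mkord (fun i => (p <= i < q.+1)%N) (fun i => d (i - p)%N * e (q - i)%N)).
rewrite (big_cat_nat (leq0n p)) /=; last by rewrite (leq_trans pq') // ltnW.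
rewrite big_nat_cond big1 ?add0r; last first.
  by move=> i /andP[/andP[_ ip] /andP[pi _]]; move: ip; rewrite ltnNge pi.
rewrite (big_cat_nat (leqW pq')) /=; last exact: ltn_ord.
rewrite [X in _ + X]big_nat_cond [X in _ + X]big1 ?addr0; last first.
  by move=> i /andP[/andP[qi _] /andP[_ iq]]; move: iq; rewrite ltnNge qi.
rewrite big_nat_cond (eq_bigl (fun i => (p <= i < q.+1)%N && true)); last first.
  by move=> i; rewrite andbb andbT.
rewrite -big_nat_cond -{1}[p : nat]add0n big_addn subSn // big_mkord.
by apply: eq_bigr => i _; rewrite addnK subnDA subnAC.
Qed.

End Positions.

Lemma alternating_sum (A T : nat -> R) r :
  (forall i, (i <= r)%N -> A i = T i + T i.+1) -> T 0%N = 0 -> T r.+1 = 0 ->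
  \sum_(i < r.+1) (-1) ^+ (r - i)%N * A i = 0.
Proof.
move=> AE T0 Tr; rewrite -[RHS](mulr0 ((-1) ^+ r)).
rewrite (eq_bigr (fun i : 'I_r.+1 => (-1) ^+ r * ((-1) ^+ i * A i))); last first.
  move=> i _; rewrite mulrA -exprD -signr_odd -[in RHS]signr_odd.
  by rewrite oddD oddB ?leq_ord // -oddD addbC oddD addbC.
rewrite -mulr_sumr; congr (_ * _).
rewrite (eq_bigr (fun i : 'I_r.+1 => (-1) ^+ i * T i - (-1) ^+ i.+1 * T i.+1)); last first.
  by move=> i _; rewrite AE ?leq_ord // exprS mulN1r mulNr opprK mulrDr.
rewrite -(big_mkord xpredT (fun i => (-1) ^+ i * T i - (-1) ^+ i.+1 * T i.+1)).
under eq_bigr do rewrite -opprB.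
by rewrite sumrN telescope_sumr // T0 Tr !mulr0 subrr oppr0.
Qed.

(** The part of a product, of the star sum of [a :: p] with the word [q], in which the first letter
    of the merged word remains in front. *)
Definition star_head (z : seq nat -> R) a p q : R := \sum_(m <- comma_plus a p)
  \sum_(w <- qsh add_contr (behead m) q) z (head 0%N m :: w).

Lemma star_head_nil z a p : star_head z a p [::] = star z (a :: p).
Proof.
rewrite /star_head /star [LHS]big_seq [RHS]big_seq; apply: eq_bigr => m.
by move/comma_plus_neq0; case: m => // h m _; rewrite qshs0 big_seq1.
Qed.

(** Either the variable of [a] is strictly larger than that of [l], or [l] heads a longer star sum:
    its comma gives the strict inequality, and its plus gives the contraction. *)
Lemma star_head_cons z a p l q : star_head z a p (l :: q) + star_head z l (a :: p) q =
  \sum_(m <- cps (a :: p)) \sum_(w <- qsh add_contr m (l :: q)) z w.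
Proof.
rewrite /star_head [comma_plus l _]/= big_cat big_map comma_plus_add big_map /=.
rewrite [X in X + _ = _]big_seq [X in _ + (X + _) = _]big_seq
  [X in _ + (_ + X) = _]big_seq -!big_split [RHS]big_seq /=.
apply: eq_bigr => m /comma_plus_neq0; case: m => // h m _.
by rewrite (big_qsh_cons add_contr z) big_seq1 /= addrA [(l + h)%N]addnC.
Qed.

(* In the product of [k_1 <= ... <= k_i] and [k_{i+1} > ... > k_r], compare the
   two largest summation variables. *)
Lemma star_antipode z k : k != [::] -> is_index k ->
  is_char add_contr is_index z -> z [::] = 1 ->
  \sum_(i < (size k).+1) (-1) ^+ (size k - i)%N *
     (star z (rev (take i k)) * z (drop i k)) = 0.
Proof.
move=> k0 ik zM z1.
(* [T i] has k_i, counted from 1, at the largest variable: weakly above those of k_1, ..., k_(i-1)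
   and strictly above those of k_(i+1), ..., k_r. Two consecutive products share one such term. *)
pose T i := if i is j.+1 then
  if (j < size k)%N then star_head z (nth 0%N k j) (rev (take j k)) (drop j.+1 k) else 0
  else 0.
apply: (@alternating_sum (fun i => star z (rev (take i k)) * z (drop i k)) T) => //;
  last by rewrite /T ltnn.
move=> i ir.
have idx s : is_index (rev s) = is_index s by rewrite /is_index all_rev.
have [itk idk] : is_index (take i k) /\ is_index (drop i k).
  by apply/andP; rewrite -all_cat cat_take_drop.
have -> : star z (rev (take i k)) * z (drop i k) =
    \sum_(m <- cps (rev (take i k))) \sum_(w <- qsh add_contr m (drop i k)) z w.
  rewrite /star mulr_suml [LHS]big_seq [RHS]big_seq; apply: eq_bigr => m mt.
  by rewrite zM //; apply: cps_index mt; rewrite idx.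
case: i ir {itk idk} => [|i] ir.
  rewrite take0 drop0 big_seq1 qsh0s big_seq1 add0r /T.
  case: k k0 ik ir {T} => // a k _ _ _ /=.
  by rewrite drop0 /star_head /= big_seq1 /= qsh0s big_seq1.
rewrite /T ir (take_nth 0%N ir) rev_rcons; case: ltnP => [ilt|ri].
  by rewrite (drop_nth 0%N ilt) star_head_cons.
rewrite drop_oversize // addr0 star_head_nil /star.
by apply: eq_bigr => m _; rewrite qshs0 big_seq1.
Qed.

End CommaPlus.

(** * Words of posets *)

Section LinearExtensions.
Variable T : eqType.
Implicit Types (e : rel T) (E l : seq T) (p q : T).

(* The linear extensions of the partial order generated by [e] on [E], listed
   from the largest to the smallest element. *)
Definition compat e l : bool := pairwise (fun p q => ~~ e p q) l.
Definition lext e E : seq (seq T) := [seq l <- permutations E | compat e l].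

Variable M : nmodType.
Implicit Types F : seq T -> M.

Definition lext_sum e E F : M := \sum_(l <- lext e E) F l.

Lemma mem_lext e E l : (l \in lext e E) = perm_eq l E && compat e l.
Proof. by rewrite mem_filter mem_permutations andbC. Qed.

Lemma lext_uniq e E : uniq (lext e E).
Proof. by rewrite filter_uniq // permutations_uniq. Qed.

Lemma lext_sum_perm e E E' F : perm_eq E E' -> lext_sum e E F = lext_sum e E' F.
Proof.
move=> EE'; apply: perm_big; apply: uniq_perm; try exact: lext_uniq.
by move=> l; rewrite !mem_lext (permPr EE').
Qed.

Lemma lext_sum_eq e e' E F : {in E &, forall p q, e p q = e' p q} ->
  lext_sum e E F = lext_sum e' E F.
Proof.
move=> ee'; rewrite /lext_sum; congr (\sum_(l <- _) F l).
apply: eq_in_filter => l; rewrite mem_permutations => /perm_mem lE.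
apply: (eq_in_pairwise (P := mem E)); last by apply/allP => p; rewrite lE.
by move=> p q pE qE /=; rewrite ee'.
Qed.

Definition lext_max e E p := all (fun q => ~~ e p q) (rem p E).

Lemma lext_sum_rec e E F : uniq E -> E != [::] -> lext_sum e E F =
  \sum_(p <- E | lext_max e E p) lext_sum e (rem p E) (fun l => F (p :: l)).
Proof.
move=> uE E0; rewrite /lext_sum /lext big_filter big_mkcond.
have sE : (0 < size E)%N by rewrite lt0n size_eq0.
rewrite (perm_big _ (permutationsE sE)) /= undup_id // big_allpairs_dep /= [RHS]big_mkcond.
apply: eq_bigr => p _; rewrite big_filter.
rewrite [LHS]big_seq; case: ifP => pmax.
  rewrite [RHS]big_mkcond [RHS]big_seq; apply: eq_bigr => l.
  rewrite mem_permutations => /perm_all lE.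
  by rewrite lE -/(lext_max e E p) pmax.
rewrite big1 // => l; rewrite mem_permutations => /perm_all lE.
by rewrite lE -/(lext_max e E p) pmax.
Qed.

Lemma lext_sum_nil e F : lext_sum e [::] F = F [::].
Proof. by rewrite /lext_sum /= big_seq1. Qed.

Definition add_rel e a b : rel T := fun p q => e p q || (p == a) && (q == b).

Lemma not_before a b l : uniq l -> a \in l -> b \in l -> a != b ->
  pairwise (fun p q => ~~ ((p == a) && (q == b))) l =
  ~~ pairwise (fun p q => ~~ ((p == b) && (q == a))) l.
Proof.
have nope c d s : c \notin s -> pairwise (fun p q => ~~ ((p == c) && (q == d))) s.
  elim: s => //= x s IHs; rewrite in_cons negb_or => /andP[cx /IHs->].
  by rewrite andbT; apply/allP => y _; rewrite eq_sym (negPf cx).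
have nope' c d s : d \notin s -> pairwise (fun p q => ~~ ((p == c) && (q == d))) s.
  elim: s => //= x s IHs; rewrite in_cons negb_or => /andP[dx ds].
  rewrite IHs // andbT; apply/allP => y ys.
  have /negPf-> : y != d by apply: contraNneq ds => <-.
  by rewrite andbF.
elim: l => //= x l IHl /andP[xl ul]; rewrite !in_cons => al bl ab.
case: (eqVneq a x) al bl xl => [<-|ax] /= al bl xl.
  have bl' : b \in l by move: bl; rewrite eq_sym (negPf ab).
  rewrite (nope' _ _ _ xl) andbT.
  rewrite [in RHS](eq_in_all (a2 := predT)) ?all_predT //=; last first.
    by move=> y _; rewrite (negPf ab).
  apply/negbTE; rewrite negb_and; apply/orP; left; apply/allPn; exists b => //.
  by rewrite !eqxx.
case: (eqVneq b x) bl xl => [<-|bx] /= bl xl.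
  rewrite (nope' _ _ _ xl) andbT (nope _ _ _ xl) andbT.
  rewrite all_predT.
  by symmetry; apply/allPn; exists a => //; rewrite !eqxx.
rewrite !all_predT /=; exact: IHl.
Qed.

Lemma lext_sum_compare e E F a b : uniq E -> a \in E -> b \in E -> a != b ->
  lext_sum e E F = lext_sum (add_rel e a b) E F + lext_sum (add_rel e b a) E F.
Proof.
move=> uE aE bE ab; rewrite /lext_sum /lext !big_filter.
have E1 c d l : compat (add_rel e c d) l =
    compat e l && pairwise (fun p q => ~~ ((p == c) && (q == d))) l.
  rewrite /compat -pairwise_relI; apply: eq_pairwise => p q.
  by rewrite /add_rel negb_or.
rewrite (bigID (fun l => pairwise (fun p q => ~~ ((p == a) && (q == b))) l)) /=.
congr (_ + _); first by apply: eq_bigl => l; rewrite E1.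
rewrite big_seq_cond [RHS]big_seq_cond; apply: eq_bigl => l; rewrite E1.
case: (boolP (l \in _)) => //=; rewrite mem_permutations => lE.
by rewrite (@not_before b a l) ?(perm_uniq lE) ?(perm_mem lE) // eq_sym.
Qed.

Lemma rem_catl p E1 E2 : uniq (E1 ++ E2) -> p \in E1 ->
  rem p (E1 ++ E2) = rem p E1 ++ E2.
Proof.
rewrite cat_uniq => /[dup] u /and3P[u1 /hasPn d12 u2] pE1.
rewrite !rem_filter ?cat_uniq // filter_cat; congr (_ ++ _); rewrite -rem_filter //.
by apply: rem_id; apply: contraL pE1 => /d12.
Qed.

Lemma rem_catr p E1 E2 : uniq (E1 ++ E2) -> p \in E2 ->
  rem p (E1 ++ E2) = E1 ++ rem p E2.
Proof.
rewrite cat_uniq => /[dup] u /and3P[u1 /hasPn d12 u2] pE2.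
rewrite !rem_filter ?cat_uniq // filter_cat; congr (_ ++ _); rewrite -rem_filter //.
exact/rem_id/d12.
Qed.

(** The largest element of a linear extension is maximal in one of the two parts; removing it gives
    the recursion of the shuffle product. *)
Lemma lext_sum_disjoint e E1 E2 F : uniq (E1 ++ E2) ->
  {in E1 & E2, forall p q, ~~ e p q && ~~ e q p} ->
  lext_sum e (E1 ++ E2) F = \sum_(l1 <- lext e E1) \sum_(l2 <- lext e E2)
    \sum_(w <- qsh (fun _ _ => [::]) l1 l2) F w.
Proof.
have [n] := ubnP (size (E1 ++ E2)); elim: n E1 E2 F => // n IHn E1 E2 F sn uE e0.
have lext0 : lext e [::] = [:: [::]] by [].
case: (eqVneq E1 [::]) => [->|E10].
  rewrite lext0 big_seq1; apply: eq_bigr => l _; by rewrite qsh0s big_seq1.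
case: (eqVneq E2 [::]) => [->|E20].
  rewrite cats0; apply: eq_bigr => l _; by rewrite lext0 big_seq1 qshs0 big_seq1.
have /and3P[u1 /hasPn d12 u2] : [&& uniq E1, ~~ has (mem E1) E2 & uniq E2].
  by rewrite -cat_uniq.
rewrite lext_sum_rec //; last by case: (E1) E10.
rewrite big_cat /=.
pose G1 l1 l2 := if l1 is p :: l1' then
  \sum_(w <- qsh (fun _ _ => [::]) l1' l2) F (p :: w) else 0.
pose G2 l1 l2 := if l2 is q :: l2' then
  \sum_(w <- qsh (fun _ _ => [::]) l1 l2') F (q :: w) else 0.
have ne E l : E != [::] -> l \in lext e E -> l != [::].
  by rewrite mem_lext -!size_eq0 => E0 /andP[/perm_size->].
transitivity (\sum_(l1 <- lext e E1) \sum_(l2 <- lext e E2) (G1 l1 l2 + G2 l1 l2)); last first.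
  rewrite big_seq [RHS]big_seq; apply: eq_bigr => l1 /(ne _ _ E10).
  case: l1 => // p l1 _; rewrite big_seq [RHS]big_seq; apply: eq_bigr => l2 /(ne _ _ E20).
  by case: l2 => // q l2 _; rewrite (big_qsh_cons _ F) big_nil addr0.
under [RHS]eq_bigr => l1 _ do rewrite big_split /=.
rewrite [RHS]big_split /= [X in _ = _ + X]exchange_big /=; congr (_ + _).
  rewrite -[RHS]/(lext_sum e E1 (fun l1 => \sum_(l2 <- lext e E2) G1 l1 l2)).
  rewrite lext_sum_rec // big_seq_cond [RHS]big_seq_cond.
  apply: eq_big => [p|p /andP[pE1 _]].
    case: (boolP (p \in E1)) => //= pE1; rewrite /lext_max rem_catl // all_cat andbC.
    rewrite (_ : all _ E2 = true) //.
    by apply/allP => q qE2; case/andP: (e0 p q pE1 qE2).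
  rewrite rem_catl // IHn //.
  - rewrite size_cat size_rem //; move: sn pE1; rewrite size_cat.
    by case: (E1) => //= a s; rewrite addSn ltnS.
  - by rewrite -rem_catl // rem_uniq.
  - by move=> p' q' /mem_rem p'E; apply: e0.
rewrite -[RHS]/(lext_sum e E2 (fun l2 => \sum_(l1 <- lext e E1) G2 l1 l2)).
rewrite lext_sum_rec // big_seq_cond [RHS]big_seq_cond.
apply: eq_big => [p|p /andP[pE2 _]].
  case: (boolP (p \in E2)) => //= pE2; rewrite /lext_max rem_catr // all_cat.
  rewrite (_ : all _ E1 = true) //.
  by apply/allP => q qE1; case/andP: (e0 q p qE1 pE2).
rewrite rem_catr // IHn; first by rewrite exchange_big.
- rewrite size_cat size_rem //; move: sn pE2; rewrite size_cat.
  by case: (E2) => //= a s; rewrite addnS ltnS.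
- by rewrite -rem_catr // rem_uniq.
- by move=> p' q' p'E /mem_rem q'E; apply: e0.
Qed.

(** The relation [e] need only relate neighbours in [l]. Every element after the head lies below its
    predecessor, so the head alone can be taken as the largest. *)
Lemma lext_sum_chain e l F : uniq l -> sorted (fun p q => e q p) l ->
  pairwise (fun p q => ~~ e p q) l -> lext_sum e l F = F l.
Proof.
elim: l F => [|p l IHl] F; first by rewrite lext_sum_nil.
move=> upl; have /andP[pl ul] := upl; rewrite [sorted _ _]/= pairwise_cons => epl /andP[mp pw].
rewrite lext_sum_rec // big_cons.
have rp : rem p (p :: l) = l by rewrite /= eqxx.
have -> : lext_max e (p :: l) p by rewrite /lext_max rp.
rewrite rp big_seq_cond big1 ?addr0.
  by apply: IHl => //; apply: path_sorted epl.
move=> q /andP[ql /allP qmax]; exfalso.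
case/splitPr: ql epl upl qmax => l1 l2 + upl qmax; rewrite cat_path /= => /and3P[_ eq _].
have last1 : last p l1 \in rem q (p :: l1 ++ q :: l2).
  rewrite mem_rem_uniq // inE -cat_cons mem_cat mem_last orTb andbT.
  move: upl; rewrite -cat_cons cat_uniq => /and3P[_ /hasPn/(_ q) h _].
  apply: contraTneq (mem_last p l1) => ->; apply: h; exact: mem_head.
by have := qmax _ last1; rewrite eq.
Qed.

End LinearExtensions.

(** * Star posets and their partial unfoldings into chains *)

Section StarPosets.

(* Elements are coded as pairs [(i, m)], standing for p_{i+1,m+1}.  Besides the
   chains p_{i,1} < ... < p_{i,k_i}, the relation contains
   p_{i,1} < p_{i+1,k_{i+1}} when [up (i - 1)], and the reverse inequality when
   [dn (i - 1)]. *)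
Definition zigzag (k : seq nat) (up dn : pred nat) : rel (nat * nat) := fun p q =>
  [|| (q.1 == p.1) && (q.2 == p.2.+1),
      [&& up p.1, q.1 == p.1.+1, p.2 == 0%N & q.2.+1 == nth 0%N k q.1] |
      [&& dn q.1, p.1 == q.1.+1, q.2 == 0%N & p.2.+1 == nth 0%N k p.1]].

Definition nodes (a b : nat) (k : seq nat) : seq (nat * nat) :=
  [seq (j, m) | j <- iota a (b - a), m <- iota 0 (nth 0%N k j)].

Definition node_label (p : nat * nat) : bool := if p.2 == 0%N then ly else lx.

Lemma mem_nodes a b k j m :
  ((j, m) \in nodes a b k) = [&& (a <= j)%N, (j < b)%N & (m < nth 0%N k j)%N].
Proof.
apply/allpairsPdep/and3P => [[j' [m' [+ + [-> ->]]]]|[aj jb mk]].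
  rewrite !mem_iota add0n => /andP[aj' j'b] /= m'k; split=> //; lia.
by exists j, m; rewrite !mem_iota; split=> //; lia.
Qed.

Lemma nodes_uniq a b k : uniq (nodes a b k).
Proof.
apply: allpairs_uniq_dep; rewrite ?iota_uniq //; first by move=> ? _; exact: iota_uniq.
by move=> [j m] [j' m'] _ _ /= [-> ->].
Qed.

Lemma nodes_cat a b c k : (a <= b)%N -> (b <= c)%N ->
  nodes a c k = nodes a b k ++ nodes b c k.
Proof.
move=> ab bc; rewrite /nodes; have -> : (c - a = (b - a) + (c - b))%N by lia.
by rewrite iotaD subnKC // map_cat flatten_cat.
Qed.

Fixpoint column (j a : nat) : seq (nat * nat) :=
  if a is b.+1 then (j, b) :: column j b else [::].

(** Columns are listed from the top down and one after the other. This is the only linear extension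
    once every link between columns points down, and its labels spell the word of the index. *)
Fixpoint chain (j : nat) (ks : seq nat) : seq (nat * nat) :=
  if ks is a :: ks' then column j a ++ chain j.+1 ks' else [::].

Lemma mem_column j a j' m : ((j', m) \in column j a) = (j' == j) && (m < a)%N.
Proof.
elim: a => [|a IHa] /=; first by rewrite in_nil andbF.
by rewrite in_cons IHa xpair_eqE -andb_orr ltnS [in RHS]leq_eqVlt.
Qed.

Lemma mem_chain j ks j' m : ((j', m) \in chain j ks) =
  [&& (j <= j')%N, (j' < j + size ks)%N & (m < nth 0%N ks (j' - j))%N].
Proof.
elim: ks j => [|a ks IHks] j /=.
  by rewrite in_nil; apply/esym/negbTE/and3P => -[] *; lia.
rewrite mem_cat mem_column IHks.
case: (ltngtP j j') => [jj'|jj'|<-].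
- by rewrite /= addSnnS; have -> : (j' - j = (j' - j.+1).+1)%N by lia.
- by [].
- have -> : (j < j + (size ks).+1)%N by lia.
  by rewrite subnn /= orbF.
Qed.

Lemma chain_label j ks : is_index ks ->
  [seq node_label p | p <- chain j ks] = index_rword ks.
Proof.
elim: ks j => [|a ks IHks] j //= /andP[a0 iks].
rewrite map_cat IHks // index_rword_cons -cat_rcons; congr (_ ++ _).
case: a a0 => // a _ /=; elim: a => //= a IHa.
by rewrite /node_label /= IHa.
Qed.

Definition chain_before (p q : nat * nat) : bool :=
  (p.1 < q.1)%N || (p.1 == q.1) && (q.2 < p.2)%N.

Lemma chain_pairwise j ks : pairwise chain_before (chain j ks).
Proof.
elim: ks j => [|a ks IHks] j //=; rewrite pairwise_cat IHks andbT; apply/andP; split.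
  apply/allrelP => -[j1 m1] [j2 m2]; rewrite mem_column mem_chain /chain_before /=.
  by case/andP => /eqP -> _ /andP[-> _].
elim: a => //= a ->; rewrite andbT; apply/allP => -[j' m].
by rewrite mem_column /chain_before /= => /andP[/eqP-> ->]; rewrite eqxx orbT.
Qed.

Lemma chain_uniq j ks : uniq (chain j ks).
Proof.
apply: pairwise_uniq (chain_pairwise j ks) => -[p1 p2].
by rewrite /chain_before /= ltnn ltnn andbF.
Qed.

Lemma nodes_chain i k : (i <= size k)%N ->
  perm_eq (nodes i (size k) k) (chain i (drop i k)).
Proof.
move=> ik; apply: uniq_perm; [exact: nodes_uniq | exact: chain_uniq |].
move=> [j m]; rewrite mem_nodes mem_chain size_drop subnKC // nth_drop.
by case: (leqP i j) => // ij; rewrite subnKC.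
Qed.

Variables (k : seq nat).
Hypothesis ik : is_index k.
Local Notation r := (size k).

Lemma nth_is_index j : (j < r)%N -> (0 < nth 0%N k j)%N.
Proof. by move=> jr; apply: (allP ik); apply: mem_nth. Qed.

Lemma chain_sorted i (up dn : pred nat) : (i <= r)%N -> (forall j, (i <= j)%N -> dn j) ->
  sorted (fun p q => zigzag k up dn q p) (chain i (drop i k)).
Proof.
move=> ir dnj; have [n] := ubnP (r - i)%N; elim: n i ir dnj => // n IHn i ir dnj rn.
case: (ltnP i r) => [ilt|ri]; last by rewrite drop_oversize.
have srt : sorted (fun p q => zigzag k up dn q p) (chain i.+1 (drop i.+1 k)).
  by apply: IHn => //; [move=> j /ltnW/dnj | lia].
rewrite (drop_nth 0%N ilt) /=; case: (nth 0%N k i) (nth_is_index ilt) => // a _ /=.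
elim: a => [|a IHa] /=; last first.
  by rewrite IHa andbT /zigzag /= !eqxx.
case: (ltnP i.+1 r) => [ilt'|ri]; last by rewrite drop_oversize.
move: srt; rewrite (drop_nth 0%N ilt') /=.
case E : (nth 0%N k i.+1) (nth_is_index ilt') => [//|b] _ /= ->; rewrite andbT.
by rewrite /zigzag /= E dnj // !eqxx /= !orbT.
Qed.

Variable M : nmodType.
Variable F : seq (nat * nat) -> M.

Lemma chain_sum i (up dn : pred nat) : (i <= r)%N -> (forall j, (i <= j)%N -> dn j) ->
  (forall j, (i <= j)%N -> ~~ up j) ->
  lext_sum (zigzag k up dn) (nodes i r k) F = F (chain i (drop i k)).
Proof.
move=> ir dnj upj; rewrite (lext_sum_perm _ _ (nodes_chain ir)).
apply: lext_sum_chain; [exact: chain_uniq | exact: chain_sorted |].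
have := chain_pairwise i (drop i k).
apply: (sub_in_pairwise (P := mem (chain i (drop i k)))); last exact/allP.
move=> [p1 p2] [q1 q2] pc _.
have {pc} : (p1, p2) \in chain i (drop i k) by exact: pc.
rewrite mem_chain /chain_before /zigzag /= => /andP[ip _]; rewrite (negPf (upj _ ip)) /=.
case/orP => [pq|/andP[/eqP -> qp]].
  by rewrite (gtn_eqF pq) /=; apply/and4P => -[_ /eqP] *; lia.
by apply/orP => -[/andP[_ /eqP] *|/and4P[_ /eqP] *]; lia.
Qed.

(** The first i columns form a star poset; every later link, including the one that leaves those
    columns, points down. Writing [j.+1] avoids truncated subtraction at i = 0. *)
Definition stage_rel i := zigzag k (fun j => (j.+1 < i)%N) (fun j => (i <= j.+1)%N).

Definition stage i : M := lext_sum (stage_rel i) (nodes 0 r k) F.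

(** On the left the link between columns i and i + 1 is absent. Deciding the order of its two
    endpoints makes it point down or up. *)
Lemma stage_compare i : (i.+1 < r)%N ->
  lext_sum (zigzag k (fun j => (j.+1 < i.+1)%N) (fun j => (i.+1 <= j)%N))
    (nodes 0 r k) F = stage i.+1 + stage i.+2.
Proof.
move=> ir; have ki := nth_is_index ir; have ki' := nth_is_index (ltnW ir).
rewrite (@lext_sum_compare _ _ _ _ _ (i.+1, (nth 0%N k i.+1).-1) (i, 0%N)).
- congr (_ + _); apply: lext_sum_eq => -[p1 p2] [q1 q2] _ _;
    rewrite /stage_rel /add_rel /zigzag /= !xpair_eqE.
    case: (eqVneq p1 i.+1) => [->|p1i] /=.
      by case: (eqVneq q1 i) => [->|qi] /=; lia.
    by apply/idP/idP; lia.
  case: (eqVneq q1 i.+1) => [->|q1i] /=; last by apply/idP/idP; lia.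
  by case: (eqVneq p1 i) => [->|pi] /=; lia.
- exact: nodes_uniq.
- by rewrite mem_nodes /= ir; lia.
- by rewrite mem_nodes /= ki' ltnW.
- by rewrite xpair_eqE; lia.
Qed.

End StarPosets.

Section StarPosetValues.
Variable R : realType.

Definition label_value (l : seq (nat * nat)) : R :=
  sh_reg R [seq node_label p | p <- l].

Definition star_value (ks : seq nat) : R :=
  lext_sum (zigzag ks xpredT xpred0) (nodes 0 (size ks) ks) label_value.

Lemma qsh_map (T T' : eqType) (f : T -> T') (s t : seq T) :
  qsh (fun _ _ => [::]) (map f s) (map f t) =
  [seq map f w | w <- qsh (fun _ _ => [::]) s t].
Proof.
elim: s t => [|a s IHs] t; first by rewrite /= !qsh0s.
elim: t => [|b t IHt]; first by rewrite /= !qshs0.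
rewrite [map f (a :: s)]/= [map f (b :: t)]/= !qsh_cons /= !cats0 map_cat -!map_comp.
rewrite -[f b :: map f t]/(map f (b :: t)) -[f a :: map f s]/(map f (a :: s)).
by rewrite IHs IHt -!map_comp.
Qed.

(* A minimal element of a star poset is labelled [ly]. *)
Lemma lext_sh_dom ks l : l \in lext (zigzag ks xpredT xpred0) (nodes 0 (size ks) ks) ->
  sh_dom [seq node_label p | p <- l].
Proof.
rewrite mem_lext => /andP[lE cl]; rewrite /sh_dom.
case/lastP: l lE cl => // l [j m] lE cl; rewrite map_rcons last_rcons /node_label /=.
case: m lE cl => // m lE; rewrite /compat pairwise_rcons => /andP[/allP h _].
have : (j, m.+1) \in nodes 0 (size ks) ks by rewrite -(perm_mem lE) mem_rcons mem_head.
rewrite mem_nodes => /and3P[_ js mk].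
have : (j, m) \in rcons l (j, m.+1) by rewrite (perm_mem lE) mem_nodes js (ltnW mk).
rewrite mem_rcons in_cons xpair_eqE eqxx (ltn_eqF (ltnSn m)) /= => jml.
by have := h _ jml; rewrite /zigzag /= !eqxx.
Qed.

Lemma nodes_take i k : (i <= size k)%N -> nodes 0 i (take i k) = nodes 0 i k.
Proof.
move=> ik; rewrite /nodes subn0; congr flatten; apply/eq_in_map => j.
by rewrite mem_iota => /andP[_ ji]; rewrite nth_take.
Qed.

(** The character property turns the product into a sum over linear extensions of a star poset next
    to a disjoint chain, which is the poset with one link cut. [stage_compare] then makes the
    alternating sum telescope, and the extreme stages are the whole chain and the whole star
    poset. *)
Lemma star_value_antipode k : is_index k -> k != [::] ->
  \sum_(i < (size k).+1) (-1) ^+ (size k - i)%N *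
    (star_value (take i k) * shz R (drop i k)) = 0.
Proof.
move=> ik k0; have k_gt0 : (0 < size k)%N by rewrite lt0n size_eq0.
have [_ idk] := index_take_drop ik.
have chainE i : label_value (chain i (drop i k)) = shz R (drop i k).
  by rewrite /label_value chain_label.
pose T i := if i is 0%N then 0 else
  if (i <= size k)%N then stage k label_value i else 0.
apply: (@alternating_sum _ (fun i => star_value (take i k) * shz R (drop i k)) T) => //;
  last by rewrite /T ltnn.
have headE i : (i <= size k)%N -> star_value (take i k) =
    lext_sum (zigzag k (fun j => (j.+1 < i)%N) (fun j => (i <= j)%N)) (nodes 0 i k) label_value.
  move=> ir; rewrite /star_value size_takel // nodes_take //.
  apply: lext_sum_eq => -[p1 p2] [q1 q2]; rewrite !mem_nodes /zigzag /=.
  move=> /andP[pi _] /andP[qi _]; rewrite nth_take // [(i <= q1)%N]leqNgt qi /=.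
  by case: (eqVneq q1 p1.+1) qi => [->|] qi; rewrite ?qi ?andbF.
case=> [_|i ir].
  have -> : star_value (take 0 k) = 1.
    rewrite take0 /star_value /= lext_sum_nil /label_value /=.
    by rewrite -[[::]]/(index_rword [::]) sh_reg_radm // zeta_nil.
  rewrite mul1r drop0 add0r /T k_gt0 /stage /stage_rel chain_sum //.
  by rewrite -{1}[k]drop0 chainE drop0.
rewrite headE //.
case: (ltnP i.+1 (size k)) => [ilt|ri]; last first.
  have iE : i.+1 = size k by apply/eqP; rewrite eqn_leq ir.
  rewrite /T ir ltnNge ri addr0 drop_oversize // /stage iE.
  have -> : shz R [::] = 1 by rewrite /shz sh_reg_radm // zeta_nil.
  rewrite mulr1; apply: lext_sum_eq => -[p1 p2] [q1 q2]; rewrite !mem_nodes /zigzag /=.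
  move=> /andP[pi _] /andP[qi _]; congr [|| _, _ | _].
  rewrite [(size k <= q1)%N]leqNgt qi /=; apply/esym/and4P => -[h /eqP pE _ _].
  by move: pi; rewrite pE ltnNge h.
rewrite /T ir ilt -stage_compare // (nodes_cat _ (leq0n i.+1) (ltnW ilt)).
rewrite [RHS]lext_sum_disjoint; first last.
- move=> [p1 p2] [q1 q2]; rewrite !mem_nodes /zigzag /= => /andP[pi _] /and3P[iq _ _].
  by apply/andP; split; apply/negP; lia.
- by rewrite -nodes_cat ?nodes_uniq // ltnW.
rewrite /lext_sum mulr_suml [LHS]big_seq [RHS]big_seq; apply: eq_bigr => l1 l1E.
have V1 : sh_dom [seq node_label p | p <- l1].
  move: l1E; have := headE i.+1 ir; rewrite /star_value => _.
  rewrite mem_lext => /andP[l1n l1c].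
  apply: (@lext_sh_dom (take i.+1 k)); rewrite mem_lext size_takel // nodes_take // l1n.
  apply: (sub_in_pairwise (P := mem l1)) l1c; last exact/allP.
  move=> [p1 p2] [q1 q2] pl ql.
  have {pl} : (p1, p2) \in l1 by exact: pl.
  have {ql} : (q1, q2) \in l1 by exact: ql.
  rewrite !(perm_mem l1n) !mem_nodes /zigzag /=.
  move=> /andP[qi _] /andP[pi _]; rewrite nth_take //.
  apply: contra => /or3P[->//|/and3P[/eqP qE -> ->]|//].
  by rewrite -qE qi eqxx orbT.
have := @chain_sum k ik _ (fun l2 => \sum_(w <- qsh (fun _ _ => [::]) l1 l2) label_value w)
  i.+1 (fun j => (j.+1 < i.+1)%N) (fun j => (i.+1 <= j)%N) ir.
rewrite /lext_sum => -> //; last by move=> j; rewrite -leqNgt => /leqW.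
rewrite -chainE /label_value.
have V2 : sh_dom [seq node_label p | p <- chain i.+1 (drop i.+1 k)].
  by rewrite chain_label //; exact: index_rword_dom.
rewrite sh_reg_char // [qsh no_contr _ _]qsh_map big_map.
by [].
Qed.

End StarPosetValues.

Lemma pairwise_rev (T : Type) (e : rel T) (s : seq T) :
  pairwise e (rev s) = pairwise (fun p q => e q p) s.
Proof.
elim: s => //= a s IHs; rewrite rev_cons pairwise_rcons IHs; congr (_ && _).
by rewrite all_rev.
Qed.

(** * Linear extensions of a finite poset as lists of nodes *)

Section PosetWords.
Variables (disp : Order.disp_t) (P : finPOrderType disp) (gen : rel P).
Hypothesis gen_lt : forall p q, gen p q -> (p < q)%O.
Hypothesis le_gen : forall p q, (p <= q)%O -> connect gen p q.
Variables (T : eqType) (e : rel T) (E : seq T) (pos : P -> T).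
Hypothesis pos_inj : injective pos.
Hypothesis posE : perm_eq [seq pos p | p <- enum P] E.
Hypothesis pos_gen : forall p q, e (pos p) (pos q) = gen p q.

Lemma gen_index (s : seq P) : (forall p, p \in s) ->
  pairwise (fun p q => ~~ gen q p) s ->
  forall p q, (p < q)%O -> (index p s < index q s)%N.
Proof.
move=> sP pw.
have step p q : gen p q -> (index p s < index q s)%N.
  move=> pq; rewrite ltnNge leq_eqVlt negb_or; apply/andP; split.
    apply/eqP => /(congr1 (nth p s)); rewrite !nth_index // => qp.
    by have := gen_lt pq; rewrite qp ltxx.
  apply/negP => qp; have := pairwiseP p pw; move/(_ (index q s) (index p s)).
  by rewrite !inE !index_mem !sP !nth_index // pq => /(_ isT isT qp).
move=> p q; rewrite lt_neqAle => /andP[pq /le_gen/connectP[c + qE]].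
have {pq} c0 : c != [::] by apply: contraNneq pq => c0; rewrite qE c0.
rewrite {}qE; elim: c p c0 => // a c IHc p _ /= /andP[/step pa ac].
case: (eqVneq c [::]) => [->//|c0]; exact: ltn_trans pa (IHc _ c0 ac).
Qed.

(** A bijection corresponds to the reversed list of its values. Compatibility of a list is tested on
    generating relations only, and [gen_index] extends it to the whole order. *)
Lemma poset_wordE (lab : T -> letter) :
  poset_word (fun p : P => lab (pos p)) =
  \sum_(l <- lext e E) wmon (rev [seq lab x | x <- l]).
Proof.
pose f (g : {ffun 'I_#|P| -> P}) := rev [seq pos (g i) | i <- enum 'I_#|P|].
rewrite /poset_word -big_filter.
rewrite (eq_bigr (fun g => wmon (rev [seq lab x | x <- f g]))); last first.
  by move=> g _; rewrite /f map_rev revK -map_comp.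
rewrite -(big_map f xpredT (fun l => wmon (rev [seq lab x | x <- l]))).
apply: perm_big; apply: uniq_perm; last 1 first.
- move=> l; rewrite mem_lext; apply/mapP/andP => [[g + ->]|[lE cl]].
    rewrite mem_filter => /andP[/andP[/injectiveP gi /forallP mono] _]; split.
      rewrite /f (perm_trans _ posE) // perm_rev perm_sym (map_comp pos g).
      apply: perm_map; apply: uniq_perm => [||p]; first exact: enum_uniq.
        by rewrite (map_inj_uniq gi) enum_uniq.
      rewrite mem_enum; symmetry.
      have /(_ p)/codomP[i ->] := inj_card_onto gi (eq_leq (esym (card_ord _))).
      by apply: map_f; rewrite mem_enum.
    rewrite /compat /f pairwise_rev pairwise_map.
    have : pairwise ltn [seq val i | i <- enum 'I_#|P|].
      by rewrite val_enum_ord -sorted_pairwise ?iota_ltn_sorted //; exact: ltn_trans.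
    rewrite pairwise_map; apply: sub_pairwise => i j ij.
    rewrite /= pos_gen; apply/negP => /gen_lt.
    have /forallP/(_ i)/implyP h := mono j.
    by move/h; rewrite ltnNge (ltnW ij).
  have [s sE] : exists s, rev l = [seq pos p | p <- s].
    have : all (mem [seq pos p | p <- enum P]) (rev l).
      by apply/allP => x; rewrite mem_rev (perm_mem lE) -(perm_mem posE).
    elim: (rev l) => [|x c IHc] /=; first by exists [::].
    by case/andP => /mapP[p _ ->] /IHc[s ->]; exists (p :: s).
  have sP : perm_eq s (enum P).
    apply: (@perm_map_inj _ _ pos) => //.
    by rewrite -sE (perm_trans _ (perm_trans lE _)) ?perm_rev // perm_sym.
  have us : uniq s by rewrite (perm_uniq sP) enum_uniq.
  have szs : size s = #|P| by rewrite (perm_size sP) cardE.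
  have ins p : p \in s by rewrite (perm_mem sP) mem_enum.
  (* The default [enum_val i] avoids assuming that [P] is inhabited; it is never returned, as [s]
     has length [#|P|]. *)
  pose g := [ffun i : 'I_#|P| => nth (enum_val i) s i].
  have gE : [seq g i | i <- enum 'I_#|P|] = s.
    case: (s) szs ins @g => [|p s'] szs ins g.
      move=> *; apply/size0nil; rewrite size_map -cardE card_ord -szs //.
    rewrite -[RHS](mkseq_nth p) szs /mkseq -val_enum_ord -map_comp.
    by apply: eq_map => i; rewrite ffunE /=; apply: set_nth_default; rewrite szs.
  have gidx i : index (g i) s = i.
    by rewrite ffunE index_uniq // szs.
  exists g; last by rewrite /f (map_comp pos g) gE -sE revK.
  rewrite mem_filter mem_index_enum andbT; apply/andP; split.
    by apply/injectiveP => i j ij; apply/val_inj; rewrite -[LHS]gidx -[RHS]gidx ij.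
  apply/forallP => i; apply/forallP => j; apply/implyP => ij.
  rewrite -[X in (X < _)%N]gidx -[X in (_ < X)%N]gidx; apply: gen_index => //.
  move: cl; rewrite /compat -[l]revK pairwise_rev sE pairwise_map.
  by apply: sub_pairwise => p q /=; rewrite pos_gen.
- rewrite map_inj_uniq ?filter_uniq ?index_enum_uniq // => g g' /(can_inj revK) gg'.
  apply/ffunP => i; apply: pos_inj.
  by move/eq_in_map: gg' => /(_ i); rewrite mem_enum => /(_ isT).
- exact: lext_uniq.
Qed.

End PosetWords.

Section StarWord.
Variable k : seq nat.

Definition star_pos (p : star_poset k) : nat * nat := (val (tag p), val (tagged p)).

Lemma star_pos_inj : injective star_pos.
Proof.
by move=> [i m] [j n] [] /val_inj ij; case: j / ij n => n /= /val_inj ->.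
Qed.

Lemma star_posE : perm_eq [seq star_pos p | p <- enum {: star_poset k}] (nodes 0 (size k) k).
Proof.
apply: uniq_perm; rewrite ?nodes_uniq ?(map_inj_uniq star_pos_inj) ?enum_uniq //.
move=> [j m]; rewrite mem_nodes /=; apply/mapP/andP => [[p _ [-> ->]]|[js mk]].
  by rewrite !ltn_ord.
pose i : 'I_(size k) := Ordinal js.
by exists (Tagged (fun i : 'I_(size k) => 'I_(nth 0%N k i)) (Ordinal mk : 'I_(nth 0%N k i)));
  rewrite ?mem_enum.
Qed.

Lemma wstarE : wstar k = \sum_(l <- lext (zigzag k xpredT xpred0) (nodes 0 (size k) k))
  wmon (rev [seq node_label x | x <- l]).
Proof.
rewrite -(@poset_wordE _ (star_poset k) (@star_gen k) _ _ _ _ _ star_pos) //.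
- move=> p q pq; rewrite lt_neqAle; apply/andP; split; last exact: connect1.
  by apply: contraTneq (star_gen_rank pq) => ->; rewrite ltnn.
- exact: star_pos_inj.
- exact: star_posE.
- by move=> p q; rewrite /zigzag /star_gen /= orbF.
Qed.

Lemma zeta_star_KYE (R : realType) : zeta_star_KY R k = star_value R k.
Proof.
have [hreg h] := Zreg_shE R; rewrite /zeta_star_KY wstarE (reg_sum hreg).
  rewrite horner_sum /star_value /lext_sum [LHS]big_seq [RHS]big_seq.
  by apply: eq_bigr => l /lext_sh_dom dl; rewrite h.
by move=> l /lext_sh_dom/rev_word1/Hoff1_wmon.
Qed.
End StarWord.

(** * The symmetric sums *)

Section SymmetricSums.
Variable R : comNzRingType.
Implicit Types (F z : seq nat -> R) (q w : seq nat) (n : nat) (d : nat -> R).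

(** The inner sum of [symm_star] as a recursion on the index, which lets the function [F] absorb the
    entries already shifted. *)
Fixpoint pser F q n : R :=
  if q is a :: q' then
    \sum_(j < n.+1) 'C(a + j - 1, j)%:R * pser (fun w => F ((a + j)%N :: w)) q' (n - j)
  else if n == 0%N then F [::] else 0.

Lemma pser_ext F F' q n : is_index q -> (forall w, is_index w -> F w = F' w) ->
  pser F q n = pser F' q n.
Proof.
elim: q F F' n => [|a q IHq] F F' n /=; first by move=> _ ->.
case/andP => a0 iq FF'; apply: eq_bigr => j _; congr (_ * _).
by apply: IHq => // w iw; apply: FF'; rewrite /= addn_gt0 a0.
Qed.

Lemma pserD F F' q n : pser (fun w => F w + F' w) q n = pser F q n + pser F' q n.
Proof.
elim: q F F' n => [|a q IHq] F F' n /=; first by case: ifP; rewrite ?addr0.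
by rewrite -big_split /=; apply: eq_bigr => j _; rewrite IHq mulrDr.
Qed.

Lemma pserZ (c : R) F q n : pser (fun w => c * F w) q n = c * pser F q n.
Proof.
elim: q F n => [|a q IHq] F n /=; first by case: ifP; rewrite ?mulr0.
by rewrite mulr_sumr; apply: eq_bigr => j _; rewrite IHq mulrCA.
Qed.

Lemma pser0 q n : pser (fun=> 0) q n = 0.
Proof.
elim: q n => [|a q IHq] n /=; first by case: ifP.
by rewrite big1 // => j _; rewrite IHq mulr0.
Qed.

(** The bound N on the entries is kept separate from n, which decreases along the recursion while
    the type of the tuples stays fixed. *)
Lemma tuple_sum_pser F q m N n : size q = m -> (n <= N)%N ->
  \sum_(l : m.-tuple 'I_N.+1 | (\sum_(a <- l) a)%N == n)
     (\prod_(p <- zip q (map val l)) 'C(p.1 + p.2 - 1, p.2))%:R *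
     F [seq (p.1 + p.2)%N | p <- zip q (map val l)] = pser F q n.
Proof.
elim: q m F n => [|a q IHq] [|m] F n //= => [_|[szq]] nN.
  rewrite (eq_bigl (fun=> n == 0%N)); last first.
    by move=> l; rewrite tuple0 big_nil eq_sym.
  case: ifP => _; last by rewrite big_pred0.
  rewrite (big_pred1 [tuple]) => [|l]; first by rewrite big_nil mul1r.
  by apply/esym/eqP/val_inj; rewrite tuple0.
have bij : bijective (fun p : 'I_N.+1 * m.-tuple 'I_N.+1 => [tuple of p.1 :: p.2]).
  exists (fun t : m.+1.-tuple 'I_N.+1 => (thead t, [tuple of behead t])).
    by case=> x t /=; rewrite theadE; congr (_, _); apply/val_inj.
  by move=> t; rewrite -tuple_eta.
rewrite (reindex _ (onW_bij _ bij)) /=.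
rewrite (eq_bigl (fun p : 'I_N.+1 * m.-tuple 'I_N.+1 => xpredT p.1 &&
  ((p.1 <= n) && (\sum_(a <- p.2) a == n - p.1)))%N); last first.
  move=> [x t] /=; rewrite big_cons; case: leqP => xn /=; apply/eqP/eqP; lia.
rewrite -(pair_big_dep xpredT (fun (x : 'I_N.+1) (t : m.-tuple 'I_N.+1) =>
   (x <= n)%N && ((\sum_(a <- t) a)%N == (n - x)%N))
  (fun (x : 'I_N.+1) (t : m.-tuple 'I_N.+1) =>
    (\prod_(p <- (a, val x) :: zip q (map val t)) 'C(p.1 + p.2 - 1, p.2))%:R *
    F ((a + x)%N :: [seq (p.1 + p.2)%N | p <- zip q (map val t)]))) /=.
rewrite (big_ord_widen N.+1 (fun j => 'C(a + j - 1, j)%:R *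
  pser (fun w => F ((a + j)%N :: w)) q (n - j)%N)) // [RHS]big_mkcond.
apply: eq_bigr => x _; rewrite ltnS; case: leqP => xn /=; last by rewrite big_pred0.
rewrite -(IHq m) ?(leq_trans (leq_subr _ _)) // mulr_sumr; apply: eq_bigr => t _.
by rewrite big_cons natrM mulrA.
Qed.

(** A shifted entry a + j equals 1 only for a = 1 and j = 0, where the binomial coefficient is 1.
    The ones that a twist strips are therefore unshifted, and twisting commutes with the expansion
    in t. *)
Lemma pser_twist d z q n : is_index q ->
  pser (twist d z) q n = twist d (fun q => pser z q n) q.
Proof.
elim: q d n => [|a q IHq] d n /=; first by rewrite !addr0; case: ifP; rewrite ?mulr0.
case/andP => a0 iq.
rewrite (eq_bigr (fun j : 'I_n.+1 =>
    d 0%N * ('C(a + j - 1, j)%:R * pser (fun w => z ((a + j)%N :: w)) q (n - j)) +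
    (if (a + j == 1)%N then pser (twist (fun i => d i.+1) z) q n else 0))); last first.
  move=> j _; rewrite pserD pserZ mulrDr mulrCA; congr (_ + _).
  case: eqP => aj; last by rewrite pser0 mulr0.
  have [-> ->] : a = 1%N /\ (j : nat) = 0%N by lia.
  by rewrite subn0 bin0 mul1r.
rewrite big_split /= -mulr_sumr; congr (_ + _).
case: (eqVneq a 1%N) => [->|a1].
  rewrite big_ord_recl big1 // addr0 /=.
  exact: IHq.
by rewrite big1 // => j _; case: ifP => // /eqP; move: a1; lia.
Qed.

Lemma symm_sumE (zs z : seq nat -> R) k n : is_index k ->
  (forall q, is_index q -> zs q = z (rev q)) ->
  \sum_(i < (size k).+1)
    (-1) ^+ sumn (drop i k) * zs (take i k) *
    (\sum_(l : (size k - i).-tuple 'I_n.+1 | (\sum_(a <- l) a)%N == n)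
      let s := zip (drop i k) (map val l) in
      (\prod_(p <- s) 'C(p.1 + p.2 - 1, p.2))%:R *
      zs (rev [seq (p.1 + p.2)%N | p <- s])) =
  \sum_(i < (size k).+1) z (rev (take i k)) *
    ((-1) ^+ sumn (drop i k) * pser z (drop i k) n).
Proof.
move=> ik zsE; have [itk idk] := index_take_drop ik.
apply: eq_bigr => i _; rewrite zsE // -mulrA mulrCA; congr (_ * (_ * _)).
rewrite (@tuple_sum_pser (fun w => zs (rev w)) (drop i k) (size k - i)%N n n) ?size_drop //.
by apply: pser_ext => // w iw; rewrite zsE ?revK // /is_index all_rev.
Qed.

End SymmetricSums.

(** * Twisted symmetric sums modulo zeta(2) *)

Section Congruence.
Variable R : realType.
Implicit Types (z : seq nat -> R) (d : fps R) (k q : seq nat).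

Lemma twist_span z (d : nat -> R) q : (forall i, MZV_span (d i)) ->
  (forall t, is_index t -> MZV_span (z t)) -> is_index q -> MZV_span (twist d z q).
Proof.
move=> sd sz; elim: q d sd => [|a q IHq] d sd iq /=; apply: spanD.
- exact/spanM/sz.
- exact: span0.
- exact/spanM/sz.
- by case: ifP => _; [apply: IHq => //; case/andP: iq | exact: span0].
Qed.

Lemma pser_span z q n : is_index q -> (forall t, is_index t -> MZV_span (z t)) ->
  MZV_span (pser z q n).
Proof.
elim: q z n => [|a q IHq] z n iq sz /=; first by case: ifP => _; [exact: sz | exact: span0].
case/andP: iq => a0 iq; apply: span_sum_fin => j _.
rewrite -(rmorph_nat (@ratr R)); apply: spanZ; apply: IHq => // w iw.
by apply: sz; rewrite /= addn_gt0 a0.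
Qed.

Lemma ones_between_sumn k (p q : nat) : ones_between k p q -> (q <= size k)%N ->
  sumn (drop p k) = (q - p + sumn (drop q k))%N.
Proof.
case/andP=> pq ones qr.
have -> : drop p k = drop p (take q k) ++ drop q k.
  by rewrite -{1}(cat_take_drop q k) drop_cat size_takel //; case: ltngtP pq => //
   [->]; rewrite subnn drop0 [drop q (take q k)]drop_oversize // size_takel.
rewrite sumn_cat; congr (_ + _)%N; move: ones => /all_pred1P->.
by rewrite sumn_nseq mul1n size_drop size_takel.
Qed.

(** A run of q - p ones stripped from the right factor changes its sign by (-1)^(q - p), which
    replaces d(u) by d(-u) on that side. In [twist_conv] the diagonal p = q reproduces the untwisted
    sum, and all other terms lie in the ideal. *)
Lemma symm_sum_congr z1 z2 d k n : is_index k ->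
  (forall t, is_index t -> z1 t = twist d z2 t) ->
  (forall t, is_index t -> MZV_span (z2 t)) -> d 0%N = 1 ->
  (forall m, (0 < m)%N -> zeta2_ideal ((d * fps_neg d) m)) ->
  zeta2_ideal (\sum_(i < (size k).+1) z1 (rev (take i k)) *
      ((-1) ^+ sumn (drop i k) * pser z1 (drop i k) n) -
    \sum_(i < (size k).+1) z2 (rev (take i k)) *
      ((-1) ^+ sumn (drop i k) * pser z2 (drop i k) n)).
Proof.
move=> ik zE sz2 d0 dN; have [itk idk] := index_take_drop ik.
have rtk i : is_index (rev (take i k)) by rewrite /is_index all_rev; apply: itk.
rewrite [X in X - _](_ : _ = \sum_(p < (size k).+1) \sum_(q < (size k).+1 | ones_between k p q)
    (d * fps_neg d) (q - p)%N *
    (z2 (rev (take p k)) * ((-1) ^+ sumn (drop q k) * pser z2 (drop q k) n))); last first.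
  apply: (@twist_conv _ k d (fps_neg d) (fun i => z2 (rev (take i k)))
    (fun i => (-1) ^+ sumn (drop i k) * pser z2 (drop i k) n)
    (fun i => z1 (rev (take i k)))
    (fun i => (-1) ^+ sumn (drop i k) * pser z1 (drop i k) n)) => i ir.
    by rewrite zE // twist_take.
  rewrite (pser_ext n (idk i) zE) pser_twist // twist_drop // mulr_sumr.
  apply: eq_bigr => q ob; rewrite (ones_between_sumn ob) ?leq_ord // /fps_neg exprD.
  by rewrite !mulrA [(-1) ^+ (q - i) * d _ * _]mulrAC.
rewrite -sumrB; apply: zeta2_ideal_sum => p _ _.
rewrite (bigD1 p) /= ?ones_between_refl // subnn fpsME big_ord1 subn0 /fps_neg d0.
rewrite expr0 !mul1r addrAC subrr add0r; apply: zeta2_ideal_sum => q _ /andP[ob qp].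
rewrite mulrC; apply: zeta2_idealM; last first.
  apply: dN; rewrite subn_gt0 ltn_neqAle; case/andP: ob => -> _; rewrite andbT.
  by apply: contra qp => /eqP pq; apply/eqP/val_inj.
apply: spanM; first exact: sz2.
by apply: span_sign; apply: pser_span.
Qed.

Lemma symm_star_congr zs1 zs2 z1 z2 d k : is_index k ->
  (forall q, is_index q -> zs1 q = z1 (rev q)) ->
  (forall q, is_index q -> zs2 q = z2 (rev q)) ->
  (forall t, is_index t -> z1 t = twist d z2 t) -> fps_span d ->
  (forall t, is_index t -> MZV_span (z2 t)) -> d 0%N = 1 ->
  (forall m, (0 < m)%N -> zeta2_ideal ((d * fps_neg d) m)) ->
  series_eqmod_zeta2 (symm_star zs1 k) (symm_star zs2 k).
Proof.
move=> ik zs1E zs2E zE sd sz2 d0 dN n; have [itk idk] := index_take_drop ik.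
rewrite /symm_star (symm_sumE n ik zs1E) (symm_sumE n ik zs2E).
have sz1 t : is_index t -> MZV_span (z1 t) by move=> it; rewrite zE //; apply: twist_span.
have sS z : (forall t, is_index t -> MZV_span (z t)) -> MZV_span (\sum_(i < (size k).+1)
    z (rev (take i k)) * ((-1) ^+ sumn (drop i k) * pser z (drop i k) n)).
  move=> sz; apply: span_sum_fin => i _; apply: spanM.
    by apply: sz; rewrite /is_index all_rev; apply: itk.
  by apply: span_sign; apply: pser_span.
by split; [exact: (sS _ sz1) | exact: (sS _ sz2) | exact: (symm_sum_congr n ik zE)].
Qed.

Lemma eqmod_zeta2_sym (a b : R) : eqmod_zeta2 a b -> eqmod_zeta2 b a.
Proof.
case=> sa sb [c sc E]; split=> //; exists (- c); first exact: spanN.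
by rewrite -opprB E mulrN.
Qed.

Lemma eqmod_zeta2_trans (a b c : R) : eqmod_zeta2 a b -> eqmod_zeta2 b c -> eqmod_zeta2 a c.
Proof.
case=> sa _ [e se E] [_ sc [f sf F]]; split=> //; exists (e + f); first exact: spanD.
by rewrite mulrDr -E -F addrA subrK.
Qed.

End Congruence.

(** * The three star values as twists of one another *)

Section Comparison.
Variable R : realType.
Implicit Types k t : seq nat.

Lemma zeta_star_regE mul (z : seq nat -> R) k : is_index k ->
  (forall q, is_index q -> zeta_reg R mul q = z (rev q)) -> z [::] = 1 ->
  zeta_star_reg R mul k = star z (rev k).
Proof.
move=> ik zE z1; case: k ik => [|a k] ik; first by rewrite /star big_seq1.
have -> : zeta_star_reg R mul (a :: k) = \sum_(m <- cps (a :: k)) zeta_reg R mul m by [].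
rewrite /star -(perm_big _ (cps_rev (rev (a :: k)))) revK big_map.
by rewrite big_seq [RHS]big_seq; apply: eq_bigr => m mk; rewrite zE // (cps_index ik mk).
Qed.

Lemma harm_reg_twist t : is_index t -> harm_reg R t = twist (Cinf R) (shz R) t.
Proof.
move=> /index_ones[m [s [-> rs]]].
by rewrite (harm_reg_shz R m rs) twist_ones // radm_ohead.
Qed.

Lemma star_harm_twist t : is_index t ->
  star (harm_reg R) t = twist (Cinf R) (star (shz R)) t.
Proof.
move=> it; rewrite -star_twist // /star [LHS]big_seq [RHS]big_seq.
by apply: eq_bigr => m mt; rewrite harm_reg_twist // (cps_index it mt).
Qed.

Lemma shz_nil : shz R [::] = 1.
Proof. by rewrite /shz sh_reg_radm // zeta_nil. Qed.

(* Both sides satisfy the recursion [star_value_antipode]. *)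
Lemma star_value_twist t : is_index t ->
  star_value R (rev t) = twist (fps_neg (Cinf R)) (star (harm_reg R)) t.
Proof.
pose z t := twist (fps_neg (Cinf R)) (star (harm_reg R)) t.
have [_ _ C0 _] := CinfP R.
suff H k : is_index k -> star_value R k = z (rev k).
  by move=> it; rewrite H ?revK // /is_index all_rev.
have [n] := ubnP (size k); elim: n k => // n IHn k kn ik.
have [itk idk] := index_take_drop ik.
case: (eqVneq k [::]) => [->|k0].
  rewrite /z /star_value /= lext_sum_nil /fps_neg C0 expr0 !mul1r addr0 /star big_seq1.
  by rewrite harm_reg_nil; exact: shz_nil.
(* In the antipode relation of [harm_reg], writing the right factor as a twist of [shz] strips ones
   from it. Regrouped with the left factor, the sign (-1)^(q - p) turns [Cinf R] into
   [fps_neg (Cinf R)]. *)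
have zK : \sum_(i < (size k).+1) (-1) ^+ (size k - i)%N *
    (z (rev (take i k)) * shz R (drop i k)) = 0.
  have ir : is_index (rev k) by rewrite /is_index all_rev.
  rewrite -[RHS](star_antipode k0 ik (@harm_reg_char R) (harm_reg_nil R)).
  under [RHS]eq_bigr => i _ do
    rewrite (harm_reg_twist (idk i)) twist_drop ?leq_ord // !mulr_sumr.
  rewrite (exchange_big_dep xpredT) //=; apply: eq_bigr => q _.
  rewrite /z twist_take ?leq_ord // mulr_suml mulr_sumr.
  rewrite (big_ord_widen_cond (size k).+1 (fun p => ones_between k p q) (fun p =>
    (-1) ^+ (size k - q) * (fps_neg (Cinf R) (q - p)%N *
      star (harm_reg R) (rev (take p k)) * shz R (drop q k)))); last exact: ltn_ord.
  rewrite [LHS](eq_bigl (fun p : 'I_(size k).+1 => ones_between k p q)); last first.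
    by move=> p; rewrite /ones_between ltnS; case: (leqP p q); rewrite ?andbF ?andbT.
  apply: eq_bigr => p /andP[pq _].
  have -> : (size k - p = (size k - q) + (q - p))%N by have := leq_ord q; lia.
  by rewrite exprD /fps_neg; ring.
(* The term i = size k carries the value on [k] itself with coefficient 1; the proper prefixes agree
   by induction. *)
have := etrans (star_value_antipode R ik k0) (esym zK); rewrite !big_ord_recr /= subnn take_size drop_size.
rewrite shz_nil !mulr1 !expr0 !mul1r (eq_bigr (fun i : 'I_(size k) => (-1) ^+ (size k - i)%N *
    (z (rev (take i k)) * shz R (drop i k)))); first by move/addrI.
by move=> i _; rewrite IHn // size_takel; [exact: leq_trans (ltn_ord i) _ | exact: ltnW].
Qed.

Lemma span_star (z : seq nat -> R) t : (forall t, is_index t -> MZV_span (z t)) ->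
  is_index t -> MZV_span (star z t).
Proof. by move=> sz it; apply: span_sum => m mt _; apply: sz; apply: cps_index mt. Qed.

End Comparison.

Theorem theorem2p2 (R : realType) (k : seq nat) (hk : is_index k) :
  series_eqmod_zeta2 (symm_star (zeta_star_reg R harm) k)
                     (symm_star (zeta_star_reg R sh) k) /\
  series_eqmod_zeta2 (symm_star (zeta_star_reg R sh) k)
                     (symm_star (zeta_star_KY R) k).
Proof.
have [sC _ C0 _] := CinfP R.
have harmE q : is_index q -> zeta_star_reg R harm q = star (harm_reg R) (rev q).
  by move=> iq; apply: zeta_star_regE; [|exact: (Zreg_harmE R).2 | exact: harm_reg_nil].
have shE q : is_index q -> zeta_star_reg R sh q = star (shz R) (rev q).
  by move=> iq; apply: zeta_star_regE; [|move=> *; exact: zeta_reg_shE | exact: shz_nil].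
have KYE q : is_index q -> zeta_star_KY R q = star_value R (rev (rev q)).
  by move=> _; rewrite revK zeta_star_KYE.
have harm_sh : series_eqmod_zeta2 (symm_star (zeta_star_reg R harm) k)
    (symm_star (zeta_star_reg R sh) k).
  apply: (symm_star_congr hk harmE shE (@star_harm_twist R) sC) => //.
    by move=> t; apply: span_star; exact: shz_span.
  exact: Cinf_neg_ideal.
(* The Kaneko-Yamamoto values are compared with the harmonic ones, of which they are a single twist;
   the shuffle values follow by transitivity. *)
have KY_harm : series_eqmod_zeta2 (symm_star (zeta_star_KY R) k)
    (symm_star (zeta_star_reg R harm) k).
  have sN : fps_span (fps_neg (Cinf R)) by exact: fps_span_neg.
  apply: (symm_star_congr (z1 := fun t => star_value R (rev t)) hk KYE harmE
    (@star_value_twist R) sN).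
  - by move=> t; apply: span_star; exact: harm_reg_span.
  - by rewrite /fps_neg C0 mul1r.
  (* The twisting series is now C(-u), whose product with its own reflection is again C(u) C(-u). *)
  move=> m m0; have -> : fps_neg (fps_neg (Cinf R)) = Cinf R.
    by apply: fpsP => i; rewrite /fps_neg mulrA -expr2 sqrr_sign mul1r.
  by rewrite mulrC; exact: Cinf_neg_ideal.
split; [exact: harm_sh | move=> n].
exact: (eqmod_zeta2_trans (eqmod_zeta2_sym (harm_sh n)) (eqmod_zeta2_sym (KY_harm n))).
Qed.
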